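(* Consider the linear model $Y_i=X_i^{\top}\beta_*+\sigma\varepsilon_i$, $1\le i\le n$, and the estimator $\widehat\beta$ computed from 1-bit dithered quantized data (see context). For $R,L>0$ put $$\mathsf{err}(d,n,R,L)=\frac{2}{\lambda_{\min}(\Sigma)}\Bigg(\|\beta_*\|_2\sqrt{\frac{\{32dR^4+8dR^2\|\Sigma\|_{\mathrm{op}}\}\max\{\log n,\log(2d)\}}{n}}+\|\beta_*\|_2\frac{8(2d+1)R^2\max\{\log n,\log(2d)\}}{n}+\sqrt{\frac{4dR^2L^2\max\{\log(2d),\log n\}}{n}}\Bigg).$$ (I) (Fixed range.) Suppose all $|X_{ij}|$ are bounded by $R$ and all $|Y_i|$ are bounded by $L$, and the quantizer ranges are $[-R,R]$ (for predictor coordinates), $[0,R^2]$ (for their squares) and $[-L,L]$ (for responses). If $$n\ge\max\left\{\frac{512dR^4+128dR^2\|\Sigma\|_{\mathrm{op}}}{\lambda_{\min}^2(\Sigma)},\,32(2d+1)R^2\right\}\max\{\log n,\log(2d)\},$$ then $\|\widehat\beta-\beta_*\|_2\le\mathsf{err}(d,n,R,L)$ with probability at least $1-2/n$. (II) (Unbounded sub-Gaussian case.) Suppose the $X_i$ are i.i.d. zero-mean sub-Gaussian random vectors with unit-variance coordinates and covariance matrix $\Sigma$, and the $\varepsilon_i$ are i.i.d. zero-mean unit-variance sub-Gaussian random variables. Let the quantizer ranges be as in (I) with $$R=R_n=\sqrt{2C_K(q+1)\log(nd)},\qquad L=L_n=\Big(\sqrt{2(q+1)C_{\overline K}}\,\|\Sigma^{1/2}\beta_*\|_2+\sigma\sqrt{2(q+1)C_{K_\varepsilon}}\Big)\sqrt{\log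 n},\qquad q=3.$$ There is a constant $C>0$ depending only on $K,\overline K,K_\varepsilon$ such that if the condition on $n$ in (I) holds with $R=R_n$, and additionally $$n\ge C\big\{\lambda_{\min}^{-1}(\Sigma)\,d\,\max\{\|\Sigma^{1/2}\beta_*\|_2+\sigma,1\}\big\}^{2/3},$$ then $$\|\widehat\beta-\beta_*\|_2\le2\,\mathsf{err}(d,n,R_n,L_n)+O\!\left(\frac{d}{n^{3/2}}\right)$$ with probability at least $1-6/n-2/(nd)$, where the constant implied by $O(\cdot)$ does not depend on $n$ and $d$ (it may depend on $K,\overline K,K_\varepsilon,\lambda_{\min}(\Sigma),\|\beta_*\|_2,\|\Sigma^{1/2}\beta_*\|_2,\sigma$).
   Context: Model: $X_i\in\mathbb{R}^d$, $Y_i=X_i^{\top}\beta_*+\sigma\varepsilon_i$ with $\varepsilon_i$ i.i.d. zero-mean, unit-variance, independent of the $X_i$. Either the design is random: the $(X_i,Y_i)$ are i.i.d. copies of $(X,Y)$ with $\mathbf{E}[X]=0$, $\Sigma=\mathbf{E}[XX^{\top}]$; or the design is fixed: the $X_i$ are non-random and $\Sigma=\frac1n\sum_{i=1}^nX_iX_i^{\top}$. Part (I) covers both; part (II) is random design. $\Sigma$ is positive definite; $\lambda_{\min}$ is the smallest eigenvalue and $\|\cdot\|_{\mathrm{op}}$ the operator norm. Dithered 1-bit quantization: for a range $[\ell,u]$, the quantizer is the randomized map with values in $\{\ell,u\}$ which, for $z\in[\ell,u]$, outputs $u$ with probability $(z-\ell)/(u-\ell)$ and $\ell$ with probability $(u-z)/(u-\ell)$;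 for $z\notin[\ell,u]$ it outputs the endpoint nearest to $z$. $\widetilde X_i=(\widetilde X_{ij})_{j=1}^d$ is obtained by quantizing each $X_{ij}$ with range $[-R,R]$, $\widetilde{X_{ij}^2}$ by quantizing $X_{ij}^2$ with range $[0,R^2]$, and $\widetilde Y_i$ by quantizing $Y_i$ with range $[-L,L]$; the randomness used in all these quantizations is mutually independent and independent of the data. Estimator: $\widehat\Sigma=\frac1n\sum_{i=1}^n\{\widetilde X_i\widetilde X_i^{\top}+\mathrm{diag}(\widetilde{X_{i1}^2}-R^2,\ldots,\widetilde{X_{id}^2}-R^2)\}$, $\widehat\Sigma_{Xy}=\frac1n\sum_{i=1}^n\widetilde X_i\widetilde Y_i$, and $\widehat\beta=\mathrm{argmin}_{\beta\in\mathbb{R}^d}\{\frac12\beta^{\top}\widehat\Sigma\beta-\beta^{\top}\widehat\Sigma_{Xy}\}$, the unique minimizer when $\widehat\Sigma$ is positive definite (and arbitrarily defined otherwise). Sub-Gaussian norms: for a zero-mean random variable $Z$, $\|Z\|_{\psi_2}=\inf\{t>0:\mathbf{E}[\exp(Z^2/t^2)]\le2\}$; for a zero-mean random vector, $\|Z\|_{\psi_2}=\sup_{\|x\|_2=1}\|\langle Z,x\rangle\|_{\psi_2}$; sub-Gaussian means this is finite. $K=\max_{j}\|X_{1j}\|_{\psi_2}$, $\overline K=\|\Sigma^{-1/2}X_1\|_{\psi_2}$, $K_\varepsilon=\|\varepsilon_1\|_{\psi_2}$. For $\kappa>0$, $C_\kappa=C_0\kappa^2$, where $C_0>0$ is a universal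 constant such that $\mathbf{P}(|Z|\ge t)\le2\exp(-t^2/(2C_0\|Z\|_{\psi_2}^2))$ for all $t>0$ and all zero-mean sub-Gaussian $Z$. *)

(* Defs.v *)
From HB Require Import structures.
From mathcomp Require Import all_boot all_order all_algebra.
From mathcomp Require Import all_classical all_reals all_analysis.

Set Implicit Arguments.
Unset Strict Implicit.
Unset Printing Implicit Defensive.

Import Order.TTheory GRing.Theory Num.Theory.
Import numFieldNormedType.Exports.

Local Open Scope classical_set_scope.
Local Open Scope ring_scope.

Section Matrices.
Variable R : realType.

Definition norm2 (d : nat) (x : 'cV[R]_d) : R :=
  Num.sqrt (\sum_j x j 0 ^+ 2).

Definition dot (d : nat) (x y : 'cV[R]_d) : R := \sum_j x j 0 * y j 0.

Definition qform (d : nat) (A : 'M[R]_d) (x : 'cV[R]_d) : R := dot x (A *m x).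

Definition opnorm (d : nat) (A : 'M[R]_d) : R :=
  sup [set norm2 (A *m x) | x in [set x : 'cV[R]_d | norm2 x = 1]].

(* Only used on symmetric matrices of positive size, which have finitely many
   eigenvalues and at least one, so that the infimum is a minimum. *)
Definition lambda_min (d : nat) (A : 'M[R]_d) : R :=
  inf [set a : R | eigenvalue A a].

Definition posdefmx (d : nat) (A : 'M[R]_d) : Prop :=
  A^T = A /\ forall x : 'cV[R]_d, x != 0 -> 0 < qform A x.

Definition possemidefmx (d : nat) (A : 'M[R]_d) : Prop :=
  A^T = A /\ forall x : 'cV[R]_d, 0 <= qform A x.

(* A positive semi-definite A has exactly one positive semi-definite square
   root, which is the one picked here. *)
Definition sqrtmx (d : nat) (A : 'M[R]_d) : 'M[R]_d :=
  xget 0 [set B : 'M[R]_d | possemidefmx B /\ B *m B = A].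

Definition colvec (d : nat) (x : d.-tuple R) : 'cV[R]_d := \col_j tnth x j.

End Matrices.

Section Probability.
Context (R : realType) (dT : measure_display) (T : measurableType dT).
Variable P : probability T R.

(* The event E itself is not required to be measurable: the estimator below is
   arbitrary where the quadratic objective is not strictly convex. *)
Definition with_prob_at_least (p : R) (E : set T) : Prop :=
  exists A : set T, [/\ measurable A, A `<=` E & (p%:E <= P A)%E].

(* Laws are compared on measurable sets only, a measure being unspecified
   elsewhere. *)
Definition same_law (dU : measure_display) (U : measurableType dU)
    (X Y : {RV P >-> U}) : Prop :=
  forall B : set U, measurable B -> distribution P X B = distribution P Y B.

Definition sigma_field_of (dU : measure_display) (U : measurableType dU)
    (X : {RV P >-> U}) : set (set T) :=
  preimage_set_system [set: T] X measurable.

Definition mutually_independent (I : finType) (F : I -> set (set T)) : Prop :=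
  forall (J : {set I}) (A : I -> set T),
    (forall i, i \in J -> F i (A i)) ->
    (P (\bigcap_(i in [set i | i \in J]) A i) = \prod_(i in J) P (A i))%E.

Definition psi2 (Z : T -> R) : \bar R :=
  ereal_inf [set t%:E | t in [set t : R | 0 < t /\
    ('E_P[fun w => expR (Z w ^+ 2 / t ^+ 2)%R] <= 2%:E)%E]].

Definition psi2_vec (d : nat) (Z : T -> 'cV[R]_d) : \bar R :=
  ereal_sup [set psi2 (fun w => dot (Z w) x) |
    x in [set x : 'cV[R]_d | norm2 x = 1]].

End Probability.

Definition universal_tail_constant (R : realType) (C0 : R) : Prop :=
  0 < C0 /\
  forall (dT : measure_display) (T : measurableType dT) (P : probability T R)
    (Z : {RV P >-> R}),
    ('E_P[Z] = 0)%E -> (psi2 P Z < +oo)%E ->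
    forall t : R, 0 < t ->
      (P [set w | (t <= `|Z w|)%R] <=
        (2 * expR (- (t ^+ 2 / (2 * C0 * fine (psi2 P Z) ^+ 2))))%:E)%E.

Section Quantization.
Context (R : realType) (dT dS : measure_display).
Context (T : measurableType dT) (S : measurableType dS).
Variable P : probability T R.

(* A randomized map is a jointly measurable map Q z s of the input z and of the
   value s of a random element xi.  The third clause is void for a degenerate
   range l = u, where the output can only be l. *)
Definition dithered_quantizer (l u : R) (Q : R -> S -> R) (xi : {RV P >-> S}) :
    Prop :=
  [/\ measurable_fun [set: R * S] (fun zs : R * S => Q zs.1 zs.2),
      forall z s, Q z s = l \/ Q z s = u,
      (forall z, l < u -> l <= z <= u ->
        P [set w | Q z (xi w) = u] = ((z - l) / (u - l))%:E /\
        P [set w | Q z (xi w) = l] = ((u - z) / (u - l))%:E) &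
      forall z s, (z < l -> Q z s = l) /\ (u < z -> Q z s = u)].

End Quantization.

Section Model.
Context (R : realType) (dT dS : measure_display).
Context (T : measurableType dT) (S : measurableType dS).
Context (P : probability T R) (n d : nat).
Variables (X : 'I_n -> {RV P >-> d.-tuple R}) (eps : 'I_n -> {RV P >-> R}).

Definition random_design (Sigma : 'M[R]_d) : Prop :=
  [/\ forall i k, same_law (X i) (X k),
      forall i j, ('E_P[fun w => tnth (X i w) j] = 0)%E &
      forall i j k,
        ('E_P[fun w => (tnth (X i w) j * tnth (X i w) k)%R] = (Sigma j k)%:E)%E].

Definition fixed_design (Sigma : 'M[R]_d) : Prop :=
  exists2 x : 'I_n -> d.-tuple R,
    forall i w, X i w = x i &
    Sigma = n%:R^-1 *: \sum_i (colvec (x i) *m (colvec (x i))^T).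

Definition standardized_noise : Prop :=
  [/\ forall i k, same_law (eps i) (eps k),
      forall i, ('E_P[eps i] = 0)%E &
      forall i, 'V_P[eps i] = 1%E].

Variables (xiX xiX2 : 'I_n -> 'I_d -> {RV P >-> S}) (xiY : 'I_n -> {RV P >-> S}).

(* Mutual independence of the vectors X_i, of the errors eps_i and of the
   random inputs of all quantizers. This gives at once the independence of the
   data points, of design and noise, and of data and quantization. *)
Definition independent_model : Prop :=
  mutually_independent P
    (fun a : ('I_n + 'I_n) + (('I_n * 'I_d) + ('I_n * 'I_d) + 'I_n) =>
      match a with
      | inl (inl i) => sigma_field_of (X i)
      | inl (inr i) => sigma_field_of (eps i)
      | inr (inl (inl (i, j))) => sigma_field_of (xiX i j)
      | inr (inl (inr (i, j))) => sigma_field_of (xiX2 i j)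
      | inr (inr i) => sigma_field_of (xiY i)
      end).

Variables (QX QX2 QY : R -> S -> R).

Definition dithered_quantizers (r L : R) : Prop :=
  [/\ forall i j, dithered_quantizer (- r) r QX (xiX i j),
      forall i j, dithered_quantizer 0 (r ^+ 2) QX2 (xiX2 i j) &
      forall i, dithered_quantizer (- L) L QY (xiY i)].

Variables (beta : 'cV[R]_d) (sigma : R).

Definition response (i : 'I_n) (w : T) : R :=
  dot (colvec (X i w)) beta + sigma * eps i w.

Definition quantX (i : 'I_n) (w : T) : 'cV[R]_d :=
  \col_j QX (tnth (X i w) j) (xiX i j w).

Definition quantX2 (i : 'I_n) (w : T) : 'rV[R]_d :=
  \row_j QX2 (tnth (X i w) j ^+ 2) (xiX2 i j w).

Definition quantY (i : 'I_n) (w : T) : R := QY (response i w) (xiY i w).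

Definition Sigma_hat (r : R) (w : T) : 'M[R]_d :=
  n%:R^-1 *: \sum_i (quantX i w *m (quantX i w)^T +
                     diag_mx (quantX2 i w - const_mx (r ^+ 2))).

Definition Sigma_Xy_hat (w : T) : 'cV[R]_d :=
  n%:R^-1 *: \sum_i (quantY i w *: quantX i w).

Definition is_estimator (r : R) (beta_hat : T -> 'cV[R]_d) : Prop :=
  let obj w b := 2^-1 * qform (Sigma_hat r w) b - dot b (Sigma_Xy_hat w) in
  forall w, posdefmx (Sigma_hat r w) ->
    forall b : 'cV[R]_d, obj w (beta_hat w) <= obj w b.

Definition bounded_data (r L : R) : Prop :=
  (forall i j, {ae P, forall w, `|tnth (X i w) j| <= r}) /\
  (forall i, {ae P, forall w, `|response i w| <= L}).

End Model.

Section Rates.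
Context (R : realType) (n d : nat).

Definition log_max : R := Num.max (ln n%:R) (ln (2 * d)%:R).

Definition err (Sigma : 'M[R]_d) (beta : 'cV[R]_d) (r L : R) : R :=
  2 / lambda_min Sigma *
  (norm2 beta *
     Num.sqrt ((32 * d%:R * r ^+ 4 + 8 * d%:R * r ^+ 2 * opnorm Sigma) *
               log_max / n%:R) +
   norm2 beta * (8 * (2 * d + 1)%:R * r ^+ 2 * log_max / n%:R) +
   Num.sqrt (4 * d%:R * r ^+ 2 * L ^+ 2 * log_max / n%:R)).

Definition sample_size_condition (Sigma : 'M[R]_d) (r : R) : Prop :=
  Num.max
    ((512 * d%:R * r ^+ 4 + 128 * d%:R * r ^+ 2 * opnorm Sigma) /
       lambda_min Sigma ^+ 2)
    (32 * (2 * d + 1)%:R * r ^+ 2) * log_max <= n%:R.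

Definition Ckappa (C0 kappa : R) : R := C0 * kappa ^+ 2.

Definition range_X (C0 K : R) (q : nat) : R :=
  Num.sqrt (2 * Ckappa C0 K * q.+1%:R * ln (n * d)%:R).

(* s stands for the norm of Sigma^(1/2) beta. *)
Definition range_Y (C0 Kbar Keps s sigma : R) (q : nat) : R :=
  (Num.sqrt (2 * q.+1%:R * Ckappa C0 Kbar) * s +
   sigma * Num.sqrt (2 * q.+1%:R * Ckappa C0 Keps)) * Num.sqrt (ln n%:R).

End Rates.

(* Main.v *)
(* For every sample the quantizer outputs take finitely many values, and they
   are independent over the samples, so the estimator lives on a finite product
   space.  There the mean of one term of Sigma_hat is the second moment matrix
   of the clipped predictors, and the mean of one term of Sigma_Xy_hat is the
   cross moment of clipped predictor and clipped response; for bounded data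
   these are Sigma and Sigma beta on average.

   The first order condition bounds |beta_hat - beta| by
   |Sigma_Xy_hat - Sigma_hat beta| divided by the smallest eigenvalue of
   Sigma_hat.  The term A = r^2 (s s^T - D) of Sigma_hat, where s is a sign
   vector and D a 0/1 diagonal matrix, satisfies
   |A x|^2 <= 2 d r^2 <x, A x> + 4 d r^4 |x|^2, so that resampling one
   observation (the method of exchangeable pairs) gives a differential inequality
   for the trace exponential and with it a lower tail bound for the smallest
   eigenvalue.  The numerator is a sum of independent bounded vectors, for which
   E cosh (t |S|) satisfies a Bernstein recursion because y |-> cosh (sqrt y) is
   convex.

   For sub-Gaussian data clipping changes the moments only by O(n^-2): the
   probability that a variable leaves its range is at most 2 n^-4, and fourth
   moments are bounded. *)
Require Import Defs.
From HB Require Import structures.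
From mathcomp Require Import all_boot all_order all_algebra.
From mathcomp Require Import all_classical all_reals all_analysis.
From mathcomp Require Import measurable_realfun.
From mathcomp Require Import ring lra.

Set Implicit Arguments.
Unset Strict Implicit.
Unset Printing Implicit Defensive.

Import Order.TTheory GRing.Theory Num.Theory.
Import numFieldNormedType.Exports.

Local Open Scope classical_set_scope.
Local Open Scope ring_scope.

(** * Euclidean norm *)

(** The terms of [Sigma_hat] do not commute, so the exponential of their sum does not factor over
    observations. Resampling one observation only requires a trace inequality for two matrices, and
    expanding it in both eigenbases reduces it to the trapezoid rule for [expR]. The result is
    one-sided: the inequality for |A x|^2 produces a multiple of the derivative of the trace
    exponential, whose sign is favourable for lower tails. Hence the variance proxy 2 d r^2 g + 4 d
    r^4 involves the mean only through an upper bound g.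

    The numerator is not split: A beta - Y s is treated as one random vector, and Minkowski's
    inequality for its second moment gives the two square roots in [err].

    Quantizer outputs are bounded whatever the data are, so concentration is never conditioned on
    the data lying in range. Leaving the range costs bias only, and the failure probability 2/n
    serves both parts. Half of [lambda_min] is reserved for fluctuations. In the sub-Gaussian case
    another eighth goes to bias, and the factor 2 in front of [err] pays for that loss. *)

Section Dot.
Context {R : realType} {d : nat}.
Implicit Types (x y z : 'cV[R]_d) (A B : 'M[R]_d).

Lemma dotE x y : dot x y = (x^T *m y) 0 0.
Proof. by rewrite mxE; apply: eq_bigr => j _; rewrite mxE. Qed.

Lemma dotC x y : dot x y = dot y x.
Proof. by apply: eq_bigr => j _; rewrite mulrC. Qed.

Lemma dotDr x y z : dot x (y + z) = dot x y + dot x z.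
Proof. by rewrite !dotE mulmxDr mxE. Qed.

Lemma dotZr a x y : dot x (a *: y) = a * dot x y.
Proof. by rewrite !dotE -scalemxAr mxE. Qed.

Lemma dotDl x y z : dot (x + y) z = dot x z + dot y z.
Proof. by rewrite dotC dotDr !(dotC z). Qed.

Lemma dotZl a x y : dot (a *: x) y = a * dot x y.
Proof. by rewrite dotC dotZr dotC. Qed.

Lemma dotNr x y : dot x (- y) = - dot x y.
Proof. by rewrite -scaleN1r dotZr mulN1r. Qed.

Lemma dotNl x y : dot (- x) y = - dot x y.
Proof. by rewrite dotC dotNr dotC. Qed.

Lemma dotBr x y z : dot x (y - z) = dot x y - dot x z.
Proof. by rewrite dotDr dotNr. Qed.

Lemma dotBl x y z : dot (x - y) z = dot x z - dot y z.
Proof. by rewrite dotDl dotNl. Qed.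

Lemma dot0r x : dot x 0 = 0.
Proof. by rewrite -(scale0r 0) dotZr mul0r. Qed.

Lemma dot0l x : dot 0 x = 0.
Proof. by rewrite dotC dot0r. Qed.

Lemma dot_sumr (I : Type) (r : seq I) (P : pred I) (F : I -> 'cV[R]_d) x :
  dot x (\sum_(i <- r | P i) F i) = \sum_(i <- r | P i) dot x (F i).
Proof. exact: (big_morph (dot x) (dotDr x) (dot0r x)). Qed.

Lemma dot_suml (I : Type) (r : seq I) (P : pred I) (F : I -> 'cV[R]_d) x :
  dot (\sum_(i <- r | P i) F i) x = \sum_(i <- r | P i) dot (F i) x.
Proof. by rewrite dotC dot_sumr; apply: eq_bigr => i _; rewrite dotC. Qed.

Lemma dot_mulmx A x y : dot x (A *m y) = dot (A^T *m x) y.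
Proof. by rewrite !dotE trmx_mul trmxK mulmxA. Qed.

Lemma dotxx_ge0 x : 0 <= dot x x.
Proof. by apply: sumr_ge0 => j _; rewrite -expr2 sqr_ge0. Qed.

Lemma dotxx_eq0 x : (dot x x == 0) = (x == 0).
Proof.
apply/idP/eqP => [|->]; last by rewrite dot0r.
rewrite psumr_eq0; last by move=> j _; rewrite -expr2 sqr_ge0.
move=> /allP h; apply/colP => j; have := h j (mem_index_enum j).
by rewrite mulf_eq0 orbb mxE => /eqP.
Qed.

Lemma norm2_sqr x : norm2 x ^+ 2 = dot x x.
Proof.
rewrite sqr_sqrtr; first by apply: eq_bigr => j _; rewrite expr2.
by apply: sumr_ge0 => j _; rewrite sqr_ge0.
Qed.

Lemma norm2E x : norm2 x = Num.sqrt (dot x x).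
Proof. by rewrite -norm2_sqr sqrtr_sqr ger0_norm // sqrtr_ge0. Qed.

Lemma norm2_ge0 x : 0 <= norm2 x. Proof. exact: sqrtr_ge0. Qed.

Lemma norm2_eq0 x : (norm2 x == 0) = (x == 0).
Proof. by rewrite -dotxx_eq0 -norm2_sqr sqrf_eq0. Qed.

Lemma norm20 : norm2 (0 : 'cV[R]_d) = 0.
Proof. by apply/eqP; rewrite norm2_eq0. Qed.

Lemma norm2Z a x : norm2 (a *: x) = `|a| * norm2 x.
Proof.
by rewrite !norm2E dotZl dotZr mulrA -expr2 sqrtrM ?sqr_ge0 // sqrtr_sqr.
Qed.

Lemma norm2N x : norm2 (- x) = norm2 x.
Proof. by rewrite -scaleN1r norm2Z normrN1 mul1r. Qed.

Lemma cauchy_schwarz x y : dot x y <= norm2 x * norm2 y.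
Proof.
have [->|x0] := eqVneq x 0; first by rewrite dot0l norm20 mul0r.
have [->|y0] := eqVneq y 0; first by rewrite dot0r norm20 mulr0.
have nx : 0 < norm2 x by rewrite lt_neqAle eq_sym norm2_eq0 x0 norm2_ge0.
have ny : 0 < norm2 y by rewrite lt_neqAle eq_sym norm2_eq0 y0 norm2_ge0.
have := dotxx_ge0 (norm2 y *: x - norm2 x *: y).
rewrite dotBl !dotBr !dotZl !dotZr -!norm2_sqr (dotC y x) => h.
have {}h : 0 <= (2 * norm2 x * norm2 y) * (norm2 x * norm2 y - dot x y) by lra.
have {}h := le_trans h (lexx _).
by move: h; rewrite pmulr_rge0 ?subr_ge0 // !mulr_gt0.
Qed.

Lemma cauchy_schwarz_abs x y : `|dot x y| <= norm2 x * norm2 y.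
Proof.
rewrite ler_norml cauchy_schwarz andbT lerNl -dotNl.
by rewrite -(norm2N x) cauchy_schwarz.
Qed.

Lemma norm2D x y : norm2 (x + y) <= norm2 x + norm2 y.
Proof.
rewrite -ler_sqr ?nnegrE ?addr_ge0 ?norm2_ge0 // norm2_sqr.
rewrite dotDl !dotDr -!norm2_sqr (dotC y x) sqrrD.
by have := cauchy_schwarz x y; lra.
Qed.

Lemma norm2B x y : norm2 (x - y) <= norm2 x + norm2 y.
Proof. by rewrite -(norm2N y) norm2D. Qed.

Lemma norm2_sum (I : Type) (r : seq I) (P : pred I) (F : I -> 'cV[R]_d) :
  norm2 (\sum_(i <- r | P i) F i) <= \sum_(i <- r | P i) norm2 (F i).
Proof.
elim/big_rec2: _ => [|i y x _ h]; first by rewrite norm20.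
by rewrite (le_trans (norm2D _ _)) // lerD2l.
Qed.

Lemma dot_delta x j : dot x (delta_mx j 0) = x j 0.
Proof.
rewrite /dot (bigD1 j) //= mxE !eqxx mulr1 big1 ?addr0 // => k kj.
by rewrite mxE (negbTE kj) mulr0.
Qed.

Lemma abs_coord_le_norm2 x j : `|x j 0| <= norm2 x.
Proof.
rewrite -dot_delta (le_trans (cauchy_schwarz_abs _ _)) //.
by rewrite [norm2 (delta_mx _ _)]norm2E dot_delta mxE !eqxx sqrtr1 mulr1.
Qed.

Definition orthonormal_family (u : 'I_d -> 'cV[R]_d) :=
  forall j k, dot (u j) (u k) = (j == k)%:R.

(** The rows of [U] are orthonormal, and a right inverse of a square matrix is also a left inverse,
    so the family is complete. *)
Lemma parseval (u : 'I_d -> 'cV[R]_d) x y : orthonormal_family u ->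
  dot x y = \sum_k dot (u k) x * dot (u k) y.
Proof.
move=> ou; pose U : 'M[R]_d := \matrix_(k, j) u k j 0.
have dU z k : (U *m z) k 0 = dot (u k) z.
  by rewrite mxE; apply: eq_bigr => j _; rewrite mxE.
have UU : U *m U^T = 1%:M.
  apply/matrixP => i j; rewrite mxE [RHS]mxE -ou.
  by apply: eq_bigr => k _; rewrite !mxE.
have VV : U^T *m U = 1%:M by rewrite mulmx1C.
rewrite -[y in LHS]mul1mx -VV -mulmxA dot_mulmx trmxK.
by apply: eq_bigr => k _; rewrite !dU.
Qed.

Lemma parseval_norm (u : 'I_d -> 'cV[R]_d) x : orthonormal_family u ->
  norm2 x ^+ 2 = \sum_k dot (u k) x ^+ 2.
Proof. by move=> ou; rewrite norm2_sqr (parseval x x ou). Qed.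

End Dot.

(** * Spectral theorem *)

Section Spectral.
Context {R : realType} {d : nat}.
Implicit Types (x y v w : 'cV[R]_d) (A : 'M[R]_d).

(** First-order condition without derivatives. At t = b / e the form equals b^2 (2 e + c) / e^2, and
    e = |c| + 1 makes 2 e + c positive. It serves both the Rayleigh quotient and the minimality of
    the estimator. *)
Lemma quadratic_le0_lin_eq0 (b c : R) :
  (forall t, 2 * t * b + t ^+ 2 * c <= 0) -> b = 0.
Proof.
move=> h; set e := `|c| + 1.
have e0 : 0 < e by rewrite /e ltr_wpDl.
have ene0 : e != 0 by rewrite gt_eqF.
have := h (b / e).
have -> : 2 * (b / e) * b + (b / e) ^+ 2 * c = (b ^+ 2 * (2 * e + c)) / e ^+ 2.
  by field.
rewrite pmulr_lle0 ?invr_gt0 ?exprn_gt0 // pmulr_lle0; last first.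
  by rewrite /e; have := lerNnormlW (lexx `|c|); have := normr_ge0 c; lra.
by move=> hb; apply/eqP; rewrite -sqrf_eq0 eq_le hb sqr_ge0.
Qed.

(** The vectors are the columns of a d x k matrix, whose left kernel has dimension at least d - k >
    0. *)
Lemma exists_orthogonal (k : nat) (u : nat -> 'cV[R]_d) : (k < d)%N ->
  exists2 x, x != 0 & forall i, (i < k)%N -> dot (u i) x = 0.
Proof.
move=> kd; pose U : 'M[R]_(d, k) := \matrix_(i, j) u j i 0.
have : kermx U != 0.
  by rewrite -mxrank_eq0 mxrank_ker -lt0n subn_gt0 (leq_ltn_trans (rank_leq_col U)).
rewrite -submx0 => /row_subPn [i]; rewrite submx0 => r0.
exists (row i (kermx U))^T.
  by apply: contra_neq r0 => h; rewrite -[LHS]trmxK h trmx0.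
move=> j jk; have := congr1 (fun M : 'M[R]_(d, k) => M i (Ordinal jk)) (mulmx_ker U).
rewrite [in X in _ = X]mxE mxE => <-; rewrite dotC.
by apply: eq_bigr => l _; rewrite !mxE.
Qed.

Lemma continuous_dot (f g : 'rV[R]_d -> 'cV[R]_d) :
  (forall j, continuous (fun z => f z j 0)) ->
  (forall j, continuous (fun z => g z j 0)) ->
  continuous (fun z => dot (f z) (g z)).
Proof.
move=> cf cg; rewrite /dot; apply: continuous_big => //=.
  by move=> z; exact: add_continuous.
by move=> j _ z; apply: continuousM; [exact: (cf j z)|exact: (cg j z)].
Qed.

Lemma continuous_tr j : continuous (fun z : 'rV[R]_d => z^T j 0).
Proof.
have -> : (fun z : 'rV[R]_d => z^T j 0) = (fun z => z 0 j).
  by apply/funext => z; rewrite mxE.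
exact: coord_continuous.
Qed.

Lemma continuous_mulmx_tr A j : continuous (fun z : 'rV[R]_d => (A *m z^T) j 0).
Proof.
have -> : (fun z : 'rV[R]_d => (A *m z^T) j 0) =
    (fun z => dot (A^T *m delta_mx j 0) z^T).
  by apply/funext => z; rewrite -dot_mulmx dotC dot_delta.
apply: continuous_dot => l; first exact: cst_continuous.
exact: continuous_tr.
Qed.

(* Maximising the Rayleigh quotient over the unit vectors orthogonal to the
   eigenvectors already found. *)
Lemma next_eigenvector A (k : nat) (u : nat -> 'cV[R]_d) (a : nat -> R) :
  A^T = A -> (k < d)%N ->
  (forall i, (i < k)%N -> A *m u i = a i *: u i) ->
  exists v mu, [/\ dot v v = 1, forall i, (i < k)%N -> dot (u i) v = 0 &
    A *m v = mu *: v].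
Proof.
move=> sA kd Au.
pose K := [set z : 'rV[R]_d | dot z^T z^T = 1 /\
  forall i, (i < k)%N -> dot (u i) z^T = 0].
have K0 : K !=set0.
  have [x x0 ux] := exists_orthogonal u kd.
  have nx : norm2 x != 0 by rewrite norm2_eq0.
  exists ((norm2 x)^-1 *: x)^T; rewrite /K /= trmxK; split.
    by rewrite dotZl dotZr -norm2_sqr; field.
  by move=> i ik; rewrite dotZr ux ?mulr0.
(* [K] is closed, and the coordinates of a unit vector lie in [-1, 1], so [K] sits in a compact
   cube. *)
have cK : compact K.
  apply: (@subclosed_compact _ K
     [set z : 'rV[R]_d | forall i, `[(-1 : R), 1]%classic (z ord0 i)]).
  - have -> : K = (fun z : 'rV[R]_d => dot z^T z^T) @^-1` [set 1] `&`
        \bigcap_(i in [set i | (i < k)%N])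
          (fun z : 'rV[R]_d => dot (u i) z^T) @^-1` [set 0] by [].
    apply: closedI.
      apply: preimage_closed; last exact: closed_eq.
      by move=> z _; apply: continuous_dot => j; exact: continuous_tr.
    apply: closed_bigI => i _; apply: preimage_closed; last exact: closed_eq.
    move=> z _; apply: continuous_dot => j; last exact: continuous_tr.
    exact: cst_continuous.
  - apply: (@rV_compact R d (fun=> `[(-1 : R), 1]%classic)).
    by move=> _; exact: segment_compact.
  - move=> z [z1 _] i /=; rewrite in_itv /= -ler_norml.
    have := abs_coord_le_norm2 z^T i.
    by rewrite norm2E z1 sqrtr1 mxE.
have [v0 vK vmax] := @compact_EVT_max _ R
  (fun z : 'rV[R]_d => dot z^T (A *m z^T)) K K0 cK (continuous_subspaceT
   (continuous_dot (fun j => @continuous_tr j) (fun j => @continuous_mulmx_tr A j))).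
move: vK; rewrite inE => -[v1 uv].
set v := v0^T in v1 uv vmax *.
set mu := dot v (A *m v) in vmax.
have ray x : (forall i, (i < k)%N -> dot (u i) x = 0) ->
    dot x (A *m x) <= mu * dot x x.
  move=> ux; have [->|x0] := eqVneq x 0; first by rewrite !dot0l mulr0.
  have nx : norm2 x != 0 by rewrite norm2_eq0.
  have /vmax : ((norm2 x)^-1 *: x)^T \in K.
    rewrite inE /K /= trmxK; split.
      by rewrite dotZl dotZr -norm2_sqr; field.
    by move=> i ik; rewrite dotZr ux ?mulr0.
  rewrite trmxK -scalemxAr dotZl dotZr mulrA -expr2 exprVn norm2_sqr.
  by rewrite ler_pdivrMl ?(mulrC _ mu) // lt_neqAle dotxx_ge0 eq_sym dotxx_eq0 x0.
exists v, mu; split=> //; apply/eqP; rewrite -subr_eq0 -dotxx_eq0.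
(* The residual [w] has to vanish. It is orthogonal to [v] and to the earlier eigenvectors, so after
   normalisation v + t w competes in the maximisation for every t. Stationarity at t = 0 gives <w, A
   v> = 0, hence <w, w> = 0. *)
have [w wE] : exists w, w = A *m v - mu *: v by exists (A *m v - mu *: v).
rewrite -wE.
have uw i : (i < k)%N -> dot (u i) w = 0.
  by move=> ik; rewrite wE dotBr dotZr uv // mulr0 subr0 dot_mulmx sA Au // dotZl uv // mulr0.
have vw : dot w v = 0.
  by rewrite wE dotBl dotZl v1 mulr1 dotC subrr.
suff wAv : dot w (A *m v) = 0 by rewrite {2}wE dotBr dotZr wAv vw mulr0 subr0.
apply: (@quadratic_le0_lin_eq0 _ (dot w (A *m w) - mu * dot w w)) => t.
have := ray (v + t *: w).
rewrite mulmxDr -scalemxAr !dotDl !dotDr !dotZl !dotZr v1 (dotC v w) vw.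
rewrite (dot_mulmx A v w) sA (dotC (A *m v)) -/mu => h.
suff : mu + t * dot w (A *m v) + (t * dot w (A *m v) + t * (t * dot w (A *m w)))
   <= mu * (1 + t * 0 + (t * 0 + t * (t * dot w w))). by lra.
by apply: h => i ik; rewrite dotDr dotZr uv // uw // mulr0 addr0.
Qed.

Lemma spectral_theorem A : A^T = A ->
  exists (u : 'I_d -> 'cV[R]_d) (a : 'I_d -> R),
    orthonormal_family u /\ forall j, A *m u j = a j *: u j.
Proof.
move=> sA.
(* Indexing by [nat] lets the family grow during the induction; only its first k values are
   constrained. *)
have H (k : nat) : (k <= d)%N -> exists (u : nat -> 'cV[R]_d) (a : nat -> R),
    (forall i j, (i < k)%N -> (j < k)%N -> dot (u i) (u j) = (i == j)%:R) /\
    (forall i, (i < k)%N -> A *m u i = a i *: u i).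
  elim: k => [_|k IH kd]; first by exists (fun=> 0), (fun=> 0); split.
  have [u [a [ou Au]]] := IH (ltnW kd).
  have [v [mu [v1 uv Av]]] := next_eigenvector sA kd Au.
  exists (fun i => if (i < k)%N then u i else v),
         (fun i => if (i < k)%N then a i else mu).
  split=> [i j|i]; last by rewrite ltnS; case: ltnP => // ik _; exact: Au.
  rewrite !ltnS => ilek jlek.
  case: ltnP => ik; case: ltnP => jk.
  - exact: ou.
  - by rewrite uv // (_ : j = k) ?(ltn_eqF ik) //; apply/eqP; rewrite eqn_leq jlek.
  - by rewrite dotC uv // (_ : i = k) ?(gtn_eqF jk) //; apply/eqP; rewrite eqn_leq ilek.
  - rewrite v1 (_ : i = j) ?eqxx //; apply/eqP.
    by rewrite eqn_leq (leq_trans ilek) // (leq_trans jlek).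
have [u [a [ou Au]]] := H d (leqnn d).
exists u, a; split=> [j k|j]; last exact: Au.
by rewrite ou.
Qed.

End Spectral.

(** * Smallest eigenvalue, operator norm and trace exponential *)

Section SymmetricMatrices.
Context {R : realType} {d : nat}.
Implicit Types (x y v w : 'cV[R]_d) (A B : 'M[R]_d).

Lemma qform_eigenbasis A (u : 'I_d -> 'cV[R]_d) (a : 'I_d -> R) x :
  A^T = A -> orthonormal_family u -> (forall j, A *m u j = a j *: u j) ->
  qform A x = \sum_k a k * dot (u k) x ^+ 2.
Proof.
move=> sA ou Au; rewrite /qform (parseval _ _ ou); apply: eq_bigr => k _.
by rewrite dot_mulmx sA Au dotZl mulrCA expr2.
Qed.

Lemma orthonormal_basis_ex x (u : 'I_d -> 'cV[R]_d) : orthonormal_family u ->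
  x != 0 -> exists k, dot (u k) x != 0.
Proof.
move=> ou; apply: contra_neqP => /forallNP h.
apply/eqP; rewrite -norm2_eq0 -sqrf_eq0 (parseval_norm _ ou) big1 // => k _.
by have /negP := h k; rewrite negbK => /eqP ->; rewrite expr0n.
Qed.

(** The eigenvalues are exactly the numbers [a k], so their infimum is at least a positive minimum
    and at most each [a k]. The quadratic form is then compared termwise in the eigenbasis. The
    transposes appear because [eigenvalue] speaks of row vectors. *)
Lemma lambda_minP A : (0 < d)%N -> posdefmx A ->
  0 < lambda_min A /\
  forall x, lambda_min A * norm2 x ^+ 2 <= qform A x.
Proof.
move=> d0 [sA pA]; have [u [a [ou Au]]] := spectral_theorem sA.
have u0 k : u k != 0 by rewrite -dotxx_eq0 ou eqxx oner_eq0.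
have a0 k : 0 < a k.
  by have := pA _ (u0 k); rewrite /qform Au dotZr ou eqxx mulr1.
pose E := [set t : R | eigenvalue A t].
have Ea k : E (a k).
  apply/eigenvalueP; exists (u k)^T.
    by rewrite -[LHS]trmxK trmx_mul trmxK sA Au linearZ.
  by apply: contra_neq (u0 k) => h; rewrite -[LHS]trmxK h trmx0.
have aE t : E t -> exists k, t = a k.
  move=> /eigenvalueP [v vA v0].
  have Av : A *m v^T = t *: v^T by rewrite -[LHS]trmxK trmx_mul trmxK sA vA linearZ.
  have v0' : v^T != 0 by apply: contra_neq v0 => h; rewrite -[LHS]trmxK h trmx0.
  have [k uk] := orthonormal_basis_ex ou v0'.
  exists k; apply: (mulIf uk).
  by rewrite -dotZr -Av dot_mulmx sA Au dotZl.
have i0 : 'I_d := Ordinal d0.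
pose m := \big[Num.min/a i0]_k a k.
have am k : m <= a k by apply: bigmin_le.
have m0 : 0 < m by apply: lt_bigmin.
have mE : m <= lambda_min A.
  apply: lb_le_inf; first by exists (a i0); exact: Ea.
  by move=> t /aE [k ->].
split; first exact: lt_le_trans mE.
move=> x; rewrite (qform_eigenbasis _ sA ou Au) (parseval_norm _ ou) mulr_sumr.
apply: ler_sum => k _; apply: ler_wpM2r; first exact: sqr_ge0.
apply: ge_inf; last exact: Ea.
by exists m => t /aE [j ->].
Qed.

(** Rayleigh quotient at a basis vector. It leads to [lambda_min] <= r^2, which turns the condition
    on n into absolute lower bounds. *)
Lemma lambda_min_le_diag A j : posdefmx A -> lambda_min A <= A j j.
Proof.
move=> pA; have d0 : (0 < d)%N by case: d j => // -[].
have [_ /(_ (delta_mx j 0))] := lambda_minP d0 pA.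
rewrite norm2_sqr dot_delta mxE !eqxx mulr1 /qform dotC dot_delta mxE.
by rewrite -/(dot (\col_k A j k) (delta_mx j 0)) => /le_trans; apply;
  rewrite (bigD1 j) //= mxE !eqxx mulr1 big1 ?addr0 // => k kj;
  rewrite mxE (negbTE kj) mulr0.
Qed.

(** A crude bound, whose purpose is that the supremum in [opnorm] is taken over a bounded set. *)
Lemma norm2_mulmx_bounded A : exists M, forall x, norm2 x = 1 -> norm2 (A *m x) <= M.
Proof.
exists (\sum_k norm2 (col k A)) => x x1.
have -> : A *m x = \sum_k x k 0 *: col k A.
  apply/colP => i; rewrite summxE mxE; apply: eq_bigr => k _.
  by rewrite !mxE mulrC.
rewrite (le_trans (norm2_sum _ _ _)) //; apply: ler_sum => k _.
rewrite norm2Z -[leRHS]mul1r ler_wpM2r ?norm2_ge0 //.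
by rewrite -x1 abs_coord_le_norm2.
Qed.

Lemma norm2_mulmx_le_opnorm A x : norm2 (A *m x) <= opnorm A * norm2 x.
Proof.
have [->|x0] := eqVneq x 0; first by rewrite mulmx0 norm20 mulr0.
have nx0 : norm2 x != 0 by rewrite norm2_eq0.
have nx : 0 < norm2 x by rewrite lt_neqAle eq_sym nx0 norm2_ge0.
rewrite -ler_pdivrMr // mulrC.
have -> : (norm2 x)^-1 * norm2 (A *m x) = norm2 (A *m ((norm2 x)^-1 *: x)).
  by rewrite -scalemxAr norm2Z ger0_norm // invr_ge0 norm2_ge0.
have [M hM] := norm2_mulmx_bounded A.
apply: ub_le_sup; first by exists M => _ [y y1 <-]; exact: hM.
exists ((norm2 x)^-1 *: x) => //=.
by rewrite norm2Z ger0_norm ?invr_ge0 ?norm2_ge0 // mulVf.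
Qed.

Lemma qform_le_opnorm A x : qform A x <= opnorm A * norm2 x ^+ 2.
Proof.
rewrite (le_trans (cauchy_schwarz _ _)) // expr2 mulrA mulrC.
by rewrite ler_wpM2r ?norm2_ge0 // norm2_mulmx_le_opnorm.
Qed.

Lemma opnorm_ge0 A : (0 < d)%N -> 0 <= opnorm A.
Proof.
move=> d0; have := norm2_mulmx_le_opnorm A (delta_mx (Ordinal d0) 0).
rewrite [X in _ * X]norm2E dot_delta mxE !eqxx sqrtr1 mulr1.
exact: le_trans (norm2_ge0 _).
Qed.

(** [sqrtmx] is a choice from a set, so its properties follow once the set has an element: [B], with
    eigenvalues sqrt (a k) in an eigenbasis of [A]. *)
Lemma sqrtmxP A : posdefmx A ->
  [/\ (sqrtmx A)^T = sqrtmx A, sqrtmx A *m sqrtmx A = A & sqrtmx A \in unitmx].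
Proof.
move=> [sA pA]; have [u [a [ou Au]]] := spectral_theorem sA.
have u0 k : u k != 0 by rewrite -dotxx_eq0 ou eqxx oner_eq0.
have a0 k : 0 <= a k.
  by have := pA _ (u0 k); rewrite /qform Au dotZr ou eqxx mulr1 => /ltW.
pose B : 'M[R]_d := \sum_k Num.sqrt (a k) *: (u k *m (u k)^T).
have uux k x : (u k *m (u k)^T) *m x = dot (u k) x *: u k.
  rewrite -mulmxA [(u k)^T *m x]mx11_scalar -dotE.
  by rewrite mul_mx_scalar.
have Bx x : B *m x = \sum_k (Num.sqrt (a k) * dot (u k) x) *: u k.
  by rewrite mulmx_suml; apply: eq_bigr => k _; rewrite -scalemxAl uux scalerA.
have sB : B^T = B.
  rewrite linear_sum; apply: eq_bigr => k _.
  by rewrite linearZ /= trmx_mul trmxK.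
have Bu k : B *m u k = Num.sqrt (a k) *: u k.
  rewrite Bx (bigD1 k) //= ou eqxx mulr1 big1 ?addr0 // => j jk.
  by rewrite ou (negbTE jk) mulr0 scale0r.
have eq_basis (C D : 'M[R]_d) : (forall k, C *m u k = D *m u k) -> C = D.
  move=> CD; apply/matrixP => i j.
  have : dot (delta_mx i 0) (C *m delta_mx j 0) = dot (delta_mx i 0) (D *m delta_mx j 0).
    rewrite !(dot_mulmx _ (delta_mx i 0)) !(parseval _ _ ou).
    apply: eq_bigr => k _; congr (_ * _).
    by rewrite !(dotC (u k)) -!dot_mulmx CD.
  by rewrite !(dotC (delta_mx i 0)) !dot_delta -!colE !mxE.
have BB : B *m B = A.
  apply: eq_basis => k; rewrite -mulmxA Bu -scalemxAr Bu scalerA -expr2.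
  by rewrite sqr_sqrtr // Au.
have pB x : 0 <= qform B x.
  rewrite (qform_eigenbasis _ sB ou Bu); apply: sumr_ge0 => k _.
  by rewrite mulr_ge0 ?sqrtr_ge0 ?sqr_ge0.
have hB : [set C : 'M[R]_d | possemidefmx C /\ C *m C = A] B by [].
have [[sS _] SS] : [set C : 'M[R]_d | possemidefmx C /\ C *m C = A] (sqrtmx A).
  exact: (@xgetI _ 0 _ B hB).
split=> //; have : sqrtmx A *m sqrtmx A \in unitmx; last by rewrite unitmx_mul => /andP [].
rewrite SS.
rewrite -row_free_unit -kermx_eq0; apply/rowV0P => v /sub_kermxP vA.
apply/eqP/negPn/negP => v0.
have v0' : v^T != 0 by apply: contra_neq v0 => h; rewrite -[LHS]trmxK h trmx0.
have := pA _ v0'; rewrite /qform dotE trmxK mulmxA vA mul0mx mxE ltxx //.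
Qed.

Lemma ler_of_derive_ge0 (f df : R -> R) (s : R) : 0 <= s ->
  (forall t : R, is_derive t (1 : R) f (df t)) ->
  (forall t, 0 < t < s -> 0 <= df t) -> f 0 <= f s.
Proof.
rewrite le_eqVlt => /predU1P [<- //|s0] dfE df0.
have [|c cs e] := @MVT R f df 0 s s0 (fun t _ => dfE t).
  apply: continuous_subspaceT => t; apply: differentiable_continuous.
  by apply/derivable1_diffP; have [] := dfE t.
by rewrite -subr_ge0 e subr0 mulr_ge0 ?(ltW s0) // df0.
Qed.

(** Trapezoid rule for the convex function [expR] on [0, s]. The derivative of the difference is
    nonnegative because exp (-t) >= 1 - t. *)
Lemma exp_trapezoid (s : R) : 0 <= s -> 2 * (expR s - 1) <= s * (expR s + 1).
Proof.
move=> s0; rewrite -subr_ge0.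
pose f t : R := (t - 2) * expR t + t + 2.
have -> : s * (expR s + 1) - 2 * (expR s - 1) = f s by rewrite /f; ring.
have f0 : f 0 = 0 by rewrite /f expR0; ring.
rewrite -f0; apply: (@ler_of_derive_ge0 f (fun t => (t - 1) * expR t + 1)) => //.
  by move=> t; rewrite /f; apply: is_derive_eq; rewrite /GRing.scale /=; ring.
move=> t _; have := expR_ge1Dx (- t); rewrite expRN.
by rewrite -[leRHS]div1r ler_pdivlMr ?expR_gt0 //; lra.
Qed.

(** The trapezoid rule on the interval between b and a; the inequality is symmetric in a and b. *)
Lemma exp_mean_value (a b : R) :
  (a - b) * (expR a - expR b) <= 2^-1 * ((a - b) ^+ 2 * (expR a + expR b)).
Proof.
wlog ba : a b / b <= a.
  move=> h; case: (leP b a) => [/h //|/ltW/h].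
  by rewrite -[in leLHS]opprB mulNr -mulrN opprB -sqrrN opprB (addrC (expR b)).
have [s s0 ->] : exists2 s : R, 0 <= s & a = b + s.
  by exists (a - b); [rewrite subr_ge0|ring].
rewrite expRD; have := exp_trapezoid s0 => h.
rewrite -subr_ge0.
have -> : 2^-1 * ((b + s - b) ^+ 2 * (expR b * expR s + expR b)) -
  (b + s - b) * (expR b * expR s - expR b) =
  2^-1 * s * expR b * (s * (expR s + 1) - 2 * (expR s - 1)) by field.
by rewrite !mulr_ge0 ?expR_ge0 ?invr_ge0 // subr_ge0.
Qed.

(* Both sides become double sums over pairs of eigenvectors weighted by
   [dot (u j) (w k) ^+ 2], so that only the scalar inequality is needed. *)
Lemma trace_exp_mean_value A B (u w : 'I_d -> 'cV[R]_d) (a b : 'I_d -> R) :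
  A^T = A -> B^T = B -> orthonormal_family u -> orthonormal_family w ->
  (forall j, A *m u j = a j *: u j) -> (forall k, B *m w k = b k *: w k) ->
  \sum_j expR (a j) * qform (A - B) (u j) -
  \sum_k expR (b k) * qform (A - B) (w k) <=
  2^-1 * (\sum_j expR (a j) * norm2 ((A - B) *m u j) ^+ 2 +
          \sum_k expR (b k) * norm2 ((A - B) *m w k) ^+ 2).
Proof.
move=> sA sB ou ow Au Bw.
pose c j k := dot (u j) (w k).
have cu j k : dot ((A - B) *m u j) (w k) = (a j - b k) * c j k.
  by rewrite mulmxBl dotBl Au dotZl -[in dot (B *m _) _]sB -dot_mulmx Bw dotZr mulrBl.
have cw j k : dot (u j) ((A - B) *m w k) = (a j - b k) * c j k.
  by rewrite dot_mulmx linearB /= sA sB cu.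
have qu j : qform (A - B) (u j) = \sum_k (a j - b k) * c j k ^+ 2.
  rewrite /qform (parseval _ _ ow); apply: eq_bigr => k _.
  by rewrite (dotC (w k)) (dotC (w k)) cu -/(c j k); ring.
have qw k : qform (A - B) (w k) = \sum_j (a j - b k) * c j k ^+ 2.
  rewrite /qform (parseval _ _ ou); apply: eq_bigr => j _.
  by rewrite cw -/(c j k); ring.
have nu j : norm2 ((A - B) *m u j) ^+ 2 = \sum_k ((a j - b k) * c j k) ^+ 2.
  by rewrite (parseval_norm _ ow); apply: eq_bigr => k _; rewrite dotC cu.
have nw k : norm2 ((A - B) *m w k) ^+ 2 = \sum_j ((a j - b k) * c j k) ^+ 2.
  by rewrite (parseval_norm _ ou); apply: eq_bigr => j _; rewrite cw.
under eq_bigr do rewrite qu mulr_sumr.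
under [X in _ - X]eq_bigr do rewrite qw mulr_sumr.
under [X in _ <= _ * (X + _)]eq_bigr do rewrite nu mulr_sumr.
under [X in _ <= _ * (_ + X)]eq_bigr do rewrite nw mulr_sumr.
rewrite [X in _ - X]exchange_big [X in _ <= _ * (_ + X)]exchange_big /=.
rewrite -sumrB -big_split mulr_sumr; apply: ler_sum => j _.
rewrite -sumrB -big_split mulr_sumr; apply: ler_sum => k _ /=.
have h := ler_wpM2r (sqr_ge0 (c j k)) (exp_mean_value (a j) (b k)).
by rewrite exprMn; lra.
Qed.

End SymmetricMatrices.

(** * Lower tail of a sum of random matrices by exchangeable pairs *)

Section FiniteProduct.
Context {R : realType} {I Om : finType}.
Variable p : I -> Om -> R.
Hypothesis p_ge0 : forall i o, 0 <= p i o.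
Hypothesis p_sum1 : forall i, \sum_o p i o = 1.
Implicit Types (w : {ffun I -> Om}).

Definition prodpr w : R := \prod_i p i (w i).

Definition Eprod (f : {ffun I -> Om} -> R) : R := \sum_w prodpr w * f w.

Definition upd w i o : {ffun I -> Om} := [ffun k => if k == i then o else w k].

Lemma upd_same w i o : upd w i o i = o.
Proof. by rewrite ffunE eqxx. Qed.

Lemma upd_other w i o k : k != i -> upd w i o k = w k.
Proof. by rewrite ffunE => /negbTE ->. Qed.

Lemma updK w i o : upd (upd w i o) i (w i) = w.
Proof. by apply/ffunP => k; rewrite !ffunE; case: eqP => [->|]. Qed.

Lemma prodpr_ge0 w : 0 <= prodpr w.
Proof. by apply: prodr_ge0. Qed.

Lemma prodpr_sum1 : \sum_w prodpr w = 1.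
Proof. by rewrite -bigA_distr_bigA big1. Qed.

Lemma prodpr_upd w i o : prodpr (upd w i o) * p i (w i) = prodpr w * p i o.
Proof.
rewrite /prodpr (bigD1 i) //= [in RHS](bigD1 i) //= upd_same.
rewrite (eq_bigr (fun k => p k (w k))); last by move=> k ki; rewrite upd_other.
by ring.
Qed.

(** Exchangeability: if o is an independent copy of the i-th coordinate of w, then w and its
    resampled version have a symmetric joint law. The involution [h] exchanges them. *)
Lemma Eprod_swap i (H : {ffun I -> Om} -> Om -> R) :
  Eprod (fun w => \sum_o p i o * H w o) =
  Eprod (fun w => \sum_o p i o * H (upd w i o) (w i)).
Proof.
rewrite /Eprod.
under eq_bigr do rewrite mulr_sumr; rewrite pair_big /=.
under [RHS]eq_bigr do rewrite mulr_sumr; rewrite [RHS]pair_big /=.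
pose h (z : {ffun I -> Om} * Om) := (upd z.1 i z.2, z.1 i).
have hK : cancel h h by move=> [w o]; rewrite /h /= updK upd_same.
rewrite [RHS](reindex h) /=; last by exists h => z _; rewrite hK.
apply: eq_bigr => -[w o] _ /=.
by rewrite updK upd_same !mulrA prodpr_upd.
Qed.

Lemma Eprod_resample i (f : {ffun I -> Om} -> R) :
  Eprod f = Eprod (fun w => \sum_o p i o * f (upd w i o)).
Proof.
rewrite -(Eprod_swap i (fun w _ => f w)); apply: eq_bigr => w _.
by rewrite -mulr_suml p_sum1 mul1r.
Qed.

Lemma EprodD f g : Eprod (fun w => f w + g w) = Eprod f + Eprod g.
Proof. by rewrite -big_split; apply: eq_bigr => w _; rewrite mulrDr. Qed.

Lemma EprodZ c f : Eprod (fun w => c * f w) = c * Eprod f.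
Proof. by rewrite mulr_sumr; apply: eq_bigr => w _; rewrite mulrCA. Qed.

Lemma EprodB f g : Eprod (fun w => f w - g w) = Eprod f - Eprod g.
Proof. by rewrite -sumrB; apply: eq_bigr => w _; rewrite mulrBr. Qed.

Lemma Eprod_sum (J : Type) (r : seq J) (P : pred J) (F : J -> {ffun I -> Om} -> R) :
  Eprod (fun w => \sum_(j <- r | P j) F j w) = \sum_(j <- r | P j) Eprod (F j).
Proof. by rewrite exchange_big; apply: eq_bigr => w _; rewrite mulr_sumr. Qed.

Lemma ler_Eprod f g : (forall w, f w <= g w) -> Eprod f <= Eprod g.
Proof.
by move=> fg; apply: ler_sum => w _; rewrite ler_wpM2l ?prodpr_ge0.
Qed.

Lemma eq_Eprod f g : (forall w, f w = g w) -> Eprod f = Eprod g.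
Proof. by move=> fg; apply: eq_bigr => w _; rewrite fg. Qed.

Lemma Eprod_markov (P : pred {ffun I -> Om}) (f : {ffun I -> Om} -> R) (c : R) :
  0 < c -> (forall w, 0 <= f w) -> (forall w, P w -> c <= f w) ->
  \sum_(w | P w) prodpr w <= Eprod f / c.
Proof.
move=> c0 f0 Pf; rewrite ler_pdivlMr // mulr_suml.
rewrite [leRHS](bigID P) /= ler_wpDr //.
  by apply: sumr_ge0 => w _; rewrite mulr_ge0 ?prodpr_ge0.
by apply: ler_sum => w Pw; rewrite ler_wpM2l ?prodpr_ge0 ?Pf.
Qed.

(** * Differential inequality for the trace exponential *)

Section MatrixTail.
Context {d : nat}.
Variables (A : I -> Om -> 'M[R]_d) (al ga g : R).
Let N : R := #|I|%:R.
Hypothesis A_sym : forall i o, (A i o)^T = A i o.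
Hypothesis al_ge0 : 0 <= al.
Hypothesis ga_ge0 : 0 <= ga.
Hypothesis g_ge0 : 0 <= g.
Hypothesis A_sqr : forall i o x,
  norm2 (A i o *m x) ^+ 2 <= al * qform (A i o) x + ga * norm2 x ^+ 2.

Definition meanmx i : 'M[R]_d := \sum_o p i o *: A i o.

Hypothesis mean_le : forall x, \sum_i qform (meanmx i) x <= N * g * norm2 x ^+ 2.

(** Mean minus sample, so that a large eigenvalue of it is a lower deviation of the sum. *)
Definition devmx w : 'M[R]_d := \sum_i (meanmx i - A i (w i)).

Lemma meanmx_sym i : (meanmx i)^T = meanmx i.
Proof. by rewrite linear_sum; apply: eq_bigr => o _; rewrite linearZ /= A_sym. Qed.

Lemma devmx_sym w : (devmx w)^T = devmx w.
Proof.
by rewrite linear_sum; apply: eq_bigr => i _; rewrite linearB /= meanmx_sym A_sym.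
Qed.

Lemma qformB (M M' : 'M[R]_d) x : qform (M - M') x = qform M x - qform M' x.
Proof. by rewrite /qform mulmxBl dotBr. Qed.

Lemma qformZ c (M : 'M[R]_d) x : qform (c *: M) x = c * qform M x.
Proof. by rewrite /qform -scalemxAl dotZr. Qed.

Lemma qform_sum (J : Type) (r : seq J) (P : pred J) (F : J -> 'M[R]_d) x :
  qform (\sum_(j <- r | P j) F j) x = \sum_(j <- r | P j) qform (F j) x.
Proof. by rewrite /qform mulmx_suml dot_sumr. Qed.

Lemma qform_mean i x : qform (meanmx i) x = \sum_o p i o * qform (A i o) x.
Proof. by rewrite qform_sum; apply: eq_bigr => o _; rewrite qformZ. Qed.

Section Eigenbases.
Variables (u : {ffun I -> Om} -> 'I_d -> 'cV[R]_d).
Variables (a : {ffun I -> Om} -> 'I_d -> R).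
Hypothesis u_on : forall w, orthonormal_family (u w).
Hypothesis u_eig : forall w k, devmx w *m u w k = a w k *: u w k.

Let norm_u w k : norm2 (u w k) = 1.
Proof. by rewrite norm2E u_on eqxx sqrtr1. Qed.

(** The expected trace of exp (t [devmx]), through eigenvalues; [dtrexp] is its derivative in t. *)
Definition trexp t : R := Eprod (fun w => \sum_k expR (t * a w k)).

Definition dtrexp t : R := Eprod (fun w => \sum_k a w k * expR (t * a w k)).

Let F t w (D : 'M[R]_d) : R := \sum_k expR (t * a w k) * qform D (u w k).
Let NN t w (D : 'M[R]_d) : R :=
  \sum_k expR (t * a w k) * norm2 (D *m u w k) ^+ 2.

(* Exchangeable pairs: resampling the i-th coordinate changes devmx w by
   D = A i o - A i (w i), and exchanging the two samples flips the sign of D. *)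
Lemma exchangeable_pair t i : 0 < t ->
  Eprod (fun w => F t w (meanmx i - A i (w i))) <=
  t * Eprod (fun w => \sum_k expR (t * a w k) *
    (norm2 (A i (w i) *m u w k) ^+ 2 +
     \sum_o p i o * norm2 (A i o *m u w k) ^+ 2)).
Proof.
move=> t0.
have E1 : Eprod (fun w => F t w (meanmx i - A i (w i))) =
    Eprod (fun w => \sum_o p i o * F t w (A i o - A i (w i))).
  apply: eq_Eprod => w; under [RHS]eq_bigr do rewrite mulr_sumr.
  rewrite exchange_big; apply: eq_bigr => k _ /=.
  rewrite qformB qform_mean -[X in _ - X]mul1r -(p_sum1 i) mulr_suml -sumrB.
  by rewrite mulr_sumr; apply: eq_bigr => o _; rewrite qformB; ring.
have E2 : Eprod (fun w => F t w (meanmx i - A i (w i))) =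
    - Eprod (fun w => \sum_o p i o * F t (upd w i o) (A i o - A i (w i))).
  rewrite E1 (Eprod_swap i (fun w o => F t w (A i o - A i (w i)))) -mulN1r -EprodZ.
  apply: eq_Eprod => w; rewrite mulN1r -sumrN; apply: eq_bigr => o _.
  rewrite upd_same -mulrN; congr (_ * _); rewrite -sumrN; apply: eq_bigr => k _.
  by rewrite -mulrN; congr (_ * _); rewrite !qformB opprB.
have E3 : Eprod (fun w => \sum_o p i o * NN t (upd w i o) (A i o - A i (w i))) =
    Eprod (fun w => \sum_o p i o * NN t w (A i o - A i (w i))).
  rewrite [RHS](Eprod_swap i (fun w o => NN t w (A i o - A i (w i)))).
  apply: eq_Eprod => w; apply: eq_bigr => o _; congr (_ * _).
  apply: eq_bigr => k _; rewrite upd_same; congr (_ * _ ^+ 2).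
  by rewrite -(norm2N (_ *m _)) -mulNmx opprB.
have dev w o : devmx w - devmx (upd w i o) = A i o - A i (w i).
  rewrite /devmx -sumrB (bigD1 i) //= upd_same big1 => [|k ki].
    by rewrite addr0 opprB addrC addrA subrK.
  by rewrite upd_other // subrr.
(* The trace inequality for t [devmx w] and t [devmx (upd w i o)], which differ by t D; one factor t
   cancels. *)
have E4 w o : F t w (A i o - A i (w i)) - F t (upd w i o) (A i o - A i (w i)) <=
    t / 2 * (NN t w (A i o - A i (w i)) + NN t (upd w i o) (A i o - A i (w i))).
  have eig w' k : (t *: devmx w') *m u w' k = (t * a w' k) *: u w' k.
    by rewrite -scalemxAl u_eig scalerA.
  have sym w' : (t *: devmx w')^T = t *: devmx w' by rewrite linearZ /= devmx_sym.
  have := trace_exp_mean_value (sym w) (sym (upd w i o)) (u_on w)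
     (u_on (upd w i o)) (eig w) (eig (upd w i o)).
  rewrite -scalerBr dev => h.
  have FZ w' : \sum_j expR (t * a w' j) * qform (t *: (A i o - A i (w i))) (u w' j)
      = t * F t w' (A i o - A i (w i)).
    by rewrite mulr_sumr; apply: eq_bigr => j _; rewrite qformZ mulrCA.
  have NZ w' : \sum_j expR (t * a w' j) *
      norm2 ((t *: (A i o - A i (w i))) *m u w' j) ^+ 2
      = t ^+ 2 * NN t w' (A i o - A i (w i)).
    rewrite mulr_sumr; apply: eq_bigr => j _.
    by rewrite -scalemxAl norm2Z exprMn real_normK ?num_real // mulrCA.
  rewrite !FZ !NZ in h.
  by rewrite -(ler_pM2l t0); lra.
(* Adding E1 and E2 expresses twice the expectation through the difference bounded in E4, and by E3
   the two quadratic terms of that bound have the same expectation. *)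
have E5 : 2 * Eprod (fun w => F t w (meanmx i - A i (w i))) <=
    t * Eprod (fun w => \sum_o p i o * NN t w (A i o - A i (w i))).
  have -> : 2 * Eprod (fun w => F t w (meanmx i - A i (w i))) =
      Eprod (fun w => \sum_o p i o * (F t w (A i o - A i (w i)) -
        F t (upd w i o) (A i o - A i (w i)))).
    rewrite mulr_natl mulr2n {1}E1 E2 -EprodB; apply: eq_Eprod => w.
    by rewrite -sumrB; apply: eq_bigr => o _; rewrite mulrBr.
  apply: (@le_trans _ _ (Eprod (fun w => \sum_o p i o * (t / 2 *
     (NN t w (A i o - A i (w i)) + NN t (upd w i o) (A i o - A i (w i))))))).
    by apply: ler_Eprod => w; apply: ler_sum => o _; rewrite ler_wpM2l.
  rewrite le_eqVlt; apply/orP; left; apply/eqP.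
  transitivity (t / 2 * (Eprod (fun w => \sum_o p i o * NN t w (A i o - A i (w i)))
    + Eprod (fun w => \sum_o p i o * NN t (upd w i o) (A i o - A i (w i))))).
    rewrite -EprodD -EprodZ; apply: eq_Eprod => w.
    rewrite -big_split mulr_sumr; apply: eq_bigr => o _ /=.
    by ring.
  by rewrite E3; field.
(* This is |x - y|^2 <= 2 |x|^2 + 2 |y|^2 for the two halves of D. *)
suff E6 : Eprod (fun w => \sum_o p i o * NN t w (A i o - A i (w i))) <=
    2 * Eprod (fun w => \sum_k expR (t * a w k) *
    (norm2 (A i (w i) *m u w k) ^+ 2 +
     \sum_o p i o * norm2 (A i o *m u w k) ^+ 2)).
  rewrite -(@ler_pM2l _ 2) //; apply: (le_trans E5).
  by rewrite [leRHS]mulrCA ler_pM2l.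
rewrite -EprodZ; apply: ler_Eprod => w.
under eq_bigr do rewrite mulr_sumr.
rewrite exchange_big mulr_sumr; apply: ler_sum => k _ /=.
have -> : 2 * (expR (t * a w k) * (norm2 (A i (w i) *m u w k) ^+ 2 +
     \sum_o p i o * norm2 (A i o *m u w k) ^+ 2)) =
   \sum_o p i o * (expR (t * a w k) * (2 * (norm2 (A i (w i) *m u w k) ^+ 2 +
     norm2 (A i o *m u w k) ^+ 2))).
  transitivity (\sum_o (p i o * (expR (t * a w k) * (2 * norm2 (A i (w i) *m u w k) ^+ 2))
     + (2 * expR (t * a w k)) * (p i o * norm2 (A i o *m u w k) ^+ 2))).
    rewrite big_split /= -mulr_suml p_sum1 -mulr_sumr; ring.
  by apply: eq_bigr => o _; ring.
apply: ler_sum => o _; rewrite ler_wpM2l // ler_wpM2l ?expR_ge0 //.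
rewrite mulmxBl; set x := A i o *m _; set y := A i (w i) *m _.
have := sqr_ge0 (norm2 (x + y)); rewrite !norm2_sqr.
rewrite !dotDl !dotDr !dotNl !dotNr; lra.
Qed.

Lemma dtrexp_le t : 0 < t -> dtrexp t <= 2 * t * (N * (al * g + ga)) * trexp t.
Proof.
move=> t0.
have dE : dtrexp t = \sum_i Eprod (fun w => F t w (meanmx i - A i (w i))).
  rewrite -Eprod_sum; apply: eq_Eprod => w; rewrite exchange_big.
  apply: eq_bigr => k _ /=; rewrite -mulr_sumr -qform_sum -/(devmx w).
  by rewrite /qform u_eig dotZr u_on eqxx mulr1 mulrC.
have d1 : dtrexp t <= t * Eprod (fun w => \sum_k expR (t * a w k) * \sum_i
    (norm2 (A i (w i) *m u w k) ^+ 2 +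
     \sum_o p i o * norm2 (A i o *m u w k) ^+ 2)).
  rewrite dE; apply: (le_trans (ler_sum _ (fun i _ => exchangeable_pair i t0))).
  rewrite -mulr_sumr -Eprod_sum ler_pM2l //; apply: ler_Eprod => w.
  by rewrite exchange_big; apply: ler_sum => k _; rewrite mulr_sumr.
have d2 : dtrexp t <= t * (2 * (N * (al * g + ga)) * trexp t - al * dtrexp t).
  apply: (le_trans d1); rewrite ler_pM2l // -!EprodZ -EprodB.
  apply: ler_Eprod => w; rewrite !mulr_sumr -sumrB; apply: ler_sum => k _.
  have -> : 2 * (N * (al * g + ga)) * expR (t * a w k) -
      al * (a w k * expR (t * a w k)) =
      expR (t * a w k) * (2 * (N * (al * g + ga)) - al * a w k) by ring.
  rewrite ler_wpM2l ?expR_ge0 //.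
  have aE : a w k = \sum_i (qform (meanmx i) (u w k) - qform (A i (w i)) (u w k)).
    under eq_bigr do rewrite -qformB.
    by rewrite -qform_sum -/(devmx w) /qform u_eig dotZr u_on eqxx mulr1.
  have h1 i o : norm2 (A i o *m u w k) ^+ 2 <= al * qform (A i o) (u w k) + ga.
    by have := A_sqr i o (u w k); rewrite norm_u expr1n mulr1.
  have h2 i : \sum_o p i o * norm2 (A i o *m u w k) ^+ 2 <=
      al * qform (meanmx i) (u w k) + ga.
    apply: (@le_trans _ _ (\sum_o p i o * (al * qform (A i o) (u w k) + ga))).
      by apply: ler_sum => o _; rewrite ler_wpM2l.
    rewrite qform_mean mulr_sumr -[X in _ <= _ + X]mul1r -(p_sum1 i) mulr_suml.
    rewrite -big_split; apply: ler_sum => o _ /=.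
    by lra.
  apply: (@le_trans _ _ (\sum_i (al * qform (A i (w i)) (u w k) + ga +
     (al * qform (meanmx i) (u w k) + ga)))).
    by apply: ler_sum => i _; rewrite lerD.
  have hm := mean_le (u w k); rewrite norm_u expr1n mulr1 in hm.
  have hm' := ler_wpM2l al_ge0 hm.
  have -> : \sum_i (al * qform (A i (w i)) (u w k) + ga +
     (al * qform (meanmx i) (u w k) + ga)) =
     2 * (al * \sum_i qform (meanmx i) (u w k)) - al * a w k + 2 * N * ga.
    rewrite aE sumrB mulrBr !big_split /= -!mulr_sumr sumr_const -mulr_natl -/N.
    by ring.
  lra.
have tr0 : 0 <= trexp t.
  apply: sumr_ge0 => w _; rewrite mulr_ge0 ?prodpr_ge0 //.
  by apply: sumr_ge0 => k _; rewrite expR_ge0.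
have k0 : 0 <= N * (al * g + ga) by rewrite mulr_ge0 ?ler0n ?addr_ge0 ?mulr_ge0.
have c0 : 0 <= 2 * t * (N * (al * g + ga)) * trexp t.
  by apply: mulr_ge0 => //; apply: mulr_ge0 => //; rewrite mulr_ge0 // ltW.
have [dneg|/ltW dpos] := leP (dtrexp t) 0; first exact: le_trans c0.
have : 0 <= t * (al * dtrexp t) by rewrite !mulr_ge0 // ltW.
lra.
Qed.

End Eigenbases.
End MatrixTail.
End FiniteProduct.

Section MatrixTailBound.
Context {R : realType} {I Om : finType} {d : nat}.
Variable p : I -> Om -> R.
Hypothesis p_ge0 : forall i o, 0 <= p i o.
Hypothesis p_sum1 : forall i, \sum_o p i o = 1.
Let N : R := #|I|%:R.

Lemma is_derive_sum_seq (J : Type) (r : seq J) (f df : J -> R -> R) (t : R) :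
  (forall j, is_derive t (1 : R) (f j) (df j t)) ->
  is_derive t (1 : R) (fun t => \sum_(j <- r) f j t) (\sum_(j <- r) df j t).
Proof.
move=> h; elim: r => [|j r IH].
  rewrite big_nil (_ : (fun _ => _) = cst 0); last first.
    by apply/funext => s; rewrite big_nil.
  exact: is_derive_cst.
rewrite big_cons (_ : (fun _ => _) = (f j \+ (fun t => \sum_(j <- r) f j t))).
  exact: is_deriveD.
by apply/funext => s; rewrite big_cons.
Qed.

(** Gronwall's argument: by [dtrexp_le] the product of [trexp] at t with exp (-c t^2) is
    nonincreasing, and it starts at d. *)
Lemma trexp_le (A : I -> Om -> 'M[R]_d) (al ga g : R) a u (s : R) :
  (forall i o, (A i o)^T = A i o) ->
  0 <= al -> 0 <= ga -> 0 <= g ->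
  (forall i o x,
    norm2 (A i o *m x) ^+ 2 <= al * qform (A i o) x + ga * norm2 x ^+ 2) ->
  (forall x, \sum_i qform (meanmx p A i) x <= N * g * norm2 x ^+ 2) ->
  (forall w, orthonormal_family (u w)) ->
  (forall w k, devmx p A w *m u w k = a w k *: u w k) ->
  0 <= s ->
  trexp p a s <= d%:R * expR (N * (al * g + ga) * s ^+ 2).
Proof.
move=> As al0 ga0 g0 A2 gm ou eig s0.
set c := N * (al * g + ga).
have dtr (t : R) : is_derive t (1 : R) (trexp p a) (dtrexp p a t).
  apply: (@is_derive_sum_seq _ (index_enum _)
    (fun w t => prodpr p w * \sum_k expR (t * a w k))
    (fun w t => prodpr p w * \sum_k a w k * expR (t * a w k))) => w.
  apply: is_deriveZ.
  apply: (@is_derive_sum_seq _ (index_enum _)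
    (fun k t => expR (t * a w k)) (fun k t => a w k * expR (t * a w k))) => k.
  by apply: is_derive_eq; rewrite /GRing.scale /=; ring.
pose f t := - (trexp p a t * expR (- (c * t ^+ 2))).
pose df t := - ((dtrexp p a t - 2 * t * c * trexp p a t) * expR (- (c * t ^+ 2))).
have : f 0 <= f s.
  apply: (@ler_of_derive_ge0 _ f df) => // [t|t /andP [t0 _]].
    rewrite /f; apply: is_derive_eq; rewrite /df /GRing.scale /=.
    by ring.
  rewrite /df oppr_ge0 pmulr_lle0 ?expR_gt0 // subr_le0.
  exact: dtrexp_le.
have -> : f 0 = - d%:R.
  rewrite /f expr0n mulr0 oppr0 expR0 mulr1; congr (- _).
  rewrite /trexp /Eprod -[RHS]mul1r -[X in X * _](prodpr_sum1 p_sum1) mulr_suml.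
  apply: eq_bigr => w _; congr (_ * _).
  under eq_bigr do rewrite mul0r expR0.
  by rewrite sumr_const card_ord.
by rewrite /f lerN2 expRN ler_pdivrMr ?expR_gt0.
Qed.

Lemma matrix_lower_tail (A : I -> Om -> 'M[R]_d) (al ga g x : R) :
  (forall i o, (A i o)^T = A i o) ->
  0 <= al -> 0 <= ga -> 0 <= g ->
  (forall i o v,
    norm2 (A i o *m v) ^+ 2 <= al * qform (A i o) v + ga * norm2 v ^+ 2) ->
  (forall v, \sum_i qform (meanmx p A i) v <= N * g * norm2 v ^+ 2) ->
  0 < al * g + ga -> 0 <= x ->
  \sum_(w | ~~ `[< forall v, qform (devmx p A w) v <= N * x * norm2 v ^+ 2 >])
     prodpr p w <=
  d%:R * expR (- (N * x ^+ 2 / (4 * (al * g + ga)))).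
Proof.
move=> As al0 ga0 g0 A2 gm; set ka := al * g + ga => ka0 x0.
have /choice [ua uaP] : forall w, exists ua : ('I_d -> 'cV[R]_d) * ('I_d -> R),
    orthonormal_family ua.1 /\ forall j, devmx p A w *m ua.1 j = ua.2 j *: ua.1 j.
  move=> w; have [u [a [ou h]]] := spectral_theorem (devmx_sym p As w).
  by exists (u, a).
pose u w := (ua w).1; pose a w := (ua w).2.
have ou w : orthonormal_family (u w) by have [] := uaP w.
have eig w k : devmx p A w *m u w k = a w k *: u w k by have [_ h] := uaP w; exact: h.
(* This t minimises the exponent N ka t^2 - t N x. *)
set t := x / (2 * ka).
have t0 : 0 <= t by rewrite divr_ge0 // mulr_ge0 // ltW.
apply: (@le_trans _ _ (trexp p a t / expR (t * (N * x)))).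
  apply: Eprod_markov => //; first exact: expR_gt0.
    by move=> w; apply: sumr_ge0 => k _; exact: expR_ge0.
  move=> w /asboolPn hw.
  have [k hk] : exists k, N * x < a w k.
    apply: contra_notP hw => /forallNP hk v.
    rewrite (qform_eigenbasis _ (devmx_sym p As w) (ou w) (eig w)).
    rewrite (parseval_norm _ (ou w)) mulr_sumr; apply: ler_sum => k _.
    by rewrite ler_wpM2r ?sqr_ge0 // leNgt; apply/negP/hk.
  rewrite (bigD1 k) //= (@le_trans _ _ (expR (t * a w k))) //.
    by rewrite ler_expR ler_wpM2l // ltW.
  by rewrite lerDl; apply: sumr_ge0 => j _; exact: expR_ge0.
rewrite ler_pdivrMr ?expR_gt0 //.
apply: (le_trans (trexp_le As al0 ga0 g0 A2 gm ou eig t0)).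
rewrite -[leRHS]mulrA -expRD -/ka; apply: ler_wpM2l => //.
rewrite ler_expR /t le_eqVlt; apply/orP; left; apply/eqP; field.
by rewrite gt_eqF.
Qed.

End MatrixTailBound.

(** * Bernstein inequality for random vectors *)

Section HyperbolicCosine.
Context {R : realType}.
Implicit Types x y t a b : R.

Definition hcosh x : R := 2^-1 * (expR x + expR (- x)).
Definition hsinh x : R := 2^-1 * (expR x - expR (- x)).

Lemma hcosh0 : hcosh 0 = 1.
Proof. by rewrite /hcosh oppr0 expR0; field. Qed.

Lemma hcosh_ge0 x : 0 <= hcosh x.
Proof. by rewrite mulr_ge0 ?invr_ge0 // addr_ge0 ?expR_ge0. Qed.

Lemma hcosh_half_exp x : 2^-1 * expR x <= hcosh x.
Proof. by rewrite ler_pM2l ?invr_gt0 // lerDl expR_ge0. Qed.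

Lemma hsinh_ge x : 0 <= x -> x <= hsinh x.
Proof.
move=> x0; pose f t : R := expR t - expR (- t) - 2 * t.
have f0 : f 0 = 0 by rewrite /f oppr0 subrr mulr0 subrr.
suff : f 0 <= f x by rewrite f0 /f /hsinh; lra.
apply: (@ler_of_derive_ge0 _ f (fun t => expR t + expR (- t) - 2)) => //.
  by move=> t; rewrite /f; apply: is_derive_eq; rewrite /GRing.scale /=; ring.
by move=> t _; have := expR_ge1Dx t; have := expR_ge1Dx (- t); lra.
Qed.

(** (1 + t + 3/5 t^2) exp (-t) increases exactly until t = 1/3, which becomes the constraint t B <=
    1/3 in the Bernstein bound. *)
Lemma expR_sub_le x : 0 <= x <= 3^-1 -> expR x - x <= 1 + 3 / 5 * x ^+ 2.
Proof.
move=> /andP [x0 x3]; pose f t : R := (1 + t + 3 / 5 * t ^+ 2) * expR (- t).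
have : f 0 <= f x.
  apply: (@ler_of_derive_ge0 _ f
    (fun t => 5^-1 * t * (1 - 3 * t) * expR (- t))) => //.
    move=> t; rewrite /f; apply: is_derive_eq; rewrite /GRing.scale /=.
    by field.
  move=> t /andP [t0 tx]; rewrite mulr_ge0 ?expR_ge0 // mulr_ge0 //.
    by rewrite mulr_ge0 ?invr_ge0 // ltW.
  by lra.
rewrite /f oppr0 expR0 addr0 expr0n mulr0 addr0 mulr1 expRN.
by rewrite ler_pdivlMr ?expR_gt0 //; lra.
Qed.

Definition hcosh_coeff x (k : nat) : R := 2^-1 * (exp_coeff x k + exp_coeff (- x) k).

Lemma cvg_hcosh x : series (hcosh_coeff x) @ \oo --> hcosh x.
Proof.
have -> : series (hcosh_coeff x) =
    fun N => 2^-1 * (series (exp_coeff x) N + series (exp_coeff (- x)) N).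
  apply/funext => N; rewrite /series /= -big_split mulr_sumr.
  by apply: eq_bigr.
apply: cvgM; first exact: cvg_cst.
by apply: cvgD; exact: is_cvg_series_exp_coeff.
Qed.

Lemma hcosh_coeffE x k : hcosh_coeff x k =
  if odd k then 0 else (k`!%:R)^-1 * (x ^+ 2) ^+ k./2.
Proof.
rewrite /hcosh_coeff /exp_coeff /=; case: ifPn => ok.
  by rewrite exprNn -signr_odd ok expr1; field; rewrite pnatr_eq0 -lt0n fact_gt0.
rewrite exprNn -signr_odd (negbTE ok) expr0 -exprM mul2n even_halfK // mul1r.
by field; rewrite pnatr_eq0 -lt0n fact_gt0.
Qed.

Lemma expr_convex t (y0 y1 : R) k : 0 <= t <= 1 -> 0 <= y0 -> 0 <= y1 ->
  ((1 - t) * y0 + t * y1) ^+ k <= (1 - t) * y0 ^+ k + t * y1 ^+ k.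
Proof.
move=> /andP [t0 t1] h0 h1; elim: k => [|k IH]; first by rewrite !expr0; lra.
have hy : 0 <= (1 - t) * y0 + t * y1 by rewrite addr_ge0 ?mulr_ge0 ?subr_ge0.
rewrite exprS; apply: (le_trans (ler_wpM2l hy IH)).
rewrite -subr_ge0 !exprS.
have -> : (1 - t) * (y0 * y0 ^+ k) + t * (y1 * y1 ^+ k) -
    ((1 - t) * y0 + t * y1) * ((1 - t) * y0 ^+ k + t * y1 ^+ k) =
    ((1 - t) * t) * ((y0 - y1) * (y0 ^+ k - y1 ^+ k)) by ring.
apply: mulr_ge0; first by rewrite mulr_ge0 ?subr_ge0.
have [le01|/ltW le10] := leP y0 y1.
  by rewrite mulr_le0 // subr_le0 // lerXn2r.
by rewrite mulr_ge0 // subr_ge0 // lerXn2r.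
Qed.

(* The power series of [hcosh (sqrt y)] has nonnegative coefficients. *)
Lemma hcosh_sqrt_convex t (q x0 x1 : R) : 0 <= t <= 1 ->
  q ^+ 2 = (1 - t) * x0 ^+ 2 + t * x1 ^+ 2 ->
  hcosh q <= (1 - t) * hcosh x0 + t * hcosh x1.
Proof.
move=> t01 qE.
apply: (ler_cvg_to (@cvg_hcosh q) (g := fun N => (1 - t) * series (hcosh_coeff x0) N +
   t * series (hcosh_coeff x1) N)).
  apply: cvgD; apply: cvgM; by [exact: cvg_cst|exact: cvg_hcosh].
near=> N; rewrite /series /= !mulr_sumr -big_split.
apply: ler_sum => k _ /=; rewrite !hcosh_coeffE; case: ifP => _.
  by rewrite !mulr0 addr0.
rewrite mulrCA [X in _ + X]mulrCA -mulrDr ler_wpM2l ?invr_ge0 // qE.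
by apply: expr_convex => //; exact: sqr_ge0.
Unshelve. all: by end_near.
Qed.

(** With r the cosine, q^2 is a convex combination of (a - b)^2 and (a + b)^2, and convexity gives
    cosh a cosh b + r sinh a sinh b. The cross term must be linear in c to vanish for centred
    vectors, so sinh b is lowered to b there; since r sinh a <= cosh a, this costs at most cosh a
    (sinh b - b). *)
Lemma hcosh_law_of_cosines (a b c q : R) : 0 < a -> 0 <= b ->
  `|c| <= a * b -> q ^+ 2 = a ^+ 2 + b ^+ 2 + 2 * c ->
  hcosh q <= hcosh a * (expR b - b) + hsinh a / a * c.
Proof.
move=> a0; rewrite le_eqVlt => /predU1P [<-|b0].
  rewrite mulr0 normr_le0 => /eqP -> qE.
  have -> : hcosh q = hcosh a.
    have : q ^+ 2 = a ^+ 2 by rewrite qE; ring.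
    move=> /eqP; rewrite eqf_sqr => /orP [/eqP -> //|/eqP ->].
    by rewrite /hcosh opprK addrC.
  by rewrite expR0 subr0 mulr1 mulr0 addr0.
move=> cab qE; set r := c / (a * b).
have ab0 : 0 < a * b by rewrite mulr_gt0.
have an0 : a != 0 by rewrite gt_eqF.
have bn0 : b != 0 by rewrite gt_eqF.
have cE : c = r * (a * b) by rewrite /r divfK // gt_eqF.
have : `|r| <= 1 by rewrite normrM normfV ler_pdivrMr (gtr0_norm ab0) // mul1r.
rewrite ler_norml => /andP [r1 r2].
have t01 : 0 <= (1 + r) / 2 <= 1 by lra.
have := @hcosh_sqrt_convex ((1 + r) / 2) q (a - b) (a + b) t01.
have -> : (1 - (1 + r) / 2) * (a - b) ^+ 2 + (1 + r) / 2 * (a + b) ^+ 2 = q ^+ 2.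
  by rewrite qE cE; field.
move=> /(_ erefl) h; apply: (le_trans h).
have -> : (1 - (1 + r) / 2) * hcosh (a - b) + (1 + r) / 2 * hcosh (a + b) =
    hcosh a * hcosh b + r * (hsinh a * hsinh b).
  by rewrite /hcosh /hsinh !opprD !opprK !expRD; field.
have -> : hsinh a / a * c = r * (hsinh a * b) by rewrite cE; field.
have sb := hsinh_ge (ltW b0).
have sa : 0 <= hsinh a by rewrite (le_trans (ltW a0)) // hsinh_ge // ltW.
have sc : hsinh a <= hcosh a.
  by rewrite ler_pM2l ?invr_gt0 // lerD2l (le_trans (_ : _ <= 0)) ?oppr_le0 ?expR_ge0.
have -> : expR b = hcosh b + hsinh b by rewrite /hcosh /hsinh; field.
rewrite -subr_ge0.
have -> : hcosh a * (hcosh b + hsinh b - b) + r * (hsinh a * b) -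
  (hcosh a * hcosh b + r * (hsinh a * hsinh b)) =
  (hcosh a - r * hsinh a) * (hsinh b - b) by ring.
rewrite mulr_ge0 ?subr_ge0 //.
by rewrite (le_trans _ sc) // ler_piMl.
Qed.

(** At s = 0 the quotient of [hsinh] is 0 by the convention on division, which is harmless because
    [dot s z] vanishes. *)
Lemma hcosh_norm2D (d : nat) (s z : 'cV[R]_d) :
  hcosh (norm2 (s + z)) <= hcosh (norm2 s) * (expR (norm2 z) - norm2 z) +
    hsinh (norm2 s) / norm2 s * dot s z.
Proof.
have [->|s0] := eqVneq s 0.
  rewrite add0r norm20 dot0l mulr0 addr0 hcosh0 mul1r.
  have := hsinh_ge (norm2_ge0 z); rewrite /hcosh /hsinh; lra.
apply: hcosh_law_of_cosines; rewrite ?norm2_ge0 //.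
- by rewrite lt_neqAle norm2_ge0 eq_sym norm2_eq0 s0.
- exact: cauchy_schwarz_abs.
- by rewrite !norm2_sqr dotDl !dotDr (dotC z s); ring.
Qed.

End HyperbolicCosine.

Section VectorBernstein.
Context {R : realType} {I Om : finType} {d : nat}.
Variable p : I -> Om -> R.
Hypothesis p_ge0 : forall i o, 0 <= p i o.
Hypothesis p_sum1 : forall i, \sum_o p i o = 1.
Variables (Z : I -> Om -> 'cV[R]_d) (B : R).
Hypothesis Z_mean0 : forall i, \sum_o p i o *: Z i o = 0.
Hypothesis Z_le : forall i o, norm2 (Z i o) <= B.
Let N : R := #|I|%:R.

(** Averaging over the coordinate added to the list removes the linear term because Z is centred.
    What remains is a factor 1 + 3/5 t^2 v, bounded by an exponential. *)
Lemma hcosh_sum_le (t : R) (r : seq I) : 0 <= t -> t * B <= 3^-1 -> uniq r ->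
  Eprod p (fun w => hcosh (norm2 (t *: \sum_(i <- r) Z i (w i)))) <=
  expR (3 / 5 * t ^+ 2 * \sum_(i <- r) \sum_o p i o * norm2 (Z i o) ^+ 2).
Proof.
move=> t0 tB; elim: r => [_|i r IH /= /andP [ir ur]].
  rewrite big_nil mulr0 expR0 -(prodpr_sum1 p_sum1); apply: ler_sum => w _.
  by rewrite big_nil scaler0 norm20 hcosh0 mulr1.
rewrite big_cons mulrDr expRD.
set v := \sum_o p i o * norm2 (Z i o) ^+ 2.
rewrite (Eprod_resample p_sum1 i).
apply: (@le_trans _ _ (Eprod p (fun w => expR (3 / 5 * t ^+ 2 * v) *
    hcosh (norm2 (t *: \sum_(i <- r) Z i (w i)))))); last first.
  by rewrite EprodZ ler_wpM2l ?expR_ge0 // IH.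
apply: (ler_Eprod p_ge0) => w.
set s := t *: \sum_(i <- r) Z i (w i).
have sE o : t *: \sum_(k <- i :: r) Z k (upd w i o k) = s + t *: Z i o.
  rewrite big_cons upd_same scalerDr addrC; congr (_ + _).
  congr (_ *: _); rewrite big_seq [RHS]big_seq; apply: eq_bigr => k kr.
  by rewrite upd_other //; apply: contraNneq ir => <-.
set h := hsinh (norm2 s) / norm2 s.
apply: (@le_trans _ _ (\sum_o p i o * (hcosh (norm2 s) *
   (1 + 3 / 5 * (t ^+ 2 * norm2 (Z i o) ^+ 2)) + h * dot s (t *: Z i o)))).
  apply: ler_sum => o _; rewrite ler_wpM2l // sE.
  apply: (le_trans (hcosh_norm2D _ _)); rewrite lerD2r.
  rewrite ler_wpM2l ?hcosh_ge0 // -exprMn norm2Z ger0_norm //.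
  apply: expR_sub_le; rewrite mulr_ge0 ?norm2_ge0 //=.
  by rewrite (le_trans _ tB) // ler_wpM2l.
have -> : \sum_o p i o * (hcosh (norm2 s) *
   (1 + 3 / 5 * (t ^+ 2 * norm2 (Z i o) ^+ 2)) + h * dot s (t *: Z i o)) =
   hcosh (norm2 s) * (\sum_o p i o + 3 / 5 * t ^+ 2 * v) +
   h * t * dot s (\sum_o p i o *: Z i o).
  rewrite dot_sumr /v mulr_sumr -big_split /= !mulr_sumr -big_split /=.
  by apply: eq_bigr => o _; rewrite !dotZr; ring.
rewrite Z_mean0 dot0r mulr0 addr0 p_sum1 mulrC ler_wpM2r ?hcosh_ge0 //.
exact: expR_ge1Dx.
Qed.

Lemma vector_bernstein (w2 u : R) : 0 <= w2 -> 0 <= u -> 0 <= B ->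
  \sum_i \sum_o p i o * norm2 (Z i o) ^+ 2 <= N * w2 ^+ 2 ->
  \sum_(w : {ffun I -> Om} | N * (5 / 3 * w2 * u + 25 / 4 * B * u ^+ 2) <
     norm2 (\sum_i Z i (w i))) prodpr p w <=
  2 * expR (- (9 / 8 * (N * u ^+ 2))).
Proof.
move=> w0 u0 B0 hv; set D := w2 + 15 / 4 * B * u.
have N0 : 0 <= N by rewrite ler0n.
have D0 : 0 <= D by rewrite addr_ge0 ?mulr_ge0.
have tot : \sum_(w : {ffun I -> Om} | N * (5 / 3 * w2 * u + 25 / 4 * B * u ^+ 2) <
     norm2 (\sum_i Z i (w i))) prodpr p w <= 1.
  rewrite -[leRHS](prodpr_sum1 p_sum1) [leRHS](bigID (fun w : {ffun I -> Om} =>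
    N * (5 / 3 * w2 * u + 25 / 4 * B * u ^+ 2) < norm2 (\sum_i Z i (w i)))) /=.
  by rewrite lerDl; apply: sumr_ge0 => w _; exact: prodpr_ge0.
have [u00|un0] := eqVneq u 0.
  by rewrite (le_trans tot) // u00 expr0n !mulr0 oppr0 expR0; lra.
have up : 0 < u by rewrite lt_neqAle eq_sym un0.
(* D = 0 forces B = 0, so every Z vanishes and the event is empty. *)
have [D00|Dn0] := eqVneq D 0.
  have B00 : B <= 0.
    have : 15 / 4 * B * u <= 0 by rewrite -D00 /D lerDr.
    by rewrite pmulr_lle0 // pmulr_rle0 //; lra.
  rewrite big_pred0 => [|w]; first by rewrite mulr_ge0 ?expR_ge0.
  apply/negbTE; rewrite -leNgt big1 => [|i _].
    by rewrite norm20 mulr_ge0 // addr_ge0 // !mulr_ge0 // exprn_ge0.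
  by apply/eqP; rewrite -norm2_eq0 eq_le norm2_ge0 (le_trans (Z_le i (w i))).
have Dp : 0 < D by rewrite lt_neqAle eq_sym Dn0.
(* D >= 15/4 B u yields t B <= 1/3, and the threshold equals N (5/3) u D. The exponent is at most N
   u^2 (15/16 - 25/12) = -(55/48) N u^2, just below -(9/8) N u^2. *)
set t := 5 / 4 * u / D.
have t0 : 0 <= t by apply: divr_ge0 => //; apply: mulr_ge0.
have tB : t * B <= 3^-1.
  rewrite /t mulrAC ler_pdivrMr // /D; lra.
set T := N * _.
have TE : T = N * (5 / 3 * u * D) by rewrite /T /D; field.
apply: (@le_trans _ _ (expR (3 / 5 * t ^+ 2 * (N * w2 ^+ 2)) / (2^-1 * expR (t * T)))).
  apply: (@le_trans _ _ (Eprod p (fun w => hcosh (norm2 (t *: \sum_i Z i (w i)))) /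
     (2^-1 * expR (t * T)))).
    apply: Eprod_markov => //; first by rewrite mulr_gt0 ?expR_gt0.
      by move=> w; exact: hcosh_ge0.
    move=> w hw; rewrite (le_trans _ (hcosh_half_exp _)) //.
    rewrite ler_pM2l ?invr_gt0 // ler_expR norm2Z ger0_norm //.
    by rewrite ler_wpM2l // ltW.
  rewrite ler_wpM2r ?invr_ge0 ?mulr_ge0 ?expR_ge0 //.
  apply: (le_trans (hcosh_sum_le t0 tB (index_enum_uniq _))).
  by rewrite ler_expR ler_wpM2l // mulr_ge0 ?sqr_ge0.
rewrite invfM invrK mulrCA ler_pM2l // -expRN -expRD ler_expR.
have wD : (w2 / D) ^+ 2 <= 1.
  by rewrite expr_le1 // ?divr_ge0 // ler_pdivrMr // mul1r /D lerDl !mulr_ge0.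
have -> : 3 / 5 * t ^+ 2 * (N * w2 ^+ 2) - t * T =
    N * u ^+ 2 * (15 / 16 * (w2 / D) ^+ 2 - 25 / 12).
  by rewrite TE /t; field.
have Nu : 0 <= N * u ^+ 2 by rewrite mulr_ge0 // sqr_ge0.
by have := mulr_ge0 Nu (_ : 0 <= 1 - (w2 / D) ^+ 2); rewrite subr_ge0 => /(_ wD); lra.
Qed.

End VectorBernstein.

(** * Quantizer outcomes *)

Section Estimator.
Context {R : realType} {d : nat}.

(** The vanishing derivative along v = bh - b0 reads <v, S v> = <h - S b0, v>; coercivity and
    Cauchy-Schwarz conclude. *)
Lemma minimizer_error (S : 'M[R]_d) (h b0 bh : 'cV[R]_d) (l : R) :
  S^T = S -> 0 < l -> (forall v, l * norm2 v ^+ 2 <= qform S v) ->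
  (forall b, 2^-1 * qform S bh - dot bh h <= 2^-1 * qform S b - dot b h) ->
  norm2 (bh - b0) <= norm2 (h - S *m b0) / l.
Proof.
move=> sS l0 Sl bmin; have [v vE] : exists v, v = bh - b0 by exists (bh - b0).
rewrite -vE.
have grad : dot v (S *m bh - h) = 0.
  apply: (@quadratic_le0_lin_eq0 _ _ (- qform S v)) => t.
  have := bmin (bh - t *: v).
  rewrite /qform mulmxBr -scalemxAr !dotBl !dotBr !dotZl !dotZr.
  rewrite (dot_mulmx S bh v) sS (dotC (S *m bh) v).
  by lra.
have [->|v0] := eqVneq v 0.
  by rewrite norm20 divr_ge0 ?norm2_ge0 // ltW.
have nv : 0 < norm2 v by rewrite lt_neqAle norm2_ge0 eq_sym norm2_eq0 v0.
rewrite ler_pdivlMr // mulrC -(ler_pM2r nv) -mulrA -expr2.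
apply: (le_trans (Sl v)).
have -> : qform S v = dot (h - S *m b0) v.
  rewrite /qform {2}vE mulmxBr !dotBr dotBl (dotC h) (dotC (S *m b0)).
  by move: grad; rewrite dotBr; lra.
exact: cauchy_schwarz.
Qed.

End Estimator.

(** * Algebra of the quantizer outputs *)

Section Bits.
Context {R : realType} {d : nat}.

(* The outputs of the quantizers for one sample: signs of the predictors, upper
   outputs for the squares, sign of the response. *)
Definition outcome : finType :=
  ({ffun 'I_d -> bool} * {ffun 'I_d -> bool} * bool)%type.

Variables (r L : R).
Hypothesis r_ge0 : 0 <= r.
Hypothesis L_ge0 : 0 <= L.
Hypothesis d_gt0 : (0 < d)%N.

Definition sgnr (x : R) (b : bool) : R := if b then x else - x.

Definition outX (o : outcome) : 'cV[R]_d := \col_j sgnr r (o.1.1 j).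

Definition outX2 (o : outcome) : 'rV[R]_d :=
  \row_j (if o.1.2 j then r ^+ 2 else 0).

Definition outY (o : outcome) : R := sgnr L o.2.

Definition outA (o : outcome) : 'M[R]_d :=
  outX o *m (outX o)^T + diag_mx (outX2 o - const_mx (r ^+ 2)).

Lemma sgnr_sqr x b : sgnr x b ^+ 2 = x ^+ 2.
Proof. by case: b; rewrite /sgnr // sqrrN. Qed.

(** The square of a one-bit output is the constant r^2, so the diagonal of s s^T carries no
    information; the correction puts the quantized squares in its place. *)
Lemma outA_coef o j k :
  outA o j k = if j == k then outX2 o 0 j else outX o j 0 * outX o k 0.
Proof.
rewrite !mxE big_ord1 !mxE; case: eqVneq => [<-|]; last by rewrite mulr0n addr0.
by rewrite mulr1n -expr2 sgnr_sqr; ring.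
Qed.

Lemma outA_sym o : (outA o)^T = outA o.
Proof.
by apply/matrixP => j k; rewrite mxE !outA_coef eq_sym mulrC; case: eqP => [->|].
Qed.

Lemma norm2_outX o : norm2 (outX o) ^+ 2 = d%:R * r ^+ 2.
Proof.
rewrite norm2_sqr /dot (eq_bigr (fun=> r ^+ 2)) => [|j _].
  by rewrite sumr_const card_ord mulr_natl.
by rewrite !mxE -expr2 sgnr_sqr.
Qed.

Lemma outA_mul o x : outA o *m x = dot (outX o) x *: outX o -
  \col_j (r ^+ 2 * (~~ o.1.2 j)%:R * x j 0).
Proof.
rewrite mulmxDl -mulmxA [_^T *m x]mx11_scalar -dotE mul_mx_scalar; congr (_ + _).
apply/colP => j; rewrite mul_diag_mx !mxE.
by case: (o.1.2 j) => /=; ring.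
Qed.

(** Let q be the squared mass of x where the quantized square is 0. Then <x, A x> = <s, x>^2 - r^2 q
    and |s|^2 = d r^2, while |A x|^2 <= 2 d r^2 <s, x>^2 + 2 r^4 q. Eliminating <s, x>^2 leaves (2 d
    + 2) r^4 q <= 4 d r^4 |x|^2. *)
Lemma outA_sqr o x : norm2 (outA o *m x) ^+ 2 <=
  2 * d%:R * r ^+ 2 * qform (outA o) x + 4 * d%:R * r ^+ 4 * norm2 x ^+ 2.
Proof.
rewrite /qform outA_mul; set y := \col_j _; set s := outX o.
set q := \sum_j (~~ o.1.2 j)%:R * x j 0 ^+ 2.
have q0 : 0 <= q by apply: sumr_ge0 => j _; rewrite mulr_ge0 ?ler0n ?sqr_ge0.
have qx : q <= norm2 x ^+ 2.
  rewrite norm2_sqr; apply: ler_sum => j _; rewrite -expr2.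
  by case: (o.1.2 j); rewrite ?mul0r ?mul1r ?sqr_ge0.
have yy : norm2 y ^+ 2 = r ^+ 4 * q.
  rewrite norm2_sqr mulr_sumr; apply: eq_bigr => j _; rewrite !mxE.
  by case: (o.1.2 j) => /=; ring.
have xy : dot x y = r ^+ 2 * q.
  rewrite mulr_sumr; apply: eq_bigr => j _; rewrite !mxE.
  by case: (o.1.2 j) => /=; ring.
have ss : dot s s = d%:R * r ^+ 2 by rewrite -norm2_sqr norm2_outX.
rewrite dotBr xy dotZr (dotC x s).
have h : norm2 (dot s x *: s - y) ^+ 2 <= 2 * (dot s x ^+ 2 * (d%:R * r ^+ 2)) +
    2 * (r ^+ 4 * q).
  rewrite -yy -ss; have := dotxx_ge0 (dot s x *: s + y).
  rewrite !norm2_sqr dotBl !dotBr dotDl !dotDr !dotZl !dotZr (dotC y s); lra.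
have d1 : (1 : R) <= d%:R by rewrite ler1n.
have r4 : 0 <= r ^+ 4 by rewrite exprn_ge0.
have h1 : r ^+ 4 * q <= d%:R * (r ^+ 4 * q) by rewrite ler_peMl // mulr_ge0.
have h2 : d%:R * r ^+ 4 * q <= d%:R * r ^+ 4 * norm2 x ^+ 2.
  by rewrite ler_wpM2l // mulr_ge0.
have -> : 2 * d%:R * r ^+ 2 * (dot s x * dot s x - r ^+ 2 * q) =
  2 * (dot s x ^+ 2 * (d%:R * r ^+ 2)) - 2 * (d%:R * r ^+ 4 * q) by ring.
lra.
Qed.

(** Every entry is at most r^2 in absolute value; Cauchy-Schwarz is applied in each row. *)
Lemma norm2_outA_le o x : norm2 (outA o *m x) <= d%:R * r ^+ 2 * norm2 x.
Proof.
have rhs0 : 0 <= d%:R * r ^+ 2 * norm2 x.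
  by rewrite !mulr_ge0 ?norm2_ge0 ?sqr_ge0.
rewrite -ler_sqr ?nnegrE ?norm2_ge0 // norm2_sqr.
apply: (@le_trans _ _ (\sum_(j < d) (d%:R * r ^+ 4 * norm2 x ^+ 2))); last first.
  by rewrite sumr_const card_ord -mulr_natl; lra.
apply: ler_sum => j _; rewrite -expr2.
set c : 'cV[R]_d := \col_k outA o j k.
have -> : (outA o *m x) j 0 = dot c x.
  by rewrite mxE; apply: eq_bigr => k _; rewrite [X in _ = X * _]mxE.
rewrite -(real_normK (num_real _)).
apply: (@le_trans _ _ ((norm2 c * norm2 x) ^+ 2)).
  by rewrite ler_sqr ?nnegrE ?mulr_ge0 ?norm2_ge0 // cauchy_schwarz_abs.
rewrite exprMn ler_wpM2r ?sqr_ge0 // norm2_sqr.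
apply: (@le_trans _ _ (\sum_(k < d) r ^+ 4)).
  apply: ler_sum => k _; rewrite mxE outA_coef.
  case: eqP => [_|_]; rewrite !mxE.
    by case: (o.1.2 j); rewrite ?mulr0 ?exprn_ge0 // -exprD.
  by rewrite mulrACA -!expr2 !sgnr_sqr -exprD.
by rewrite sumr_const card_ord mulr_natl.
Qed.

Lemma norm2_outY o : norm2 (outY o *: outX o) = Num.sqrt d%:R * r * L.
Proof.
rewrite norm2Z norm2E -norm2_sqr norm2_outX sqrtrM ?ler0n // sqrtr_sqr.
rewrite (ger0_norm r_ge0) mulrC; congr (_ * _).
by rewrite /outY; case: o.2; rewrite /sgnr ?normrN ger0_norm.
Qed.

End Bits.

(** * Concentration of matrix and residual over finitely many outcomes *)

Section FiniteErrorBound.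
Context {R : realType} {n d : nat}.
Variable p : 'I_n -> @outcome d -> R.
Hypothesis p_ge0 : forall i o, 0 <= p i o.
Hypothesis p_sum1 : forall i, \sum_o p i o = 1.
Variables (r L : R) (beta : 'cV[R]_d).
Hypothesis r_gt0 : 0 < r.
Hypothesis L_ge0 : 0 <= L.
Hypothesis d_gt0 : (0 < d)%N.

Definition out_residual (o : outcome) : 'cV[R]_d :=
  outA r o *m beta - outY L o *: outX r o.

Definition mean_residual i : 'cV[R]_d := \sum_o p i o *: out_residual o.

(** The quantity al g + ga of the matrix tail bound for the constants of [outA_sqr]. *)
Definition var_proxy (gc : R) : R := 2 * d%:R * r ^+ 2 * gc + 4 * d%:R * r ^+ 4.

(** Root mean square bound for A beta - Y s: the first summand is for A beta, the second is the
    constant norm of Y s. *)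
Definition residual_scale (gc : R) : R :=
  norm2 beta * Num.sqrt (var_proxy gc) + Num.sqrt d%:R * r * L.

Lemma var_proxy_gt0 gc : 0 <= gc -> 0 < var_proxy gc.
Proof.
move=> g0; have r0 := ltW r_gt0.
have h1 : 0 <= 2 * d%:R * r ^+ 2 * gc by rewrite !mulr_ge0 ?sqr_ge0.
have h2 : 0 < 4 * d%:R * r ^+ 4 by rewrite !mulr_gt0 ?ltr0n ?exprn_gt0.
by rewrite /var_proxy; lra.
Qed.

Lemma norm2_residual_le o :
  norm2 (out_residual o) <= norm2 (outA r o *m beta) + Num.sqrt d%:R * r * L.
Proof. by rewrite (le_trans (norm2B _ _)) // (norm2_outY (ltW r_gt0) L_ge0). Qed.

Lemma norm2_residual_bound o : norm2 (out_residual o) <=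
  d%:R * r ^+ 2 * norm2 beta + Num.sqrt d%:R * r * L.
Proof.
by rewrite (le_trans (norm2_residual_le o)) // lerD2r norm2_outA_le // ltW.
Qed.

(** Minkowski's inequality by hand: the variance is at most the second moment, and 2 a e <= a^2 +
    e^2 bounds the mean of a by e. The mean matrices enter only through their average over i, which
    admits fixed designs. *)
Lemma residual_second_moment gc : 0 <= gc ->
  (forall v, \sum_i qform (meanmx p (fun=> outA r) i) v <= n%:R * gc * norm2 v ^+ 2) ->
  \sum_i \sum_o p i o * norm2 (out_residual o - mean_residual i) ^+ 2 <=
  n%:R * residual_scale gc ^+ 2.
Proof.
move=> g0 hg; have r0 := ltW r_gt0; set q := Num.sqrt d%:R * r * L.
have q0 : 0 <= q by rewrite !mulr_ge0 ?sqrtr_ge0 // ltW.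
set e := norm2 beta * Num.sqrt (var_proxy gc).
have e0 : 0 <= e by rewrite mulr_ge0 ?norm2_ge0 ?sqrtr_ge0.
have ka0 := var_proxy_gt0 g0.
pose a o := norm2 (outA r o *m beta).
have m2 : \sum_i \sum_o p i o * a o ^+ 2 <= n%:R * e ^+ 2.
  apply: (@le_trans _ _ (\sum_i (2 * d%:R * r ^+ 2 *
      qform (meanmx p (fun=> outA r) i) beta + 4 * d%:R * r ^+ 4 * norm2 beta ^+ 2))).
    apply: ler_sum => i _; rewrite qform_mean mulr_sumr.
    rewrite -[X in _ <= _ + X]mul1r -[X in _ <= _ + X * _](p_sum1 i) mulr_suml -big_split.
    apply: ler_sum => o _ /=.
    rewrite [2 * _ * _ * (p i o * _)]mulrCA -mulrDr ler_wpM2l //.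
    by apply: outA_sqr => //; exact: ltW.
  rewrite big_split /= -mulr_sumr sumr_const card_ord -[X in _ + X]mulr_natl.
  have := ler_wpM2l (_ : 0 <= 2 * d%:R * r ^+ 2) (hg beta).
  rewrite !mulr_ge0 ?sqr_ge0 // => /(_ erefl).
  by rewrite /e exprMn (sqr_sqrtr (ltW ka0)) /var_proxy; lra.
have m1 : \sum_i \sum_o p i o * a o <= n%:R * e.
  have [e00|en0] := eqVneq e 0.
    have b0 : beta = 0.
      apply/eqP; rewrite -norm2_eq0; move/eqP: e00.
      by rewrite mulf_eq0 [X in _ || X]gt_eqF ?sqrtr_gt0 ?orbF.
    rewrite e00 mulr0 big1 // => i _; rewrite big1 // => o _.
    by rewrite /a b0 mulmx0 norm20 mulr0.
  have ep : 0 < e by rewrite lt_neqAle eq_sym en0.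
  rewrite -(ler_pM2r ep) -(@ler_pM2l _ 2) //.
  apply: (@le_trans _ _ (\sum_i \sum_o p i o * a o ^+ 2 + n%:R * e ^+ 2)); last first.
    by lra.
  have -> : n%:R * e ^+ 2 = \sum_(i < n) \sum_o p i o * e ^+ 2.
    under eq_bigr do rewrite -mulr_suml p_sum1 mul1r.
    by rewrite sumr_const card_ord mulr_natl.
  rewrite mulr_suml mulr_sumr -big_split; apply: ler_sum => i _ /=.
  rewrite mulr_suml mulr_sumr -big_split; apply: ler_sum => o _ /=.
  have := mulr_ge0 (p_ge0 i o) (sqr_ge0 (a o - e)); lra.
apply: (@le_trans _ _ (\sum_i \sum_o p i o * (a o ^+ 2 + 2 * q * a o + q ^+ 2))).
  apply: ler_sum => i _.
  apply: (@le_trans _ _ (\sum_o p i o * norm2 (out_residual o) ^+ 2)).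
    have -> : \sum_o p i o * norm2 (out_residual o - mean_residual i) ^+ 2 =
       \sum_o p i o * norm2 (out_residual o) ^+ 2 - norm2 (mean_residual i) ^+ 2.
      transitivity (\sum_o (p i o * norm2 (out_residual o) ^+ 2 -
        2 * dot (p i o *: out_residual o) (mean_residual i) +
        p i o * norm2 (mean_residual i) ^+ 2)).
        apply: eq_bigr => o _; move: (out_residual o) (mean_residual i) => y m.
        by rewrite !norm2_sqr dotBl !dotBr dotZl (dotC m y); ring.
      rewrite big_split sumrB /= -!mulr_suml -mulr_sumr -dot_suml p_sum1.
      by rewrite -/(mean_residual i) norm2_sqr; ring.
    by rewrite gerBl sqr_ge0.
  apply: ler_sum => o _; rewrite ler_wpM2l //.
  have h := norm2_residual_le o; rewrite -/q -/(a o) in h.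
  have : norm2 (out_residual o) ^+ 2 <= (a o + q) ^+ 2.
    by rewrite ler_sqr ?nnegrE ?norm2_ge0 // addr_ge0 // norm2_ge0.
  by rewrite sqrrD; lra.
have -> : \sum_i \sum_o p i o * (a o ^+ 2 + 2 * q * a o + q ^+ 2) =
    \sum_i \sum_o p i o * a o ^+ 2 + 2 * q * (\sum_i \sum_o p i o * a o) +
    n%:R * q ^+ 2.
  have -> : n%:R * q ^+ 2 = \sum_(i < n) \sum_o p i o * q ^+ 2.
    under eq_bigr do rewrite -mulr_suml p_sum1 mul1r.
    by rewrite sumr_const card_ord mulr_natl.
  rewrite mulr_sumr -!big_split; apply: eq_bigr => i _ /=.
  rewrite mulr_sumr -!big_split; apply: eq_bigr => o _ /=.
  by ring.
have := ler_wpM2l (_ : 0 <= 2 * q) m1; rewrite mulr_ge0 // => /(_ erefl).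
by rewrite /residual_scale -/e -/q; lra.
Qed.

Definition good_outcomes (x0 T : R) (w : {ffun 'I_n -> outcome}) : Prop :=
  (forall v, qform (devmx p (fun=> outA r) w) v <= n%:R * x0 * norm2 v ^+ 2) /\
  norm2 (\sum_i (out_residual (w i) - mean_residual i)) <= T.

Lemma bad_outcomes_pr (gc x0 B u : R) : 0 <= gc -> 0 <= x0 -> 0 <= u ->
  (forall v, \sum_i qform (meanmx p (fun=> outA r) i) v <= n%:R * gc * norm2 v ^+ 2) ->
  0 <= B -> (forall i o, norm2 (out_residual o - mean_residual i) <= B) ->
  \sum_(w | ~~ `[< good_outcomes x0
      (n%:R * (5 / 3 * residual_scale gc * u + 25 / 4 * B * u ^+ 2)) w >])
     prodpr p w <=
  d%:R * expR (- (n%:R * x0 ^+ 2 / (4 * var_proxy gc))) +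
  2 * expR (- (9 / 8 * (n%:R * u ^+ 2))).
Proof.
move=> g0 x0_ge0 u0 hg B0 hB; set T := n%:R * (_ + _).
have r0 := ltW r_gt0.
apply: (@le_trans _ _ (\sum_(w | ~~ `[< forall v, qform (devmx p (fun=> outA r) w) v
      <= n%:R * x0 * norm2 v ^+ 2 >]) prodpr p w +
    \sum_(w : {ffun 'I_n -> outcome} | T < norm2 (\sum_i (out_residual (w i) - mean_residual i)))
      prodpr p w)).
  rewrite big_mkcond [X in _ <= X + _]big_mkcond [X in _ <= _ + X]big_mkcond.
  rewrite -big_split; apply: ler_sum => w _ /=.
  have pw : 0 <= prodpr p w by exact: prodpr_ge0.
  case: (boolP `[< good_outcomes _ _ _ >]) => /= hgood.
    by rewrite addr_ge0 //; case: ifP.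
  case: (boolP `[< _ >]) => /asboolP h1 /=; last by rewrite lerDl; case: ifP.
  case: ltP => h2; first by rewrite lerDr.
  by move: hgood => /asboolP; case.
apply: lerD.
  have := @matrix_lower_tail R _ _ d p p_ge0 p_sum1 (fun=> outA r)
    (2 * d%:R * r ^+ 2) (4 * d%:R * r ^+ 4) gc x0.
  rewrite card_ord; apply => //.
  - by move=> _ o; exact: outA_sym.
  - by rewrite !mulr_ge0 ?sqr_ge0.
  - by rewrite !mulr_ge0 ?exprn_ge0.
  - by move=> i o v; exact: outA_sqr.
  - exact: var_proxy_gt0.
have := @vector_bernstein R _ _ d p p_ge0 p_sum1
  (fun i o => out_residual o - mean_residual i) B _ hB (residual_scale gc) u.
rewrite card_ord; apply => //.
- move=> i; under eq_bigr do rewrite scalerBr.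
  by rewrite sumrB -scaler_suml p_sum1 scale1r subrr.
- by rewrite addr_ge0 ?mulr_ge0 ?norm2_ge0 ?sqrtr_ge0.
- exact: residual_second_moment.
Qed.

End FiniteErrorBound.

(** * Independence *)

Section Independence.
Context (R : realType) (dT : measure_display) (T : measurableType dT).
Variable P : probability T R.
Context {I : finType}.
Variable F : I -> set (set T).
Hypothesis F_meas : forall a A, F a A -> measurable A.
Hypothesis F_setT : forall a, F a setT.
Hypothesis F_setI : forall a, setI_closed (F a).
Hypothesis F_indep : mutually_independent P F.

Definition events_of (J : {set I}) : set (set T) :=
  [set A | exists2 a, a \in J & F a A].

(** [events_of] need not be stable under intersections across sources. These finite intersections
    are, and they generate the same sigma-field, as the uniqueness theorem for measures requires. *)
Definition joint_events (J : {set I}) : set (set T) :=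
  [set E | exists2 B : I -> set T, forall a, a \in J -> F a (B a) &
     E = \bigcap_(a in [set a | a \in J]) B a].

Lemma joint_events_setI J : setI_closed (joint_events J).
Proof.
move=> _ _ [B FB ->] [C FC ->]; exists (fun a => B a `&` C a).
  by move=> a aJ; apply: F_setI; [exact: FB|exact: FC].
by rewrite bigcapI.
Qed.

Lemma events_of_joint J : events_of J `<=` joint_events J.
Proof.
move=> A [a aJ FA]; exists (fun b => if b == a then A else setT).
  by move=> b bJ; case: eqP => [->|].
apply/seteqP; split=> t.
  by move=> At b _; case: eqP.
by move=> /(_ a aJ); rewrite eqxx.
Qed.

Lemma joint_events_meas J E : joint_events J E -> measurable E.
Proof.
move=> [B FB ->]; apply: fin_bigcap_measurable; first exact: finite_finset.
by move=> a aJ; apply: (F_meas (FB a aJ)).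
Qed.

Lemma sigma_joint_events J : <<s joint_events J >> = <<s events_of J >>.
Proof.
apply/seteqP; split; last exact: sub_sigma_algebra2 (@events_of_joint J).
apply: smallest_sub; first exact: smallest_sigma_algebra.
move=> _ [B FB ->].
pose TJ : measurableType _ := g_sigma_algebraType (events_of J).
apply: (@fin_bigcap_measurable _ TJ); first exact: finite_finset.
by move=> a aJ; apply: sub_sigma_algebra; exists a => //; exact: FB.
Qed.

Lemma events_of_meas J E : <<s events_of J >> E -> measurable E.
Proof.
apply: smallest_sub; first exact: sigma_algebra_measurable.
by move=> A [a _ /F_meas].
Qed.

Lemma indep_joint_events (J J' : {set I}) (E E' : set T) :
  (forall a, a \in J -> a \notin J') ->
  joint_events J E -> joint_events J' E' -> (P (E `&` E') = P E * P E')%E.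
Proof.
move=> dJ [B FB ->] [C FC ->].
have dis a : a \in J' -> a \notin J.
  by move=> aJ'; apply/negP => /dJ; rewrite aJ'.
pose D a := if a \in J then B a else C a.
have -> : (\bigcap_(a in [set a | a \in J]) B a) `&`
   (\bigcap_(a in [set a | a \in J']) C a) =
   \bigcap_(a in [set a | a \in J :|: J']) D a.
  apply/seteqP; split=> t.
    move=> [Bt Ct] a /=; rewrite inE /D; case: ifP => [aJ _|_ /= aJ'].
      exact: Bt.
    exact: Ct.
  move=> Dt; split=> a /= aJ.
    by have := Dt a; rewrite /= inE aJ /D aJ => /(_ isT).
  by have := Dt a; rewrite /= inE aJ orbT /D (negbTE (dis a aJ)) => /(_ isT).
rewrite !F_indep //; last first.
  move=> a; rewrite inE /D; case: ifP => [aJ _|_ /= aJ']; first exact: FB.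
  exact: FC.
rewrite (eq_bigl [predU J & J']); last by move=> a; rewrite !inE.
rewrite bigU /=; last first.
  by apply/pred0P => a /=; apply/negP => /andP [/dJ/negbTE ->].
congr (_ * _)%E; apply: eq_bigr => a aJ; rewrite /D ?aJ //.
by rewrite (negbTE (dis a aJ)).
Qed.

(** Both sides are finite measures in E that agree on the pi-system G. *)
Lemma indep_extend (G : set (set T)) (E' : set T) : measurable E' ->
  G `<=` measurable -> setI_closed G -> G setT ->
  (forall E, G E -> (P (E `&` E') = P E * P E')%E) ->
  forall E, <<s G >> E -> (P (E `&` E') = P E * P E')%E.
Proof.
move=> mE' Gm GI GT PG E GE.
have finE' : P E' \is a fin_num by exact: fin_num_measure.
have c0 : 0 <= fine (P E') by rewrite fine_ge0.
pose m1 := mrestr P mE'; pose m2 := mscale (NngNum c0) P.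
have m2E A : (P A * P E')%E = m2 A by rewrite /m2 /mscale /= fineK // muleC.
rewrite m2E.
apply: (@g_sigma_algebra_measure_unique _ R T G Gm (fun=> setT) _ _ m1 m2) => //.
- by rewrite bigcup_const.
- move=> A GA; transitivity (P A * P E')%E; first exact: PG.
  exact: m2E.
- move=> _; have m1T : m1 setT = P E' by rewrite /m1 /mrestr setTI.
  suff : (m1 setT < +oo)%E by [].
  by rewrite m1T -ge0_fin_numE.
Qed.

(** The extension is made on one side at a time, the event of the other side being fixed. *)
Lemma indep_sigma (J J' : {set I}) (E E' : set T) :
  (forall a, a \in J -> a \notin J') ->
  <<s events_of J >> E -> <<s events_of J' >> E' ->
  (P (E `&` E') = P E * P E')%E.
Proof.
move=> dJ; rewrite -!sigma_joint_events.
have GT K : joint_events K setT.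
  by exists (fun=> setT) => //; apply/seteqP; split.
have Gm K : joint_events K `<=` measurable by move=> A; exact: joint_events_meas.
have sm K A : <<s joint_events K >> A -> measurable A.
  by rewrite sigma_joint_events; exact: events_of_meas.
move=> hE hE'; apply: (indep_extend _ (Gm J) (@joint_events_setI J) (GT J) _ hE).
  exact: sm hE'.
move=> A GA; rewrite setIC muleC.
apply: (indep_extend (Gm J _ GA) (Gm J') (@joint_events_setI J') (GT J') _ hE').
move=> B GB; rewrite setIC muleC.
exact: indep_joint_events dJ GA GB.
Qed.

Lemma indep_sigma_family (n : nat) (J : 'I_n -> {set I}) (E : 'I_n -> set T) :
  (forall i k, i != k -> forall a, a \in J i -> a \notin J k) ->
  (forall i, <<s events_of (J i) >> (E i)) ->
  (P (\bigcap_(i in [set: 'I_n]) E i) = \prod_i P (E i))%E.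
Proof.
move=> dJ sE.
have H (m : nat) : (m <= n)%N ->
    (P (\bigcap_(i in [set i : 'I_n | (i < m)%N]) E i) =
     \prod_(i : 'I_n | (i < m)%N) P (E i))%E.
  elim: m => [_|m IH mn].
    rewrite big_pred0 // (_ : [set i : 'I_n | _] = set0) ?bigcap_set0 ?probability_setT //.
    by apply/seteqP; split.
  pose i0 := Ordinal mn.
  have split_m (i : 'I_n) : (i < m.+1)%N = (i == i0) || (i < m)%N.
    by rewrite ltnS leq_eqVlt.
  rewrite (bigD1 i0) /=; last by rewrite ltnS.
  have -> : \bigcap_(i in [set i : 'I_n | (i < m.+1)%N]) E i =
      E i0 `&` \bigcap_(i in [set i : 'I_n | (i < m)%N]) E i.
    apply/seteqP; split=> t.
      move=> h; split; first exact: (h i0 (ltnSn m)).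
      by move=> i /= im; apply: h; exact: leqW.
    move=> [h0 h] i /=; rewrite split_m => /predU1P [-> //|im]; exact: h.
  (* The first m events lie in the sigma-field of the sources [K], which are disjoint from those of
     [i0]. *)
  pose K := \bigcup_(i : 'I_n | (i < m)%N) J i.
  rewrite (@indep_sigma (J i0) K).
  - rewrite IH ?(ltnW mn) //; congr (_ * _)%E; apply: eq_bigl => i.
    by have /= -> := split_m i; case: eqP => [->|] /=; rewrite ?ltnn ?andbT.
  - move=> a a0; apply/finset.bigcupP => -[i im ai].
    have /dJ : i0 != i by rewrite neq_ltn /= im orbT.
    by move=> /(_ a a0); rewrite ai.
  - exact: sE.
  - pose TK : measurableType _ := g_sigma_algebraType (events_of K).
    apply: (@fin_bigcap_measurable _ TK); first exact: finite_finset.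
    move=> i /= im; apply: (sub_sigma_algebra2 (M := events_of (J i)) _ (sE i)).
    by move=> A [a aJ FA]; exists a => //; apply/finset.bigcupP; exists i.
have := H n (leqnn n).
rewrite (_ : [set i : 'I_n | _] = setT); last by apply/seteqP; split=> // i _ /=.
by move=> ->; apply: eq_bigl => i; rewrite ltn_ord.
Qed.

End Independence.

Section TonelliIndependence.
Local Open Scope ereal_scope.
Context (R : realType) (dT dU dS : measure_display).
Context (T : measurableType dT) (U : measurableType dU) (S : measurableType dS).
Variable P : probability T R.

(** By uniqueness on rectangles the joint law is the product of the marginal laws. U may be the
    sample space itself with a smaller sigma-field, and integrating out xi then amounts to
    conditioning on that field. *)
Lemma tonelli_indep (V : T -> U) (xi : T -> S) (f : U * S -> \bar R) :
  measurable_fun [set: T] V -> measurable_fun [set: T] xi ->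
  measurable_fun [set: (U * S)%type] f ->
  (forall z, 0 <= f z) ->
  (forall A B, measurable A -> measurable B ->
    P (V @^-1` A `&` xi @^-1` B) = P (V @^-1` A) * P (xi @^-1` B)) ->
  \int[P]_t f (V t, xi t) = \int[P]_t \int[P]_s f (V t, xi s).
Proof.
move=> mV mxi mf f0 ind.
pose W t := (V t, xi t).
have mW : measurable_fun setT W by exact: measurable_fun_pair.
pose pV : {RV P >-> U} := HB.pack V (isMeasurableFun.Build _ _ _ _ V mV).
pose pxi : {RV P >-> S} := HB.pack xi (isMeasurableFun.Build _ _ _ _ xi mxi).
pose pW : {RV P >-> (U * S)%type} := HB.pack W (isMeasurableFun.Build _ _ _ _ W mW).
transitivity (\int[distribution P pW]_z f z).
  by rewrite ge0_integral_distribution.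
transitivity (\int[distribution P pV \x distribution P pxi]_z f z).
  apply: eq_measure_integral => A mA _; apply/esym.
  by apply: product_measure_unique => // B C mB mC; exact: ind.
rewrite fubini_tonelli1 // ge0_integral_distribution //.
- apply: eq_integral => t _ /=; rewrite /fubini_F.
  rewrite ge0_integral_distribution //; first exact: measurableT_comp.
- exact: measurable_fun_fubini_tonelli_F.
- by move=> y; apply: integral_ge0.
Qed.

End TonelliIndependence.

Section BoundedExpectation.
Context (R : realType) (dT : measure_display) (T : measurableType dT).
Variable P : probability T R.

Definition bounded_rv (f : T -> R) : Prop :=
  measurable_fun setT f /\ exists c, forall t, `|f t| <= c.

Lemma bounded_rv_integrable f : bounded_rv f -> P.-integrable setT (EFin \o f).
Proof.
move=> [mf [c fc]]; apply: measurable_bounded_integrable => //.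
  exact: (le_lt_trans (probability_le1 P measurableT)) (ltry 1).
exists c; split; first exact: num_real.
by move=> x cx t _; apply: (le_trans (fc t)); exact: ltW.
Qed.

Lemma bounded_rv_cst c : bounded_rv (fun=> c).
Proof. by split; [exact: measurable_cst|exists `|c|]. Qed.

Lemma bounded_rvM f g : bounded_rv f -> bounded_rv g ->
  bounded_rv (fun t => f t * g t).
Proof.
move=> [mf [c fc]] [mg [b gb]]; split; first exact: measurable_funM.
by exists (c * b) => t; rewrite normrM ler_pM.
Qed.

Lemma bounded_rvD f g : bounded_rv f -> bounded_rv g ->
  bounded_rv (fun t => f t + g t).
Proof.
move=> [mf [c fc]] [mg [b gb]]; split; first exact: measurable_funD.
by exists (c + b) => t; rewrite (le_trans (ler_normD _ _)) // lerD.
Qed.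

Lemma bounded_rv_sum (I : Type) (r : seq I) (F : I -> T -> R) :
  (forall i, bounded_rv (F i)) -> bounded_rv (fun t => \sum_(i <- r) F i t).
Proof.
move=> bF; elim: r => [|i r IH].
  rewrite (_ : (fun _ => _) = fun=> 0); first exact: bounded_rv_cst.
  by apply/funext => t; rewrite big_nil.
rewrite (_ : (fun _ => _) = fun t => F i t + \sum_(i <- r) F i t).
  exact: bounded_rvD.
by apply/funext => t; rewrite big_cons.
Qed.

Lemma Rintegral_cst1 c : \int[P]_t c = c.
Proof.
by rewrite /Rintegral integral_cst // [X in (_ * X)%E]probability_setT mule1.
Qed.

Lemma Rintegral_sum_bounded (I : Type) (r : seq I) (F : I -> T -> R) :
  (forall i, bounded_rv (F i)) ->
  \int[P]_t (\sum_(i <- r) F i t) = \sum_(i <- r) \int[P]_t F i t.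
Proof.
move=> bF; elim: r => [|i r IH].
  by rewrite big_nil; under eq_Rintegral do rewrite big_nil; rewrite Rintegral_cst1.
under eq_Rintegral do rewrite big_cons.
rewrite RintegralD //; first by rewrite big_cons IH.
  exact: bounded_rv_integrable.
by apply: bounded_rv_integrable; exact: bounded_rv_sum.
Qed.

End BoundedExpectation.
Arguments bounded_rv_cst {R dT T} c.

(** * Clipping and the mean of a dithered quantizer *)

Definition clip {R : realType} (l u z : R) : R := Num.max l (Num.min u z).

Section Clip.
Context {R : realType}.
Implicit Types l u z : R.

Lemma clip_low l u z : l <= u -> z <= l -> clip l u z = l.
Proof. by move=> lu zl; rewrite /clip max_l // ge_min zl orbT. Qed.

Lemma clip_high l u z : l <= u -> u <= z -> clip l u z = u.
Proof. by move=> lu uz; rewrite /clip min_l // max_r. Qed.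

Lemma clip_id l u z : l <= z <= u -> clip l u z = z.
Proof. by move=> /andP [lz zu]; rewrite /clip min_r // max_r. Qed.

End Clip.

Section Quantizer.
Context (R : realType) (dT dS : measure_display).
Context (T : measurableType dT) (S : measurableType dS).
Variable P : probability T R.
Variables (l u : R) (Q : R -> S -> R) (xi : {RV P >-> S}).
Hypothesis lu : l <= u.
Hypothesis Q_dq : dithered_quantizer l u Q xi.

Lemma clip_ge z : l <= clip l u z.
Proof. by rewrite /clip le_max lexx. Qed.

Lemma clip_le z : clip l u z <= u.
Proof. by rewrite /clip ge_max lu ge_min lexx. Qed.

Lemma measurable_clip : measurable_fun setT (clip l u).
Proof. by apply: measurable_maxr => //; apply: measurable_minr. Qed.

Lemma quantizer_range z s : l <= Q z s <= u.
Proof. by have [_ /(_ z s) [->|->] _ _] := Q_dq; rewrite lexx lu. Qed.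

Lemma measurable_quantizer dU (U : measurableType dU) (V : U -> R) (X : U -> S) :
  measurable_fun setT V -> measurable_fun setT X ->
  measurable_fun setT (fun w => Q (V w) (X w)).
Proof.
move=> mV mX; have [mQ _ _ _] := Q_dq.
exact: (measurableT_comp mQ (measurable_fun_pair mV mX)).
Qed.

Lemma quantizer_bounded (V : T -> R) : measurable_fun setT V ->
  bounded_rv (fun w => Q (V w) (xi w)).
Proof.
move=> mV; split; first by apply: measurable_quantizer.
exists (`|l| + `|u|) => w; have /andP [h1 h2] := quantizer_range (V w) (xi w).
rewrite ler_norml; apply/andP; split.
  rewrite (le_trans _ h1) // lerNl (le_trans (ler_norm _)) // normrN.
  by rewrite lerDl.
by rewrite (le_trans h2) // (le_trans (ler_norm _)) // lerDr.
Qed.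

(** The output is a two-point variable with mean l + (u - l) P (output = u). Outside the range it is
    the nearest endpoint, hence the clip; a degenerate range l = u is covered as well. *)
Lemma quantizer_mean z : \int[P]_w Q z (xi w) = clip l u z.
Proof.
have [mQ Qlu Qin Qout] := Q_dq.
pose E := [set w | Q z (xi w) = u].
have mE : measurable E.
  rewrite (_ : E = (fun w => Q z (xi w)) @^-1` [set u]) //.
  by rewrite -[X in measurable X]setTI; apply: measurable_quantizer.
have -> : \int[P]_w Q z (xi w) = l + (u - l) * fine (P E).
  have QE w : Q z (xi w) = l + (u - l) * \1_E w.
    rewrite indicE; case: (boolP (w \in E)) => [|/negP wE].
      by rewrite inE => ->; rewrite mulr1 addrC subrK.
    have [->|Qu] := Qlu z (xi w); first by rewrite mulr0 addr0.
    by exfalso; apply: wE; rewrite inE.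
  under eq_Rintegral do rewrite QE.
  have bE : bounded_rv (\1_E : T -> R).
    split; first exact: measurable_indic.
    by exists 1 => w; rewrite indicE; case: (w \in E); rewrite ?normr1 ?normr0.
  rewrite RintegralD //; last 2 first.
  - by apply: bounded_rv_integrable; exact: bounded_rv_cst.
  - apply: bounded_rv_integrable; apply: bounded_rvM => //.
    exact: bounded_rv_cst.
  rewrite Rintegral_cst1 RintegralZl //; last exact: bounded_rv_integrable.
  by rewrite /Rintegral integral_indic // setIT.
move: lu; rewrite le_eqVlt => /predU1P [lu0|ltlu].
  have := clip_ge z; have := clip_le z; rewrite -lu0 subrr mul0r addr0 => h1 h2.
  by apply/eqP; rewrite eq_le h1 h2.
have ul0 : u - l != 0 by rewrite subr_eq0 gt_eqF.
rewrite /clip; case: (ltP z l) => [zl|lz].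
  have -> : P E = 0%E.
    rewrite (_ : E = set0) ?measure0 //; apply/seteqP; split=> // w Eu.
    have : l = u by rewrite -Eu; have [/(_ zl)] := Qout z (xi w).
    by move=> h; move: ltlu; rewrite h ltxx.
  rewrite min_r ?(ltW (lt_trans zl ltlu)) // max_l ?(ltW zl) // /=.
  by rewrite mulr0 addr0.
case: (ltP u z) => [uz|zu].
  have -> : P E = 1%E.
    rewrite (_ : E = setT) ?probability_setT //; apply/seteqP; split=> // w _.
    by have [_ /(_ uz)] := Qout z (xi w).
  rewrite max_r // ?(ltW ltlu) //=; ring.
have -> : P E = ((z - l) / (u - l))%:E.
  by have [|] := Qin z ltlu; rewrite ?lz.
by rewrite /= max_r //; field.
Qed.

(* Conditionally on a sigma-field generated by G and independent of xi, the
   quantizer is unbiased for the clipped input. *)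
Lemma quantizer_unbiased (G : set (set T)) (h V : T -> R) :
  G `<=` measurable ->
  (forall E B, <<s G >> E -> measurable B ->
    (P (E `&` xi @^-1` B) = P E * P (xi @^-1` B))%E) ->
  measurable_fun setT (h : g_sigma_algebraType G -> R) ->
  measurable_fun setT (V : g_sigma_algebraType G -> R) ->
  (exists c, forall w, `|h w| <= c) ->
  \int[P]_w (h w * Q (V w) (xi w)) = \int[P]_w (h w * clip l u (V w)).
Proof.
move=> Gm ind mh mV [c hc].
have sG A : <<s G >> A -> measurable A.
  by apply: smallest_sub => //; exact: sigma_algebra_measurable.
have down (f : T -> R) : measurable_fun setT (f : g_sigma_algebraType G -> R) ->
    measurable_fun setT f.
  by move=> mf _ B mB; apply: sG; exact: mf.
have bV : bounded_rv (fun w => Q (V w) (xi w)).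
  by apply: quantizer_bounded; exact: down.
have bC : bounded_rv (fun w => clip l u (V w)).
  split; first by apply: measurableT_comp; [exact: measurable_clip|exact: down].
  exists (`|l| + `|u|) => w; have h1 := clip_ge (V w); have h2 := clip_le (V w).
  rewrite ler_norml; apply/andP; split.
    rewrite (le_trans _ h1) // lerNl (le_trans (ler_norm _)) // normrN.
    by rewrite lerDl.
  by rewrite (le_trans h2) // (le_trans (ler_norm _)) // lerDr.
(* Tonelli's theorem wants nonnegative integrands, so the quantizer is shifted by l and [h] by its
   bound c. The instances g = 1 and g = h + c together remove both shifts by linearity. *)
have key (g : T -> R) : measurable_fun setT (g : g_sigma_algebraType G -> R) ->
    (forall w, 0 <= g w) ->
    \int[P]_w (g w * (Q (V w) (xi w) - l)) = \int[P]_w (g w * (clip l u (V w) - l)).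
  move=> mg g0; rewrite /Rintegral; congr fine.
  (* The sample point, seen in the smaller sigma-field, plays the role of V in [tonelli_indep]. *)
  have mid : measurable_fun setT (id : T -> g_sigma_algebraType G).
    by move=> _ B mB; rewrite setTI; exact: sG.
  pose f (ts : g_sigma_algebraType G * S) : \bar R :=
    (g ts.1 * (Q (V ts.1) ts.2 - l))%:E.
  have mf : measurable_fun setT f.
    apply/measurable_EFinP; apply: measurable_funM.
      exact: measurableT_comp.
    apply: measurable_funB; last exact: measurable_cst.
    by apply: measurable_quantizer => //; exact: measurableT_comp.
  have f0 z : (0 <= f z)%E.
    rewrite lee_fin mulr_ge0 // subr_ge0.
    by have /andP [] := quantizer_range (V z.1) z.2.
  transitivity (\int[P]_t f (t, xi t))%E; first by [].
  rewrite (tonelli_indep mid _ mf f0 (fun A B mA mB => ind A B mA mB)) //.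
  apply: eq_integral => t _; rewrite /f /=.
  have -> : clip l u (V t) = \int[P]_w Q (V t) (xi w) by rewrite quantizer_mean.
  have bQ : bounded_rv (fun w => Q (V t) (xi w)).
    by apply: quantizer_bounded; exact: measurable_cst.
  rewrite -[X in _ = (_ * (_ - X))%:E](Rintegral_cst1 P).
  rewrite -RintegralB //; last 2 first.
  - exact: bounded_rv_integrable.
  - by apply: bounded_rv_integrable; exact: bounded_rv_cst.
  rewrite -RintegralZl //; last first.
    apply: bounded_rv_integrable; apply: bounded_rvD => //.
    exact: bounded_rv_cst.
  rewrite /Rintegral fineK //.
  apply: integrable_fin_num => //; apply: bounded_rv_integrable.
  apply: bounded_rvM; first exact: bounded_rv_cst.
  by apply: bounded_rvD => //; exact: bounded_rv_cst.
have bh : bounded_rv h by split; [exact: down|exists c].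
have c0 w : 0 <= h w + c.
  by have := hc w; rewrite ler_norml => /andP [h1 _]; lra.
have k1 := key (fun=> 1) (measurable_cst _) (fun=> ler01).
have k2 := key (fun w => h w + c) (measurable_funD mh (measurable_cst c)) c0.
have expand (q : T -> R) (a : R) : bounded_rv q ->
    \int[P]_w ((h w + a) * (q w - l)) = \int[P]_w (h w * q w) - l * \int[P]_w h w +
      a * \int[P]_w q w - a * l.
  move=> bq.
  have i1 := bounded_rv_integrable P bh.
  have i2 := bounded_rv_integrable P bq.
  have i3 := bounded_rv_integrable P (bounded_rvM bh bq).
  have i4 := bounded_rv_integrable P (bounded_rvM (bounded_rv_cst l) bh).
  have i5 := bounded_rv_integrable P (bounded_rvM (bounded_rv_cst a) bq).
  have b6 := bounded_rvD (bounded_rvM bh bq)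
    (bounded_rvM (bounded_rv_cst (-1)) (bounded_rvM (bounded_rv_cst l) bh)).
  have b7 := bounded_rvD b6 (bounded_rvM (bounded_rv_cst a) bq).
  have -> : \int[P]_w ((h w + a) * (q w - l)) =
      \int[P]_w (((h w * q w + -1 * (l * h w)) + a * q w) - a * l).
    by apply: eq_Rintegral => w _; ring.
  rewrite RintegralB //; last 2 first.
  - exact: bounded_rv_integrable.
  - by apply: bounded_rv_integrable; exact: bounded_rv_cst.
  rewrite Rintegral_cst1 RintegralD //; last exact: bounded_rv_integrable.
  rewrite RintegralD //; last first.
    apply: bounded_rv_integrable; apply: bounded_rvM; first exact: bounded_rv_cst.
    by apply: bounded_rvM => //; exact: bounded_rv_cst.
  rewrite !RintegralZl //; by [ring|exact: bounded_rv_integrable].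
move: k2; rewrite !expand // => k2.
have k3 : \int[P]_w Q (V w) (xi w) = \int[P]_w clip l u (V w).
  have shift (q : T -> R) : bounded_rv q ->
      \int[P]_w (1 * (q w - l)) = \int[P]_w q w - l.
    move=> bq; under eq_Rintegral do rewrite mul1r.
    rewrite RintegralB //; last 2 first.
    - exact: bounded_rv_integrable.
    - by apply: bounded_rv_integrable; exact: bounded_rv_cst.
    by rewrite Rintegral_cst1.
  by move: k1; rewrite !shift //; lra.
by move: k2; rewrite k3; lra.
Qed.

End Quantizer.

(** * Reduction to a finite product space *)

Section ModelBits.
Context (R : realType) (dT dS : measure_display).
Context (T : measurableType dT) (S : measurableType dS).
Context (P : probability T R) (n d : nat).
Variables (X : 'I_n -> {RV P >-> d.-tuple R}) (eps : 'I_n -> {RV P >-> R}).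
Variables (xiX xiX2 : 'I_n -> 'I_d -> {RV P >-> S}) (xiY : 'I_n -> {RV P >-> S}).
Variables (QX QX2 QY : R -> S -> R).
Variables (beta : 'cV[R]_d) (sigma r L : R).
Hypothesis r_ge0 : 0 <= r.
Hypothesis L_ge0 : 0 <= L.
Hypothesis model_indep : independent_model X eps xiX xiX2 xiY.
Hypothesis model_quant : dithered_quantizers xiX xiX2 xiY QX QX2 QY r L.

Let source : finType :=
  (('I_n + 'I_n) + (('I_n * 'I_d) + ('I_n * 'I_d) + 'I_n))%type.

Let F (a : source) : set (set T) :=
  match a with
  | inl (inl i) => sigma_field_of (X i)
  | inl (inr i) => sigma_field_of (eps i)
  | inr (inl (inl (i, j))) => sigma_field_of (xiX i j)
  | inr (inl (inr (i, j))) => sigma_field_of (xiX2 i j)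
  | inr (inr i) => sigma_field_of (xiY i)
  end.

Let sX i : source := inl (inl i).
Let sE i : source := inl (inr i).
Let sxX i j : source := inr (inl (inl (i, j))).
Let sxX2 i j : source := inr (inl (inr (i, j))).
Let sxY i : source := inr (inr i).

Let F_indep : mutually_independent P F := model_indep.

Lemma sigma_field_of_meas dU (U : measurableType dU) (Z : {RV P >-> U}) A :
  sigma_field_of Z A -> measurable A.
Proof.
by move=> [B mB <-]; exact: measurable_funP.
Qed.

Lemma sigma_field_of_setT dU (U : measurableType dU) (Z : {RV P >-> U}) :
  sigma_field_of Z setT.
Proof. by exists setT => //; rewrite preimage_setT setIT. Qed.

Lemma sigma_field_of_setI dU (U : measurableType dU) (Z : {RV P >-> U}) :
  setI_closed (sigma_field_of Z).
Proof.
move=> _ _ [B mB <-] [C mC <-]; exists (B `&` C); first exact: measurableI.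
by rewrite preimage_setI setIIr.
Qed.

Let F_meas a A : F a A -> measurable A.
Proof. by case: a => [[i|i]|[[[i j]|[i j]]|i]] /=; exact: sigma_field_of_meas. Qed.

Let F_setT a : F a setT.
Proof. by case: a => [[i|i]|[[[i j]|[i j]]|i]] /=; exact: sigma_field_of_setT. Qed.

Let F_setI a : setI_closed (F a).
Proof. by case: a => [[i|i]|[[[i j]|[i j]]|i]] /=; exact: sigma_field_of_setI. Qed.

Let gen (J : {set source}) : set (set T) := events_of F J.

Let gen_meas J : gen J `<=` measurable.
Proof. by move=> A [a _ /F_meas]. Qed.

Let source_measurable dU (U : measurableType dU) (Z : {RV P >-> U}) (a : source)
  (J : {set source}) : F a = sigma_field_of Z -> a \in J ->
  measurable_fun setT ((Z : T -> U) : g_sigma_algebraType (gen J) -> U).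
Proof.
move=> Fa aJ _ B mB; apply: sub_sigma_algebra; exists a => //.
by rewrite Fa; exists B.
Qed.

Let source_indep dU (U : measurableType dU) (Z : {RV P >-> U}) (a : source)
  (J : {set source}) (E : set T) (B : set U) :
  F a = sigma_field_of Z -> a \notin J -> <<s gen J >> E -> measurable B ->
  (P (E `&` Z @^-1` B) = P E * P (Z @^-1` B))%E.
Proof.
move=> Fa aJ sE' mB.
apply: (indep_sigma F_meas F_setT F_setI F_indep (J := J) (J' := [set a]%SET)) => //.
  by move=> b bJ; rewrite inE; apply: contraNneq aJ => <-.
apply: sub_sigma_algebra; exists a; first by rewrite inE.
by rewrite Fa; exists B => //; rewrite setTI.
Qed.

Lemma X_eps_indep i (A : set (d.-tuple R)) (B : set R) :
  measurable A -> measurable B ->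
  (P (X i @^-1` A `&` eps i @^-1` B) = P (X i @^-1` A) * P (eps i @^-1` B))%E.
Proof.
move=> mA mB.
apply: (@source_indep _ _ (eps i) (sE i) [set sX i]%SET) => //.
  by rewrite !inE.
apply: sub_sigma_algebra; exists (sX i); first by rewrite inE.
by exists A => //; rewrite setTI.
Qed.

Definition clipX i w : 'cV[R]_d := \col_j clip (- r) r (tnth (X i w) j).

Definition clipY i w : R := clip (- L) L (response X eps beta sigma i w).

Let rr : - r <= r. Proof. by rewrite ge0_cp. Qed.
Let LL : - L <= L. Proof. by rewrite ge0_cp. Qed.
Let r2 : 0 <= r ^+ 2. Proof. exact: sqr_ge0. Qed.

(** It makes the quantizers of squares consistent with those of coordinates: the diagonal of the
    mean is also a second moment of clipped predictors. *)
Lemma clip_sqr x : clip 0 (r ^+ 2) (x ^+ 2) = clip (- r) r x ^+ 2.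
Proof.
have [xr|rx] := leP x (- r).
  rewrite (clip_low rr xr) sqrrN clip_high // -(sqrrN x) ler_sqr ?nnegrE //.
    by rewrite lerNr.
  by rewrite lerNr oppr0 (le_trans xr) // oppr_le0.
have [xr|{}xr] := leP r x.
  by rewrite (clip_high rr xr) clip_high // ler_sqr ?nnegrE // (le_trans r_ge0).
rewrite (@clip_id _ (- r)) ?(ltW rx) ?(ltW xr) // clip_id // sqr_ge0 /=.
rewrite -(real_normK (num_real x)) ler_sqr ?nnegrE // ler_norml.
by rewrite (ltW rx) (ltW xr).
Qed.

Section Measurability.
Variable J : {set source}.
Let TJ := g_sigma_algebraType (gen J).

Lemma coordX_meas i j : sX i \in J ->
  measurable_fun setT ((fun w => tnth (X i w) j) : TJ -> R).
Proof.
move=> iJ; apply: (measurableT_comp (measurable_tnth j)).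
exact: (source_measurable _ iJ).
Qed.

Lemma response_meas i : sX i \in J -> sE i \in J ->
  measurable_fun setT (response X eps beta sigma i : TJ -> R).
Proof.
move=> iJ eJ; apply: measurable_funD.
  apply: measurable_sum => j; apply: measurable_funM; last exact: measurable_cst.
  under eq_fun do rewrite mxE; exact: coordX_meas.
apply: measurable_funM; first exact: measurable_cst.
exact: (source_measurable _ eJ).
Qed.

Lemma quantX_meas i j : sX i \in J -> sxX i j \in J ->
  measurable_fun setT ((fun w => quantX X xiX QX i w j 0) : TJ -> R).
Proof.
move=> iJ xJ; under eq_fun do rewrite mxE.
have [hX _ _] := model_quant.
apply: (measurable_quantizer (hX i j)); first exact: coordX_meas.
exact: (source_measurable _ xJ).
Qed.

Lemma quantX2_meas i j : sX i \in J -> sxX2 i j \in J ->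
  measurable_fun setT ((fun w => quantX2 X xiX2 QX2 i w 0 j) : TJ -> R).
Proof.
move=> iJ xJ; under eq_fun do rewrite mxE.
have [_ hX _] := model_quant.
apply: (measurable_quantizer (hX i j)).
  by apply: measurable_funX; exact: coordX_meas.
exact: (source_measurable _ xJ).
Qed.

Lemma quantY_meas i : sX i \in J -> sE i \in J -> sxY i \in J ->
  measurable_fun setT (quantY X eps xiY QY beta sigma i : TJ -> R).
Proof.
move=> iJ eJ xJ; have [_ _ hY] := model_quant.
apply: (measurable_quantizer (hY i)); first exact: response_meas.
exact: (source_measurable _ xJ).
Qed.

End Measurability.

Lemma coordX_meas0 i j : measurable_fun setT (fun w => tnth (X i w) j).
Proof. by apply: (measurableT_comp (measurable_tnth j)). Qed.

Lemma response_meas0 i : measurable_fun setT (response X eps beta sigma i).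
Proof.
apply: measurable_funD.
  apply: measurable_sum => j; apply: measurable_funM; last exact: measurable_cst.
  under eq_fun do rewrite mxE; exact: coordX_meas0.
by apply: measurable_funM.
Qed.

Lemma quantX_abs i j w : `|quantX X xiX QX i w j 0| <= r.
Proof.
rewrite mxE ler_norml; have [hX _ _] := model_quant.
exact: (quantizer_range rr (hX i j)).
Qed.

Lemma clip_abs (l x : R) : 0 <= l -> `|clip (- l) l x| <= l.
Proof.
move=> l0; have ll : - l <= l by rewrite ge0_cp.
by rewrite ler_norml clip_ge clip_le.
Qed.

(** One quantizer at a time is replaced by its conditional mean: the k-th given X_i and the
    randomness of the j-th, and afterwards the j-th given X_i. For j = k both factors would share
    one source of randomness. *)
Lemma E_quantX_offdiag i j k : j != k ->
  \int[P]_w (quantX X xiX QX i w j 0 * quantX X xiX QX i w k 0) =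
  \int[P]_w (clipX i w j 0 * clipX i w k 0).
Proof.
move=> jk; have [hX _ _] := model_quant.
transitivity (\int[P]_w (quantX X xiX QX i w j 0 * clip (- r) r (tnth (X i w) k))).
  under eq_Rintegral do rewrite [X in _ * X]mxE.
  pose J : {set source} := [set sX i; sxX i j]%SET.
  apply: (quantizer_unbiased rr (hX i k) (@gen_meas J)).
  - move=> E B sE' mB; apply: (source_indep (a := sxX i k) _ _ sE' mB) => //.
    by apply/negP; rewrite !inE => /orP [//|/eqP [kj]]; move: jk; rewrite kj eqxx.
  - by apply: quantX_meas; rewrite !inE eqxx ?orbT.
  - by apply: coordX_meas; rewrite !inE eqxx.
  - by exists r => w; exact: quantX_abs.
under eq_Rintegral do rewrite mulrC [X in _ * X]mxE.
under [RHS]eq_Rintegral do rewrite mulrC !mxE.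
pose J : {set source} := [set sX i]%SET.
apply: (quantizer_unbiased rr (hX i j) (@gen_meas J)).
- by move=> E B sE' mB; apply: (source_indep (a := sxX i j) _ _ sE' mB); rewrite // !inE.
- apply: measurableT_comp; first exact: measurable_clip.
  by apply: coordX_meas; rewrite !inE eqxx.
- by apply: coordX_meas; rewrite !inE eqxx.
- by exists r => w; exact: clip_abs.
Qed.

Lemma E_quantX2 i j :
  \int[P]_w quantX2 X xiX2 QX2 i w 0 j = \int[P]_w (clipX i w j 0 * clipX i w j 0).
Proof.
have [_ hX _] := model_quant.
transitivity (\int[P]_w (1 * QX2 (tnth (X i w) j ^+ 2) (xiX2 i j w))).
  by apply: eq_Rintegral => w _; rewrite mul1r mxE.
transitivity (\int[P]_w (1 * clip 0 (r ^+ 2) (tnth (X i w) j ^+ 2))).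
  pose J : {set source} := [set sX i]%SET.
  apply: (quantizer_unbiased r2 (hX i j) (@gen_meas J)).
  - by move=> E B sE' mB; apply: (source_indep (a := sxX2 i j) _ _ sE' mB); rewrite // !inE.
  - exact: measurable_cst.
  - by apply: measurable_funX; apply: coordX_meas; rewrite !inE eqxx.
  - by exists 1 => w; rewrite normr1.
by apply: eq_Rintegral => w _; rewrite mul1r clip_sqr !mxE expr2.
Qed.

Lemma E_quantYX i j :
  \int[P]_w (quantY X eps xiY QY beta sigma i w * quantX X xiX QX i w j 0) =
  \int[P]_w (clipY i w * clipX i w j 0).
Proof.
have [hX _ hY] := model_quant.
transitivity (\int[P]_w (quantX X xiX QX i w j 0 * clipY i w)).
  under eq_Rintegral do rewrite mulrC.
  pose J : {set source} := [set sX i; sE i; sxX i j]%SET.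
  apply: (quantizer_unbiased LL (hY i) (@gen_meas J)).
  - by move=> E B sE' mB; apply: (source_indep (a := sxY i) _ _ sE' mB); rewrite // !inE.
  - by apply: quantX_meas; rewrite !inE eqxx ?orbT.
  - by apply: response_meas; rewrite !inE eqxx ?orbT.
  - by exists r => w; exact: quantX_abs.
under eq_Rintegral do rewrite mulrC mxE.
under [RHS]eq_Rintegral do rewrite mxE.
pose J : {set source} := [set sX i; sE i]%SET.
apply: (quantizer_unbiased rr (hX i j) (@gen_meas J)).
- by move=> E B sE' mB; apply: (source_indep (a := sxX i j) _ _ sE' mB); rewrite // !inE.
- apply: measurableT_comp; first exact: measurable_clip.
  by apply: response_meas; rewrite !inE eqxx ?orbT.
- by apply: coordX_meas; rewrite !inE eqxx.
- by exists L => w; exact: clip_abs.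
Qed.

Definition outcome_of i w : @outcome d :=
  ([ffun j => quantX X xiX QX i w j 0 == r],
   [ffun j => quantX2 X xiX2 QX2 i w 0 j == r ^+ 2],
   quantY X eps xiY QY beta sigma i w == L).

Lemma quantX_out i w : quantX X xiX QX i w = outX r (outcome_of i w).
Proof.
apply/colP => j; rewrite [RHS]mxE ffunE /sgnr; case: eqP => // ne.
have [hX _ _] := model_quant; have [_ h _ _] := hX i j.
by move: ne; rewrite mxE; have [->|->] := h (tnth (X i w) j) (xiX i j w).
Qed.

Lemma quantX2_out i w : quantX2 X xiX2 QX2 i w = outX2 r (outcome_of i w).
Proof.
apply/rowP => j; rewrite [RHS]mxE ffunE; case: eqP => // ne.
have [_ hX _] := model_quant; have [_ h _ _] := hX i j.
by move: ne; rewrite mxE; have [->|->] := h (tnth (X i w) j ^+ 2) (xiX2 i j w).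
Qed.

Lemma quantY_out i w : quantY X eps xiY QY beta sigma i w = outY L (outcome_of i w).
Proof.
rewrite /outY /= /sgnr; case: eqP => // ne.
have [_ _ hY] := model_quant; have [_ h _ _] := hY i.
by move: ne; rewrite /quantY; have [->|->] := h (response X eps beta sigma i w) (xiY i w).
Qed.

Lemma Sigma_hat_out w : Sigma_hat X xiX xiX2 QX QX2 r w =
  n%:R^-1 *: \sum_i outA r (outcome_of i w).
Proof.
by congr (_ *: _); apply: eq_bigr => i _; rewrite quantX_out quantX2_out.
Qed.

Lemma Sigma_Xy_hat_out w : Sigma_Xy_hat X eps xiX xiY QX QY beta sigma w =
  n%:R^-1 *: \sum_i (outY L (outcome_of i w) *: outX r (outcome_of i w)).
Proof.
by congr (_ *: _); apply: eq_bigr => i _; rewrite quantX_out quantY_out.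
Qed.

Let sources i : {set source} := [set a |
  match a with
  | inl (inl k) => k == i
  | inl (inr k) => k == i
  | inr (inl (inl (k, _))) => k == i
  | inr (inl (inr (k, _))) => k == i
  | inr (inr k) => k == i
  end]%SET.

(** The outcome of observation i uses its own sources only, and distinct observations have disjoint
    sources; hence the product law of the outcomes. *)
Lemma outcome_sigma i o : <<s gen (sources i) >> [set w | outcome_of i w = o].
Proof.
pose TJ : measurableType _ := g_sigma_algebraType (gen (sources i)).
have -> : [set w | outcome_of i w = o] =
   (\bigcap_(j in [set: 'I_d]) [set w | (quantX X xiX QX i w j 0 == r) = o.1.1 j]) `&`
   (\bigcap_(j in [set: 'I_d])
      [set w | (quantX2 X xiX2 QX2 i w 0 j == r ^+ 2) = o.1.2 j]) `&`
   [set w | (quantY X eps xiY QY beta sigma i w == L) = o.2].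
  apply/seteqP; split=> w /=.
    by move=> <- /=; split=> //; split=> j _ /=; rewrite ffunE.
  move=> [[h1 h2] h3]; case: o h1 h2 h3 => [[q1 q2] q3] /= h1 h2 h3.
  rewrite /outcome_of h3; congr (_, _, _); apply/ffunP => j; rewrite ffunE.
    exact: h1.
  exact: h2.
have bit (f : T -> R) (c : R) (b : bool) : measurable_fun setT (f : TJ -> R) ->
    measurable ([set w | (f w == c) = b] : set TJ).
  move=> mf; have mb : measurable_fun setT ((fun w => f w == c) : TJ -> bool).
    by apply: measurable_fun_eqr => //; exact: measurable_cst.
  rewrite (_ : [set w | _] = (fun w => f w == c) @^-1` [set b]) //.
  by rewrite -[X in measurable X]setTI; exact: mb.
apply: (@measurableI _ TJ).
  apply: (@measurableI _ TJ).
    apply: (@fin_bigcap_measurable _ TJ); first exact: finite_finset.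
    by move=> j _; apply: bit; apply: quantX_meas; rewrite finset.in_set /=.
  apply: (@fin_bigcap_measurable _ TJ); first exact: finite_finset.
  by move=> j _; apply: bit; apply: quantX2_meas; rewrite finset.in_set /=.
by apply: bit; apply: quantY_meas; rewrite finset.in_set /=.
Qed.

Lemma outcome_meas i o : measurable [set w | outcome_of i w = o].
Proof. exact: (events_of_meas F_meas (@outcome_sigma i o)). Qed.

Definition outcome_law i o : R := fine (P [set w | outcome_of i w = o]).

Lemma outcome_law_ge0 i o : 0 <= outcome_law i o.
Proof. by rewrite fine_ge0. Qed.

Lemma outcome_lawE i o : (outcome_law i o)%:E = P [set w | outcome_of i w = o].
Proof. by rewrite fineK // fin_num_measure //; exact: outcome_meas. Qed.

Lemma E_outcome i (f : outcome -> R) :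
  \int[P]_w f (outcome_of i w) = \sum_o outcome_law i o * f o.
Proof.
have fE w : f (outcome_of i w) = \sum_o f o * \1_[set w | outcome_of i w = o] w.
  rewrite (bigD1 (outcome_of i w)) //= indicE mem_set //= mulr1.
  rewrite big1 ?addr0 // => o ow; rewrite indicE memNset ?mulr0 //= => h.
  by rewrite h eqxx in ow.
have bI o : bounded_rv (\1_[set w | outcome_of i w = o] : T -> R).
  split; first by apply: measurable_indic; exact: outcome_meas.
  by exists 1 => w; rewrite indicE; case: (w \in _); rewrite ?normr1 ?normr0.
under eq_Rintegral do rewrite fE.
rewrite Rintegral_sum_bounded; last first.
  by move=> o; apply: bounded_rvM; [exact: bounded_rv_cst|exact: bI].
apply: eq_bigr => o _; rewrite RintegralZl //; last exact: bounded_rv_integrable.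
rewrite mulrC; congr (_ * _); rewrite /Rintegral integral_indic ?setIT //.
exact: outcome_meas.
Qed.

Lemma outcome_law_sum1 i : \sum_o outcome_law i o = 1.
Proof.
have := E_outcome i (fun=> 1); rewrite Rintegral_cst1 => ->.
by apply: eq_bigr => o _; rewrite mulr1.
Qed.

Definition outcomes_of w : {ffun 'I_n -> @outcome d} := [ffun i => outcome_of i w].

Lemma outcomes_pr (c : {ffun 'I_n -> @outcome d}) :
  measurable [set w | outcomes_of w = c] /\
  P [set w | outcomes_of w = c] = (prodpr outcome_law c)%:E.
Proof.
have -> : [set w | outcomes_of w = c] =
    \bigcap_(i in [set: 'I_n]) [set w | outcome_of i w = c i].
  apply/seteqP; split=> w /=.
    by move=> <- i _ /=; rewrite ffunE.
  by move=> h; apply/ffunP => i; rewrite ffunE; exact: h.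
split.
  apply: fin_bigcap_measurable; first exact: finite_finset.
  by move=> i _; exact: outcome_meas.
rewrite (indep_sigma_family F_meas F_setT F_setI F_indep (J := sources)).
- rewrite /prodpr -prodEFin; apply: eq_bigr => i _; exact/esym/outcome_lawE.
- move=> i k ik [[l|l]|[[[l j]|[l j]]|l]]; rewrite !finset.in_set /= => /eqP ->;
    by rewrite (negbTE ik).
- by move=> i; exact: outcome_sigma.
Qed.

(** Every set of outcomes is an event, so the good event is measurable however the estimator is
    defined elsewhere. *)
Lemma outcomes_event_pr (B : pred {ffun 'I_n -> @outcome d}) :
  measurable [set w | B (outcomes_of w)] /\
  P [set w | B (outcomes_of w)] = (\sum_(c | B c) prodpr outcome_law c)%:E.
Proof.
have mc c := (outcomes_pr c).1.
have mB : measurable [set w | B (outcomes_of w)].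
  rewrite (_ : [set w | _] = \bigcup_(c in [set c | B c]) [set w | outcomes_of w = c]).
    by apply: fin_bigcup_measurable => // ; exact: finite_finset.
  by apply/seteqP; split=> w /=; [move=> Bw; exists (outcomes_of w)|case=> c Bc ->].
split=> //.
have bI (A : set T) : measurable A -> bounded_rv (\1_A : T -> R).
  move=> mA; split; first exact: measurable_indic.
  by exists 1 => w; rewrite indicE; case: (w \in A); rewrite ?normr1 ?normr0.
have PE (A : set T) : measurable A -> fine (P A) = \int[P]_w (\1_A w : R).
  by move=> mA; rewrite /Rintegral integral_indic // setIT.
rewrite -[LHS]fineK ?fin_num_measure //; congr EFin.
rewrite PE //.
have -> : \int[P]_w (\1_[set w | B (outcomes_of w)] w : R) =
    \int[P]_w (\sum_(c | B c) (\1_[set w | outcomes_of w = c] w : R)).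
  apply: eq_Rintegral => w _; rewrite indicE.
  have out c : c != outcomes_of w -> \1_[set w | outcomes_of w = c] w = 0 :> R.
    by move=> cw; rewrite indicE memNset //= => h; rewrite h eqxx in cw.
  case: (boolP (B (outcomes_of w))) => Bw.
    rewrite mem_set // (bigD1 (outcomes_of w)) //= indicE mem_set //.
    by rewrite big1 ?addr0 // => c /andP [_]; exact: out.
  rewrite memNset /=; last exact/negP.
  by rewrite big1 // => c Bc; apply: out; apply: contraNneq Bw => <-.
under eq_Rintegral do rewrite -big_filter.
rewrite Rintegral_sum_bounded; last by move=> c; exact: bI.
rewrite big_filter; apply: eq_bigr => c _.
by rewrite -PE // (outcomes_pr c).2.
Qed.

Definition clip_moment i : 'M[R]_d :=
  \matrix_(j, k) \int[P]_w (clipX i w j 0 * clipX i w k 0).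

Definition clip_cross i : 'cV[R]_d :=
  \col_j \int[P]_w (clipY i w * clipX i w j 0).

Lemma mean_outA i : meanmx outcome_law (fun=> outA r) i = clip_moment i.
Proof.
apply/matrixP => j k; rewrite summxE [RHS]mxE.
transitivity (\int[P]_w outA r (outcome_of i w) j k).
  by rewrite (E_outcome i (fun o => outA r o j k)); apply: eq_bigr => o _; rewrite mxE.
under eq_Rintegral do rewrite outA_coef -quantX_out -quantX2_out.
case: eqVneq => [<-|jk]; first exact: E_quantX2.
exact: E_quantX_offdiag.
Qed.

Lemma mean_residualE i :
  mean_residual outcome_law r L beta i = clip_moment i *m beta - clip_cross i.
Proof.
rewrite /mean_residual /out_residual.
under eq_bigr do rewrite scalerBr.
rewrite sumrB; congr (_ - _).
  by rewrite -mean_outA mulmx_suml; apply: eq_bigr => o _; rewrite scalemxAl.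
apply/colP => j; rewrite summxE [RHS]mxE.
transitivity (\int[P]_w (outY L (outcome_of i w) * outX r (outcome_of i w) j 0)).
  rewrite (E_outcome i (fun o => outY L o * outX r o j 0)).
  by apply: eq_bigr => o _; rewrite !mxE.
under eq_Rintegral do rewrite -quantX_out -quantY_out.
exact: E_quantYX.
Qed.

(** Common core of both parts: [b] bounds the clipping bias of a residual, [M] is the logarithmic
    level, and [x0] is the part of the eigenvalue bound [l] given up to fluctuations. *)
Lemma model_error_bound (bh : T -> 'cV[R]_d) (gc l x0 b M : R) :
  (0 < n)%N -> (0 < d)%N -> 0 < r -> 0 <= gc -> 0 <= x0 -> x0 < l -> 0 <= b ->
  0 <= M ->
  (forall v, \sum_i qform (clip_moment i) v <= n%:R * gc * norm2 v ^+ 2) ->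
  (forall v, n%:R * l * norm2 v ^+ 2 <= \sum_i qform (clip_moment i) v) ->
  (forall i, norm2 (clip_moment i *m beta - clip_cross i) <= b) ->
  is_estimator X eps xiX xiX2 xiY QX QX2 QY beta sigma r bh ->
  let u := Num.sqrt (M / n%:R) in
  let B := d%:R * r ^+ 2 * norm2 beta + Num.sqrt d%:R * r * L + b in
  with_prob_at_least P
    (1 - (d%:R * expR (- (n%:R * x0 ^+ 2 / (4 * var_proxy (d := d) r gc))) +
          2 * expR (- (9 / 8 * M))))
    [set w | norm2 (bh w - beta) <=
      (5 / 3 * residual_scale r L beta gc * u + 25 / 4 * B * u ^+ 2 + b) / (l - x0)].
Proof.
move=> n0 d0 r0 g0 x00 x0l b0 M0 hg hl hb est u B.
have nR : 0 < n%:R :> R by rewrite ltr0n.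
have u0 : 0 <= u by exact: sqrtr_ge0.
have uu : n%:R * u ^+ 2 = M.
  by rewrite sqr_sqrtr ?divr_ge0 // mulrCA divff ?mulr1 // gt_eqF.
have B0 : 0 <= B.
  by rewrite !addr_ge0 ?mulr_ge0 ?norm2_ge0 ?sqrtr_ge0 ?sqr_ge0.
have hg' v : \sum_i qform (meanmx outcome_law (fun=> outA r) i) v <=
    n%:R * gc * norm2 v ^+ 2.
  by under eq_bigr do rewrite mean_outA; exact: hg.
have hB i o : norm2 (out_residual r L beta o - mean_residual outcome_law r L beta i) <= B.
  rewrite (le_trans (norm2B _ _)) // lerD //.
    exact: norm2_residual_bound.
  by rewrite mean_residualE.
have := @bad_outcomes_pr R n d outcome_law outcome_law_ge0 outcome_law_sum1 r L beta
  r0 L_ge0 d0 gc x0 B u g0 x00 u0 hg' B0 hB.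
rewrite uu; set TT := n%:R * (_ + _) => hbad.
pose good := good_outcomes outcome_law r L beta x0 TT.
have [mG PG] := outcomes_event_pr (fun c => `[< good c >]).
exists [set w | `[< good (outcomes_of w) >]]; split=> //; last first.
  rewrite PG lee_fin.
  have := prodpr_sum1 outcome_law_sum1.
  rewrite (bigID (fun c => `[< good c >])) /= => tot.
  by move: hbad tot; rewrite -/good; lra.
move=> w /= /asboolP [hS hZ].
set Sh := Sigma_hat X xiX xiX2 QX QX2 r w.
have SE : Sh = n%:R^-1 *: \sum_i outA r (outcome_of i w) by exact: Sigma_hat_out.
have sS : Sh^T = Sh.
  rewrite SE linearZ /= linear_sum; congr (_ *: _).
  by apply: eq_bigr => i _; exact: outA_sym.
have lx : 0 < l - x0 by rewrite subr_gt0.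
have Sl v : (l - x0) * norm2 v ^+ 2 <= qform Sh v.
  have h1 := hS v; have h2 := hl v.
  have dE : qform (devmx outcome_law (fun=> outA r) (outcomes_of w)) v =
     \sum_i qform (clip_moment i) v - n%:R * qform Sh v.
    rewrite SE qformZ mulrA divff ?gt_eqF // mul1r !qform_sum -sumrB.
    by apply: eq_bigr => i _; rewrite qformB mean_outA ffunE.
  rewrite dE in h1; rewrite -(ler_pM2l nR); lra.
have pS : posdefmx Sh.
  split=> // v v0; apply: lt_le_trans (Sl v).
  by rewrite mulr_gt0 // exprn_gt0 // lt_neqAle norm2_ge0 eq_sym norm2_eq0 v0.
apply: (le_trans (minimizer_error beta sS lx Sl (est w pS))).
rewrite ler_pM2r ?invr_gt0 //.
(* The numerator is minus the averaged residual, split into its centred part and its mean. *)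
have -> : Sigma_Xy_hat X eps xiX xiY QX QY beta sigma w - Sh *m beta =
   - (n%:R^-1 *: (\sum_i (out_residual r L beta (outcomes_of w i) -
        mean_residual outcome_law r L beta i))
     + n%:R^-1 *: \sum_i mean_residual outcome_law r L beta i).
  rewrite -scalerDr -big_split /= SE Sigma_Xy_hat_out -scalemxAl mulmx_suml.
  rewrite -scalerBr -scalerN; congr (_ *: _); rewrite -sumrB -sumrN.
  by apply: eq_bigr => i _; rewrite subrK /out_residual ffunE opprB.
rewrite norm2N (le_trans (norm2D _ _)) // lerD // norm2Z ger0_norm ?invr_ge0 ?(ltW nR) //.
  by rewrite ler_pdivrMl.
rewrite ler_pdivrMl // (le_trans (norm2_sum _ _ _)) //.
apply: (@le_trans _ _ (\sum_(i < n) b)); last by rewrite sumr_const card_ord mulr_natl.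
by apply: ler_sum => i _; rewrite mean_residualE.
Qed.

End ModelBits.

(** * Error of the estimator *)

Section FinalBound.
Context (R : realType).

Lemma with_prob_at_leastW (dT : measure_display) (T : measurableType dT)
    (P : probability T R) (q q' : R) (E E' : set T) :
  with_prob_at_least P q E -> q' <= q -> E `<=` E' -> with_prob_at_least P q' E'.
Proof.
move=> [A [mA AE PA]] qq EE; exists A; split=> //.
  exact: subset_trans AE EE.
by apply: le_trans PA; rewrite lee_fin.
Qed.

Lemma ln2_ge_half : 2^-1 <= ln 2 :> R.
Proof.
have := @le_ln1Dx R (- 2^-1); rewrite (_ : 1 + - 2^-1 = 2^-1); last by field.
rewrite lnV ?posrE // => h.
by have := h; rewrite ltrN2 invf_lt1 ?ltr1n // => /(_ isT); lra.
Qed.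

Lemma log_max_ge0 (n d : nat) : (0 < d)%N -> 2^-1 <= log_max R n d.
Proof.
move=> d0; rewrite /log_max le_max; apply/orP; right.
rewrite (le_trans ln2_ge_half) // ler_ln ?posrE ?ltr0n ?muln_gt0 //.
by rewrite ler_nat -[X in (X <= _)%N]muln1 leq_mul2l.
Qed.

(** [err] without the factor 2 / [lambda_min], since the eigenvalue bound in the denominator differs
    between the two parts. *)
Definition err_scale (n d : nat) (Sigma : 'M[R]_d) (beta : 'cV[R]_d) (r L : R) : R :=
  norm2 beta *
     Num.sqrt ((32 * d%:R * r ^+ 4 + 8 * d%:R * r ^+ 2 * opnorm Sigma) *
               log_max R n d / n%:R) +
   norm2 beta * (8 * (2 * d + 1)%:R * r ^+ 2 * log_max R n d / n%:R) +
   Num.sqrt (4 * d%:R * r ^+ 2 * L ^+ 2 * log_max R n d / n%:R).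

Section Arithmetic.
Variables (n d : nat) (Sigma : 'M[R]_d) (beta : 'cV[R]_d) (r L : R).
Hypothesis n_gt0 : (0 < n)%N.
Hypothesis d_gt0 : (0 < d)%N.
Hypothesis r_gt0 : 0 < r.
Hypothesis L_ge0 : 0 <= L.
Hypothesis lam_gt0 : 0 < lambda_min Sigma.
Hypothesis lam_le : lambda_min Sigma <= r ^+ 2.
Hypothesis sample : sample_size_condition n Sigma r.

Let N : R := n%:R.
Let D : R := d%:R.
Let M := log_max R n d.
Let O := opnorm Sigma.
Let lam := lambda_min Sigma.
(** The summand r^2 leaves room for the clipping bias in the upper bound on the mean matrix. *)
Let kappa := var_proxy (d := d) r (O + r ^+ 2).
Let u := Num.sqrt (M / N).

Let N0 : 0 < N. Proof. by rewrite ltr0n. Qed.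
Let D1 : 1 <= D. Proof. by rewrite ler1n. Qed.
Let D0 : 0 < D. Proof. by rewrite ltr0n. Qed.
Let M_ge : 2^-1 <= M. Proof. exact: log_max_ge0. Qed.
Let M0 : 0 <= M. Proof. by apply: le_trans M_ge. Qed.
Let O0 : 0 <= O. Proof. exact: opnorm_ge0. Qed.

Lemma sample_size_lower :
  (512 * D * r ^+ 4 + 128 * D * r ^+ 2 * O) * M <= N * lam ^+ 2.
Proof.
have l2 : 0 < lam ^+ 2 by rewrite exprn_gt0.
have : (512 * D * r ^+ 4 + 128 * D * r ^+ 2 * O) / lam ^+ 2 * M <= N.
  apply: le_trans sample; rewrite ler_wpM2r // le_max lexx //.
by rewrite mulrAC ler_pdivrMr.
Qed.

Let r4 : lam ^+ 2 <= r ^+ 4.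
Proof.
rewrite (_ : 4%N = (2 * 2)%N) // exprM ler_sqr ?nnegrE ?sqr_ge0 //; exact: ltW.
Qed.

(** Since [lambda_min] <= r^2, the ranges cancel from the condition on n. With log_max >= 1/2 this
    gives n >= 256, and it also gives u <= 1/20. *)
Lemma log_over_n_le : 512 * D * M <= N.
Proof.
have l2 : 0 < lam ^+ 2 by rewrite exprn_gt0.
rewrite -(ler_pM2r l2) (le_trans _ sample_size_lower) //.
have DM0 : 0 <= D * M by rewrite mulr_ge0 // ltW.
have h1 : D * M * lam ^+ 2 <= D * M * r ^+ 4 by rewrite ler_wpM2l.
have h2 : 0 <= D * M * (r ^+ 2 * O) by rewrite mulr_ge0 // mulr_ge0 ?sqr_ge0.
lra.
Qed.

Lemma n_ge256 : 256 <= N.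
Proof.
apply: le_trans log_over_n_le.
have : 2^-1 <= D * M by rewrite (le_trans M_ge) // ler_peMl.
lra.
Qed.

Lemma usqrE : u ^+ 2 = M / N.
Proof. by rewrite sqr_sqrtr // divr_ge0 // ltW. Qed.

Lemma u_le : u <= 20^-1.
Proof.
have MDM : M <= D * M by rewrite ler_peMl.
have h : M <= 400^-1 * N by have := log_over_n_le; have := N0; have := MDM; lra.
have e20 : 20^-1 ^+ 2 = 400^-1 :> R by field.
by rewrite -ler_sqr ?nnegrE ?sqrtr_ge0 // usqrE ler_pdivrMr // e20.
Qed.

Lemma failure_prob_le :
  D * expR (- (N * (lam / 2) ^+ 2 / (4 * kappa))) + 2 * expR (- (9 / 8 * M)) <= 2 / N.
Proof.
have ka0 : 0 < kappa by apply: var_proxy_gt0 => //; rewrite addr_ge0 ?sqr_ge0.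
have NM : N <= expR M.
  by rewrite -[N]lnK ?posrE // ler_expR /M /log_max le_max lexx.
have DM : 2 * D <= expR M.
  rewrite -natrM -[X in X <= _]lnK ?posrE ?ltr0n ?muln_gt0 //.
  by rewrite ler_expR /M /log_max le_max lexx orbT.
have Mp : 0 < expR M := expR_gt0 M.
have e1 : expR (- M) <= N^-1 by rewrite expRN lef_pV2 ?posrE.
(* The condition on n is calibrated for 16 M kappa <= n lam^2 / 4, with 32 d r^4 M to spare. Since d
   <= exp M, the matrix term is then at most exp (-3 M). *)
have t1 : 4 * M <= N * (lam / 2) ^+ 2 / (4 * kappa).
  rewrite ler_pdivlMr ?mulr_gt0 //.
  have h := sample_size_lower.
  have h2 : 0 <= D * r ^+ 4 * M.
    by rewrite mulr_ge0 // mulr_ge0 ?exprn_ge0 ?(ltW D0) ?(ltW r_gt0).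
  rewrite /kappa /var_proxy -/D.
  have -> : 4 * M * (4 * (2 * D * r ^+ 2 * (O + r ^+ 2) + 4 * D * r ^+ 4)) =
    4^-1 * ((512 * D * r ^+ 4 + 128 * D * r ^+ 2 * O) * M - 128 * D * r ^+ 4 * M) by field.
  have -> : N * (lam / 2) ^+ 2 = 4^-1 * (N * lam ^+ 2) by field.
  lra.
have e2 : D * expR (- (N * (lam / 2) ^+ 2 / (4 * kappa))) <= N^-1.
  apply: (@le_trans _ _ (expR M * expR (- (4 * M)))).
    apply: ler_pM; rewrite ?expR_ge0 ?(ltW D0) //; first by lra.
    by rewrite ler_expR lerN2.
  rewrite -expRD; apply: (le_trans _ e1); rewrite ler_expR; have := M0; lra.
(* exp (-M) accounts for 1/n, and the remaining M / 8 pays for the factor 2 because exp M >= n >=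
   256 = 2^8. *)
have e3 : 2 * expR (- (9 / 8 * M)) <= N^-1.
  apply: (le_trans _ e1).
  have -> : - (9 / 8 * M) = - (M / 8) + - M by field.
  rewrite expRD mulrA ler_piMl ?expR_ge0 // expRN ler_pdivrMr ?expR_gt0 // mul1r.
  have : (2 : R) ^+ 8 <= expR (M / 8) ^+ 8.
    rewrite -expRM_natl (_ : 8%:R * (M / 8) = M); last by field.
    by rewrite (le_trans _ NM) // (le_trans _ n_ge256) //; lra.
  by rewrite ler_pXn2r ?nnegrE ?expR_ge0.
lra.
Qed.

Lemma rate_le :
  5 / 3 * residual_scale r L beta (O + r ^+ 2) * u +
  25 / 4 * (D * r ^+ 2 * norm2 beta + Num.sqrt D * r * L) * u ^+ 2 <=
  err_scale n Sigma beta r L.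
Proof.
have u0 : 0 <= u by exact: sqrtr_ge0.
have nb := norm2_ge0 beta.
have ka0 : 0 < kappa by apply: var_proxy_gt0 => //; rewrite addr_ge0 ?sqr_ge0.
set q := Num.sqrt D * r * L.
have q0 : 0 <= q by rewrite !mulr_ge0 ?sqrtr_ge0 // ltW.
have MN : 0 <= M / N by rewrite divr_ge0 // ltW.
rewrite /err_scale /residual_scale -/q -/kappa -/M -/O -/N -/D.
have h1 : 5 / 3 * Num.sqrt kappa * u <=
   Num.sqrt ((32 * D * r ^+ 4 + 8 * D * r ^+ 2 * O) * M / N).
  rewrite -ler_sqr ?nnegrE ?mulr_ge0 ?sqrtr_ge0 //.
  rewrite !exprMn usqrE sqr_sqrtr ?(ltW ka0) // sqr_sqrtr; last first.
    rewrite -mulrA mulr_ge0 // addr_ge0 // !mulr_ge0 ?sqr_ge0 ?exprn_ge0 //; exact: ltW.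
  rewrite -[leRHS]mulrA ler_wpM2r // /kappa /var_proxy -/D.
  have c1 : 0 <= D * r ^+ 2 * O by rewrite !mulr_ge0 ?sqr_ge0 // ltW.
  have c2 : 0 <= D * r ^+ 4 by rewrite !mulr_ge0 ?exprn_ge0 // ltW.
  have -> : 2 * D * r ^+ 2 * (O + r ^+ 2) = 2 * (D * r ^+ 2 * O) + 2 * (D * r ^+ 4) by ring.
  lra.
have h2 : 25 / 4 * (D * r ^+ 2) * u ^+ 2 <= 8 * (2 * d + 1)%:R * r ^+ 2 * M / N.
  rewrite usqrE -[leRHS]mulrA ler_wpM2r //.
  rewrite natrD natrM -/D.
  have c1 : 0 <= D * r ^+ 2 by rewrite mulr_ge0 ?sqr_ge0 // ltW.
  have c2 := sqr_ge0 r.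
  lra.
have h3 : Num.sqrt (4 * D * r ^+ 2 * L ^+ 2 * M / N) = 2 * q * u.
  have quu : 0 <= 2 * q * u by apply: mulr_ge0 => //; apply: mulr_ge0.
  rewrite -[RHS](ger0_norm quu) -sqrtr_sqr; congr Num.sqrt.
  by rewrite !exprMn usqrE sqr_sqrtr ?(ltW D0) //; ring.
(* u <= 1/20 gives 25/4 u^2 <= 5/16 u, and 5/3 + 5/16 < 2. *)
have h4 : 5 / 3 * q * u + 25 / 4 * q * u ^+ 2 <= 2 * q * u.
  have := u_le; have qu : 0 <= q * u by rewrite mulr_ge0.
  move=> /(ler_wpM2l qu); lra.
have h1' := ler_wpM2l nb h1; have h2' := ler_wpM2l nb h2.
rewrite h3; lra.
Qed.

End Arithmetic.

Section Model.
Context (dT dS : measure_display).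
Context (T : measurableType dT) (S : measurableType dS).
Context (P : probability T R) (n d : nat).
Variables (X : 'I_n -> {RV P >-> d.-tuple R}) (eps : 'I_n -> {RV P >-> R}).
Variables (xiX xiX2 : 'I_n -> 'I_d -> {RV P >-> S}) (xiY : 'I_n -> {RV P >-> S}).
Variables (QX QX2 QY : R -> S -> R).
Variables (Sigma : 'M[R]_d) (beta : 'cV[R]_d) (sigma r L : R).
Variable bh : T -> 'cV[R]_d.

Lemma estimator_error (l b : R) :
  (0 < n)%N -> (0 < d)%N -> 0 < r -> 0 <= L ->
  independent_model X eps xiX xiX2 xiY ->
  dithered_quantizers xiX xiX2 xiY QX QX2 QY r L ->
  is_estimator X eps xiX xiX2 xiY QX QX2 QY beta sigma r bh ->
  0 < lambda_min Sigma -> lambda_min Sigma <= r ^+ 2 ->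
  sample_size_condition n Sigma r ->
  lambda_min Sigma / 2 < l -> 0 <= b ->
  (forall v, \sum_i qform (clip_moment X r i) v <=
     n%:R * (opnorm Sigma + r ^+ 2) * norm2 v ^+ 2) ->
  (forall v, n%:R * l * norm2 v ^+ 2 <= \sum_i qform (clip_moment X r i) v) ->
  (forall i, norm2 (clip_moment X r i *m beta -
     clip_cross X eps beta sigma r L i) <= b) ->
  with_prob_at_least P (1 - 2 / n%:R)
    [set w | norm2 (bh w - beta) <=
      (err_scale n Sigma beta r L + 2 * b) / (l - lambda_min Sigma / 2)].
Proof.
move=> n0 d0 r0 L0 ind quant est lam0 lamr ss ll b0 hup hlow hb.
have M0 : 0 <= log_max R n d by rewrite (le_trans _ (log_max_ge0 n d0)).
apply: (with_prob_at_leastW (model_error_bound (ltW r0) L0 ind quant n0 d0 r0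
  (gc := opnorm Sigma + r ^+ 2) _ _ ll b0 M0 hup hlow hb est)).
- by rewrite addr_ge0 ?sqr_ge0 ?opnorm_ge0.
- by rewrite divr_ge0 // ltW.
- by rewrite lerD2l lerN2 failure_prob_le.
move=> w /= /le_trans; apply.
rewrite ler_pM2r ?invr_gt0 ?subr_gt0 //.
set u := Num.sqrt _; have u0 : 0 <= u by exact: sqrtr_ge0.
have rl : 5 / 3 * residual_scale r L beta (opnorm Sigma + r ^+ 2) * u +
    25 / 4 * (d%:R * r ^+ 2 * norm2 beta + Num.sqrt d%:R * r * L) * u ^+ 2 <=
    err_scale n Sigma beta r L by apply: rate_le.
have u1 : u <= 20^-1 by apply: (@u_le n d Sigma r).
(* 25/4 u^2 <= 1/64, so the two bias terms stay below 2 b. *)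
have bu : 25 / 4 * b * u ^+ 2 <= b.
  have : u ^+ 2 <= 20^-1 ^+ 2 by rewrite ler_sqr ?nnegrE.
  by move=> /(ler_wpM2l b0); lra.
lra.
Qed.

End Model.
End FinalBound.

(** * Integrable random variables *)

Section IntegrableRV.
Context (R : realType) (dT : measure_display) (T : measurableType dT).
Variable P : probability T R.
Implicit Types f g : T -> R.

Definition integrable_rv f : Prop := P.-integrable setT (EFin \o f).

Lemma integrable_rv_meas f : integrable_rv f -> measurable_fun setT f.
Proof. by move=> /measurable_int /measurable_EFinP. Qed.

Lemma integrable_rvD f g : integrable_rv f -> integrable_rv g ->
  integrable_rv (fun w => f w + g w).
Proof. by move=> hf hg; exact: (integrableD measurableT hf hg). Qed.

Lemma integrable_rvZ c f : integrable_rv f -> integrable_rv (fun w => c * f w).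
Proof. by move=> hf; exact: (integrableZl measurableT c hf). Qed.

Lemma integrable_rvB f g : integrable_rv f -> integrable_rv g ->
  integrable_rv (fun w => f w - g w).
Proof. by move=> hf hg; exact: (integrableB measurableT hf hg). Qed.

Lemma integrable_rv_cst c : integrable_rv (fun=> c).
Proof. by apply: bounded_rv_integrable; exact: bounded_rv_cst. Qed.

Lemma integrable_rv_le f g : measurable_fun setT f -> integrable_rv g ->
  (forall w, `|f w| <= g w) -> integrable_rv f.
Proof.
move=> mf hg fg; apply: (le_integrable measurableT _ _ hg).
  exact/measurable_EFinP.
by move=> w _ /=; rewrite lee_fin (le_trans (fg w)) // ler_norm.
Qed.

Lemma integrable_rv_sum (I : Type) (s : seq I) (F : I -> T -> R) :
  (forall i, integrable_rv (F i)) -> integrable_rv (fun w => \sum_(i <- s) F i w).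
Proof.
move=> hF; elim: s => [|i s IH].
  rewrite (_ : (fun _ => _) = fun=> 0); first exact: integrable_rv_cst.
  by apply/funext => w; rewrite big_nil.
rewrite (_ : (fun _ => _) = fun w => F i w + \sum_(i <- s) F i w).
  exact: integrable_rvD.
by apply/funext => w; rewrite big_cons.
Qed.

Lemma Rintegral_sum_rv (I : Type) (s : seq I) (F : I -> T -> R) :
  (forall i, integrable_rv (F i)) ->
  \int[P]_w (\sum_(i <- s) F i w) = \sum_(i <- s) \int[P]_w F i w.
Proof.
move=> hF; elim: s => [|i s IH].
  by rewrite big_nil; under eq_Rintegral do rewrite big_nil; rewrite Rintegral_cst1.
under eq_Rintegral do rewrite big_cons.
by rewrite RintegralD // ?big_cons ?IH //; [exact: hF|exact: integrable_rv_sum].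
Qed.

Lemma ge0_integrable_rv f : measurable_fun setT f -> (forall w, 0 <= f w) ->
  (\int[P]_w (f w)%:E < +oo)%E -> integrable_rv f.
Proof.
move=> mf f0 foo; apply/integrableP; split; first exact/measurable_EFinP.
by under eq_integral do rewrite /= ger0_norm //.
Qed.

Lemma integrable_rv_EFin f : integrable_rv f ->
  (\int[P]_w f w)%:E = (\int[P]_w (f w)%:E)%E.
Proof. by move=> hf; rewrite fineK //; exact: integrable_fin_num. Qed.

Lemma sqr_integrable_mul f g : measurable_fun setT f -> measurable_fun setT g ->
  integrable_rv (fun w => f w ^+ 2) -> integrable_rv (fun w => g w ^+ 2) ->
  integrable_rv (fun w => f w * g w).
Proof.
move=> mf mg hf hg; apply: (integrable_rv_le _ (integrable_rvD hf hg)).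
  exact: measurable_funM.
move=> w; have h1 := sqr_ge0 (f w - g w); have h2 := sqr_ge0 (f w + g w).
have h3 := sqr_ge0 (f w); have h4 := sqr_ge0 (g w).
by rewrite ler_norml; apply/andP; split; lra.
Qed.

Lemma sqr_integrable f : measurable_fun setT f ->
  integrable_rv (fun w => f w ^+ 2) -> integrable_rv f.
Proof.
move=> mf hf; apply: (integrable_rv_le mf (integrable_rvD (integrable_rv_cst 1) hf)).
move=> w; have h1 := sqr_ge0 (f w - 1); have h2 := sqr_ge0 (f w + 1).
by rewrite ler_norml; apply/andP; split; lra.
Qed.

Lemma ae_Rintegral f g : measurable_fun setT f -> measurable_fun setT g ->
  {ae P, forall w, f w = g w} -> \int[P]_w f w = \int[P]_w g w.
Proof.
move=> mf mg fg; congr fine; apply: ae_eq_integral => //; try exact/measurable_EFinP.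
by apply: filterS fg => w /= -> _.
Qed.

Section IndependentProduct.
Variables f g : T -> R.
Hypothesis fg_indep : forall A B : set R, measurable A -> measurable B ->
  (P (f @^-1` A `&` g @^-1` B) = P (f @^-1` A) * P (g @^-1` B))%E.
Hypothesis f_int : integrable_rv f.
Hypothesis g_int : integrable_rv g.

Let mf := integrable_rv_meas f_int.
Let mg := integrable_rv_meas g_int.

(** The bound by |x| covers positive and negative parts, so four instances give the product rule for
    signed variables, with integrability of the product as part of the conclusion. *)
Lemma ge0_indep_product (a b : R -> R) : measurable_fun setT a ->
  measurable_fun setT b -> (forall x, 0 <= a x <= `|x|) ->
  (forall x, 0 <= b x <= `|x|) ->
  integrable_rv (fun w => a (f w) * b (g w)) /\
  \int[P]_w (a (f w) * b (g w)) = \int[P]_w a (f w) * \int[P]_w b (g w).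
Proof.
move=> ma mb a0 b0.
have ia : integrable_rv (fun w => a (f w)).
  apply: (integrable_rv_le (g := fun w => `|f w|)).
  - exact: measurableT_comp.
  - exact: (integrable_abse f_int).
  - by move=> w; have /andP [h1 h2] := a0 (f w); rewrite ger0_norm.
have ib : integrable_rv (fun w => b (g w)).
  apply: (integrable_rv_le (g := fun w => `|g w|)).
  - exact: measurableT_comp.
  - exact: (integrable_abse g_int).
  - by move=> w; have /andP [h1 h2] := b0 (g w); rewrite ger0_norm.
have h (w : T) : 0 <= a (f w) by have /andP [] := a0 (f w).
have h' (w : T) : 0 <= b (g w) by have /andP [] := b0 (g w).
have E : (\int[P]_w (a (f w) * b (g w))%:E =
    (\int[P]_w a (f w))%:E * (\int[P]_w b (g w))%:E)%E.
  pose F (z : R * R) : \bar R := (a z.1 * b z.2)%:E.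
  transitivity (\int[P]_w F (f w, g w))%E; first by [].
  rewrite (tonelli_indep mf mg _ _ fg_indep); last 2 first.
  - apply/measurable_EFinP; apply: measurable_funM; exact: measurableT_comp.
  - move=> z; rewrite lee_fin mulr_ge0 //.
      by have /andP [] := a0 z.1.
    by have /andP [] := b0 z.2.
  transitivity (\int[P]_w ((a (f w))%:E * (\int[P]_w b (g w))%:E))%E.
    apply: eq_integral => w _; rewrite /F /=.
    under eq_integral do rewrite EFinM.
    rewrite ge0_integralZl_EFin //; last 2 first.
    - by move=> s _; rewrite lee_fin.
    - by apply/measurable_EFinP; exact: integrable_rv_meas ib.
    by rewrite integrable_rv_EFin.
  rewrite ge0_integralZr //; last 3 first.
  - by apply/measurable_EFinP; exact: integrable_rv_meas ia.
  - by move=> s _; rewrite lee_fin.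
  - by rewrite lee_fin; apply: Rintegral_ge0 => w _.
  by rewrite (integrable_rv_EFin ia).
have iab : integrable_rv (fun w => a (f w) * b (g w)).
  apply: ge0_integrable_rv.
  - by apply: measurable_funM; [exact: integrable_rv_meas ia|exact: integrable_rv_meas ib].
  - by move=> w; rewrite mulr_ge0.
  - by rewrite E -EFinM ltry.
by split=> //; apply: EFin_inj; rewrite integrable_rv_EFin // E -EFinM.
Qed.

Lemma indep_product : integrable_rv (fun w => f w * g w) /\
  \int[P]_w (f w * g w) = \int[P]_w f w * \int[P]_w g w.
Proof.
pose p (x : R) := Num.max x 0; pose m (x : R) := Num.max (- x) 0.
have mp : measurable_fun setT p by apply: measurable_maxr => //; exact: measurable_cst.
have mm : measurable_fun setT m.
  by apply: measurable_maxr; [exact: oppr_measurable|exact: measurable_cst].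
have xE (x : R) : x = p x - m x.
  rewrite /p /m; have [x0|x0] := leP x 0.
    by rewrite max_l ?oppr_ge0 // sub0r opprK.
  by rewrite max_r ?oppr_le0 ?(ltW x0) // subr0.
have hp (x : R) : 0 <= p x <= `|x|.
  by rewrite /p le_max lexx orbT ge_max ler_norm normr_ge0.
have hm (x : R) : 0 <= m x <= `|x|.
  by rewrite /m le_max lexx orbT ge_max -normrN ler_norm normr_ge0.
have [i1 e1] := ge0_indep_product mp mp hp hp.
have [i2 e2] := ge0_indep_product mp mm hp hm.
have [i3 e3] := ge0_indep_product mm mp hm hp.
have [i4 e4] := ge0_indep_product mm mm hm hm.
have fgE : (fun w => f w * g w) = (fun w => (p (f w) * p (g w) - p (f w) * m (g w)) -
    (m (f w) * p (g w) - m (f w) * m (g w))).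
  by apply/funext => w; rewrite {1}(xE (f w)) {1}(xE (g w)); ring.
have i12 := integrable_rvB i1 i2; have i34 := integrable_rvB i3 i4.
have part (q : R -> R) (h : T -> R) : measurable_fun setT q -> integrable_rv h ->
    (forall x, 0 <= q x <= `|x|) -> integrable_rv (fun w => q (h w)).
  move=> mq ih hq; apply: (integrable_rv_le (g := fun w => `|h w|)).
  - by apply: measurableT_comp => //; exact: integrable_rv_meas ih.
  - exact: (integrable_abse ih).
  - by move=> w; have /andP [h1 h2] := hq (h w); rewrite ger0_norm.
split; first by rewrite fgE; exact: integrable_rvB.
have -> : \int[P]_w (f w * g w) = \int[P]_w ((p (f w) * p (g w) - p (f w) * m (g w)) -
    (m (f w) * p (g w) - m (f w) * m (g w))) by rewrite -fgE.
rewrite RintegralB // RintegralB // RintegralB // e1 e2 e3 e4.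
have -> : \int[P]_w f w = \int[P]_w p (f w) - \int[P]_w m (f w).
  rewrite -RintegralB //; [|exact: part|exact: part].
  by apply: eq_Rintegral => w _; rewrite -xE.
have -> : \int[P]_w g w = \int[P]_w p (g w) - \int[P]_w m (g w).
  rewrite -RintegralB //; [|exact: part|exact: part].
  by apply: eq_Rintegral => w _; rewrite -xE.
ring.
Qed.

End IndependentProduct.
End IntegrableRV.

(** * Fixed range *)

Section Noise.
Context (R : realType) (dT : measure_display) (T : measurableType dT).
Variable P : probability T R.

Lemma centered_variance (Z : {RV P >-> R}) (v : R) :
  ('E_P[Z] = 0)%E -> ('V_P[Z] = v%:E)%E ->
  [/\ integrable_rv P (fun w => Z w ^+ 2), \int[P]_w (Z w ^+ 2) = v,
      integrable_rv P Z & \int[P]_w Z w = 0].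
Proof.
move=> EZ VZ.
have mZ : measurable_fun setT Z by [].
have E2 : (\int[P]_w (Z w ^+ 2)%:E = v%:E)%E.
  rewrite -VZ /variance unlock EZ /= unlock; apply: eq_integral => w _ /=.
  by congr EFin; transitivity ((Z w - 0) * (Z w - 0)); [rewrite subr0 expr2|].
have i2 : integrable_rv P (fun w => Z w ^+ 2).
  apply: ge0_integrable_rv; first exact: measurable_funX.
    by move=> w; exact: sqr_ge0.
  by rewrite E2 ltry.
have i1 : integrable_rv P Z by exact: sqr_integrable.
split=> //; first by rewrite /Rintegral E2.
by move: EZ; rewrite unlock /Rintegral => ->.
Qed.

End Noise.

Section FixedRange.
Context (R : realType) (dT dS : measure_display).
Context (T : measurableType dT) (S : measurableType dS).
Context (P : probability T R) (n d : nat).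
Variables (X : 'I_n -> {RV P >-> d.-tuple R}) (eps : 'I_n -> {RV P >-> R}).
Variables (xiX xiX2 : 'I_n -> 'I_d -> {RV P >-> S}) (xiY : 'I_n -> {RV P >-> S}).
Variables (Sigma : 'M[R]_d) (beta : 'cV[R]_d) (sigma r L : R).
Hypothesis n_gt0 : (0 < n)%N.
Hypothesis r_ge0 : 0 <= r.
Hypothesis L_ge0 : 0 <= L.
Hypothesis noise : standardized_noise eps.
Hypothesis indep : independent_model X eps xiX xiX2 xiY.

Lemma clipX_meas i j : measurable_fun setT (fun w => clipX X r i w j 0).
Proof.
rewrite (_ : (fun _ => _) = clip (- r) r \o (fun w => tnth (X i w) j)).
  by apply: measurableT_comp; [exact: measurable_clip|exact: coordX_meas0].
by apply/funext => w; rewrite mxE.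
Qed.

Lemma clipX_bounded i j : bounded_rv (fun w => clipX X r i w j 0).
Proof.
split; first exact: clipX_meas.
by exists r => w; rewrite mxE clip_abs.
Qed.

Lemma noise_facts i : [/\ integrable_rv P (fun w => eps i w ^+ 2),
   \int[P]_w (eps i w ^+ 2) = 1, integrable_rv P (eps i) & \int[P]_w eps i w = 0].
Proof. by have [_ /(_ i) h1 /(_ i) h2] := noise; exact: centered_variance. Qed.

Lemma noise_design_uncorrelated i (h : d.-tuple R -> R) :
  measurable_fun setT h -> integrable_rv P (fun w => h (X i w)) ->
  integrable_rv P (fun w => h (X i w) * eps i w) /\
  \int[P]_w (h (X i w) * eps i w) = 0.
Proof.
move=> mh ih; have [_ _ ie e0] := noise_facts i.
have [|i1 e1] := indep_product _ ih ie.
  move=> A B mA mB.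
  have mA' : measurable (h @^-1` A) by rewrite -[X in measurable X]setTI; exact: mh.
  exact: (X_eps_indep indep i mA' mB).
by split=> //; rewrite e1 e0 mulr0.
Qed.

(** Clipping is almost surely invisible, so the response expands linearly, and the noise term
    vanishes by independence and centring. The expansion is written in clipped coordinates because
    their boundedness gives integrability. *)
Lemma clip_moment_cross (i : 'I_n) :
  (forall j, {ae P, forall w, `|tnth (X i w) j| <= r}) ->
  {ae P, forall w, `|response X eps beta sigma i w| <= L} ->
  clip_moment X r i *m beta - clip_cross X eps beta sigma r L i = 0.
Proof.
move=> bX bY; apply/eqP; rewrite subr_eq0; apply/eqP/colP => j.
have bc k := clipX_bounded i k.
have iaa k : integrable_rv P (fun w => clipX X r i w j 0 * clipX X r i w k 0).
  by apply: bounded_rv_integrable; exact: bounded_rvM.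
have [iae ae0] : integrable_rv P (fun w => clip (- r) r (tnth (X i w) j) * eps i w) /\
    \int[P]_w (clip (- r) r (tnth (X i w) j) * eps i w) = 0.
  apply: (@noise_design_uncorrelated i (fun t => clip (- r) r (tnth t j))).
    by apply: measurableT_comp; [exact: measurable_clip|exact: measurable_tnth].
  have := bounded_rv_integrable P (bc j); congr (integrable_rv P _).
  by apply/funext => w; rewrite mxE.
rewrite mxE [RHS]mxE.
have iak k : integrable_rv P
    (fun w => beta k 0 * (clipX X r i w j 0 * clipX X r i w k 0)).
  exact: integrable_rvZ.
transitivity (\int[P]_w ((\sum_k beta k 0 * (clipX X r i w j 0 * clipX X r i w k 0)) +
    sigma * (clip (- r) r (tnth (X i w) j) * eps i w))).
  rewrite RintegralD //; last 2 first.
  - exact: integrable_rv_sum.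
  - exact: integrable_rvZ.
  rewrite RintegralZl // ae0 mulr0 addr0 Rintegral_sum_rv //.
  by apply: eq_bigr => k _; rewrite (RintegralZl _ measurableT (iaa k)) mulrC ?mxE.
apply: ae_Rintegral.
- apply: measurable_funD.
    apply: measurable_sum => k; exact: integrable_rv_meas (iak k).
  exact: integrable_rv_meas (integrable_rvZ sigma iae).
- apply: measurable_funM; last exact: clipX_meas.
  by apply: measurableT_comp; [exact: measurable_clip|exact: response_meas0].
have bX' : {ae P, forall w, forall j, `|tnth (X i w) j| <= r}.
  have : {ae P, forall w, forall j, j \in enum 'I_d -> `|tnth (X i w) j| <= r}.
    elim: (enum 'I_d) => [|k s IH]; first by near=> w.
    apply: filterS2 (bX k) IH => w h1 h2 l; rewrite inE => /predU1P [-> //|].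
    exact: h2.
  by apply: filterS => w h l; apply: h; rewrite mem_enum.
apply: filterS2 bX' bY => w hX hY.
have cX k : clipX X r i w k 0 = tnth (X i w) k.
  by rewrite mxE clip_id // -ler_norml.
rewrite /clipY clip_id -?ler_norml // cX clip_id -?ler_norml //.
rewrite /response mulrDl; congr (_ + _); last by ring.
rewrite /dot mulr_suml; apply: eq_bigr => k _.
by rewrite !cX mxE; ring.
Unshelve. all: by end_near.
Qed.

Lemma clip_moment_ae (i : 'I_n) j k :
  (forall j, {ae P, forall w, `|tnth (X i w) j| <= r}) ->
  clip_moment X r i j k = \int[P]_w (tnth (X i w) j * tnth (X i w) k).
Proof.
move=> bX; rewrite mxE; apply: ae_Rintegral.
- by apply: measurable_funM; exact: clipX_meas.
- by apply: measurable_funM; exact: coordX_meas0.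
apply: filterS2 (bX j) (bX k) => w hj hk.
by rewrite !mxE !clip_id -?ler_norml.
Qed.

(** This sum over observations is what the two designs have in common, and it is all that the matrix
    bounds see of the second moments. *)
Lemma sum_moments_design : random_design X Sigma \/ fixed_design X Sigma ->
  forall j k, \sum_i \int[P]_w (tnth (X i w) j * tnth (X i w) k) =
    n%:R * Sigma j k.
Proof.
move=> [[_ _ hS]|[x Xx ->]] j k.
  rewrite (eq_bigr (fun=> Sigma j k)) => [|i _].
    by rewrite sumr_const card_ord mulr_natl.
  by have := hS i j k; rewrite unlock /Rintegral => ->.
rewrite mxE mulrA divff ?mul1r ?pnatr_eq0 -?lt0n // summxE.
apply: eq_bigr => i _; under eq_Rintegral do rewrite Xx.
by rewrite Rintegral_cst1 mxE big_ord1 !mxE.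
Qed.

End FixedRange.

Lemma part_fixed_range (R : realType) (n d : nat) (dT dS : measure_display)
      (T : measurableType dT) (S : measurableType dS) (P : probability T R)
      (X : 'I_n -> {RV P >-> d.-tuple R}) (eps : 'I_n -> {RV P >-> R})
      (xiX xiX2 : 'I_n -> 'I_d -> {RV P >-> S}) (xiY : 'I_n -> {RV P >-> S})
      (QX QX2 QY : R -> S -> R)
      (Sigma : 'M[R]_d) (beta : 'cV[R]_d) (sigma r L : R)
      (beta_hat : T -> 'cV[R]_d) :
    (0 < n)%N -> (0 < d)%N -> 0 < r -> 0 < L ->
    random_design X Sigma \/ fixed_design X Sigma ->
    posdefmx Sigma ->
    standardized_noise eps ->
    independent_model X eps xiX xiX2 xiY ->
    dithered_quantizers xiX xiX2 xiY QX QX2 QY r L ->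
    is_estimator X eps xiX xiX2 xiY QX QX2 QY beta sigma r beta_hat ->
    bounded_data X eps beta sigma r L ->
    sample_size_condition n Sigma r ->
    with_prob_at_least P (1 - 2 / n%:R)
      [set w | norm2 (beta_hat w - beta) <= err n Sigma beta r L].
Proof.
move=> n0 d0 r0 L0 design pS noise ind quant est [bX bY] ss.
have [lam0 lamP] := lambda_minP d0 pS.
have nR : 0 < n%:R :> R by rewrite ltr0n.
have mE : \sum_i clip_moment X r i = n%:R *: Sigma.
  apply/matrixP => j k; rewrite summxE mxE -(sum_moments_design n0 design).
  by apply: eq_bigr => i _; exact: clip_moment_ae.
have qE v : \sum_i qform (clip_moment X r i) v = n%:R * qform Sigma v.
  by rewrite -qformZ -mE qform_sum.
have lam_r : lambda_min Sigma <= r ^+ 2.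
  pose j0 := Ordinal d0; apply: (le_trans (lambda_min_le_diag j0 pS)).
  rewrite -(ler_pM2l nR).
  have -> : n%:R * Sigma j0 j0 = \sum_i clip_moment X r i j0 j0.
    by rewrite -summxE mE mxE.
  apply: (@le_trans _ _ (\sum_(i < n) r ^+ 2)); last by rewrite sumr_const card_ord mulr_natl.
  apply: ler_sum => i _; rewrite mxE -[leRHS](Rintegral_cst1 P).
  have bc := clipX_bounded X (ltW r0) i j0.
  apply: le_Rintegral => //; try exact: bounded_rv_integrable.
  - by apply: bounded_rv_integrable; exact: bounded_rvM.
  - exact: integrable_rv_cst.
  move=> w _; rewrite mxE -expr2 -(real_normK (num_real _)).
  by rewrite ler_sqr ?nnegrE ?(ltW r0) // clip_abs // ltW.
have op0 := opnorm_ge0 Sigma d0.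
(* Without bias, l = [lambda_min]; half of it goes to fluctuations and the other half gives the
   factor 2 / [lambda_min] of [err]. *)
have res := estimator_error (l := lambda_min Sigma) (b := 0) n0 d0 r0 (ltW L0)
  ind quant est lam0 lam_r ss.
apply: (with_prob_at_leastW (res _ _ _ _ _)) => //.
- by rewrite ltr_pdivrMr // mulr_natr mulr2n ltrDl.
- move=> v; rewrite qE -mulrA ler_pM2l //.
  apply: (le_trans (qform_le_opnorm Sigma v)); rewrite ler_wpM2r ?sqr_ge0 //.
  by rewrite lerDl sqr_ge0.
- by move=> v; rewrite qE -mulrA ler_pM2l.
- move=> i; rewrite (clip_moment_cross (ltW r0) noise ind (bX i) (bY i)).
  by rewrite norm20.
move=> w /= /le_trans; apply.
rewrite mulr0 addr0 (_ : lambda_min Sigma - _ = lambda_min Sigma / 2); last by field.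
rewrite /err -/(err_scale n Sigma beta r L) le_eqVlt; apply/orP; left; apply/eqP.
by field; rewrite gt_eqF.
Qed.

(** * Sub-Gaussian moments and truncation *)

Section SubGaussian.
Context (R : realType) (dT : measure_display) (T : measurableType dT).
Variable P : probability T R.

Lemma psi2_lt (Z : T -> R) (t : R) : (psi2 P Z < t%:E)%E ->
  exists t0 : R, [/\ 0 < t0, t0 < t &
    ('E_P[fun w => expR (Z w ^+ 2 / t0 ^+ 2)%R] <= 2%:E)%E].
Proof.
move=> /ereal_inf_lt [_ [t0 [t00 h] <-]]; rewrite lte_fin => t0t.
by exists t0.
Qed.

(** With y = Z^2 / t0^2, the bounds y <= exp y - 1 and y^2 / 2 <= exp y turn E exp y <= 2 into
    moment bounds. The strict inequality t0 < t is what [psi2_ge1] relies on. *)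
Lemma psi2_moments (Z : T -> R) (t : R) : measurable_fun setT Z ->
  (psi2 P Z < t%:E)%E ->
  [/\ integrable_rv P (fun w => Z w ^+ 2),
      exists2 t0, 0 <= t0 < t & \int[P]_w (Z w ^+ 2) <= t0 ^+ 2,
      integrable_rv P (fun w => Z w ^+ 4) &
      \int[P]_w (Z w ^+ 4) <= 4 * t ^+ 4].
Proof.
move=> mZ /psi2_lt [t0 [t00 t0t h]].
rewrite unlock in h.
have t2 : 0 < t0 ^+ 2 by rewrite exprn_gt0.
have t0n : t0 != 0 by rewrite gt_eqF.
pose y w : R := Z w ^+ 2 / t0 ^+ 2.
have my : measurable_fun setT y.
  by apply: measurable_funM; [exact: measurable_funX|exact: measurable_cst].
have ie : integrable_rv P (fun w => expR (y w)).
  apply: ge0_integrable_rv.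
  - exact: measurableT_comp.
  - by move=> w; exact: expR_ge0.
  - exact: le_lt_trans h (ltry 2).
have Ee : \int[P]_w expR (y w) <= 2 by rewrite -lee_fin integrable_rv_EFin.
have y0 w : 0 <= y w by rewrite divr_ge0 ?sqr_ge0 // ltW.
have i2 : integrable_rv P (fun w => Z w ^+ 2).
  apply: (integrable_rv_le _ (integrable_rvZ (t0 ^+ 2) ie)).
    exact: measurable_funX.
  move=> w; rewrite ger0_norm ?sqr_ge0 //.
  have -> : Z w ^+ 2 = t0 ^+ 2 * y w by rewrite /y; field.
  by rewrite ler_pM2l //; have := expR_ge1Dx (y w); lra.
have i4 : integrable_rv P (fun w => Z w ^+ 4).
  apply: (integrable_rv_le _ (integrable_rvZ (2 * t0 ^+ 4) ie)).
    exact: measurable_funX.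
  move=> w; have -> : Z w ^+ 4 = t0 ^+ 4 * y w ^+ 2 by rewrite /y; field.
  have q0 : 0 <= t0 ^+ 4 * y w ^+ 2 by rewrite pmulr_rge0 ?sqr_ge0 ?exprn_gt0.
  rewrite (ger0_norm q0).
  rewrite -[leRHS]mulrA [leRHS]mulrCA ler_pM2l ?exprn_gt0 //.
  by have := @expR_ge1Dxn R (y w) 1 (y0 w); rewrite (_ : 2`!%:R = 2 :> R) //; lra.
split=> //.
- exists t0; first by rewrite (ltW t00).
  have -> : \int[P]_w (Z w ^+ 2) = \int[P]_w (t0 ^+ 2 * y w).
    by apply: eq_Rintegral => w _; rewrite /y; field.
  have iy : integrable_rv P y.
    apply: (integrable_rv_le my ie) => w; rewrite ger0_norm //.
    by have := expR_ge1Dx (y w); lra.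
  rewrite RintegralZl // ger_pMr //.
  have : \int[P]_w (1 + y w) <= \int[P]_w expR (y w).
    apply: le_Rintegral => //; first exact: integrable_rvD (integrable_rv_cst P 1) iy.
    by move=> w _; exact: expR_ge1Dx.
  rewrite RintegralD //; last exact: integrable_rv_cst.
  by rewrite Rintegral_cst1; lra.
- apply: (@le_trans _ _ (\int[P]_w (2 * t0 ^+ 4 * expR (y w)))).
    apply: le_Rintegral => //; first exact: integrable_rvZ.
    move=> w _; have -> : Z w ^+ 4 = t0 ^+ 4 * y w ^+ 2 by rewrite /y; field.
    rewrite -[leRHS]mulrA [leRHS]mulrCA ler_pM2l ?exprn_gt0 //.
    by have := @expR_ge1Dxn R (y w) 1 (y0 w); rewrite (_ : 2`!%:R = 2 :> R) //; lra.
  rewrite RintegralZl //.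
  have h4 : t0 ^+ 4 <= t ^+ 4.
    by rewrite lerXn2r ?nnegrE ?(ltW t00) ?(ltW t0t) // (le_trans (ltW t00)) // ltW.
  have t4 : 0 <= t0 ^+ 4 by rewrite exprn_ge0 // ltW.
  have := ler_wpM2l (_ : 0 <= 2 * t0 ^+ 4) Ee.
  by rewrite mulr_ge0 // => /(_ erefl); lra.
Qed.

(** It excludes a zero norm, for which the quotient in the universal tail bound would be 0 by the
    convention on division. *)
Lemma psi2_ge1 (Z : T -> R) : measurable_fun setT Z ->
  \int[P]_w (Z w ^+ 2) = 1 -> (1%:E <= psi2 P Z)%E.
Proof.
move=> mZ Z2; rewrite leNgt; apply/negP => h.
have [_ [t0 /andP [t00 t01] h2] _ _] := psi2_moments mZ h.
by move: h2; rewrite Z2 leNgt expr_lt1 // t01.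
Qed.

(** The factor 4 is q + 1 for q = 3, hence the power m^-4. *)
Lemma subgaussian_tail (C0 K m : R) (Z : {RV P >-> R}) :
  universal_tail_constant C0 -> ('E_P[Z] = 0)%E ->
  \int[P]_w (Z w ^+ 2) = 1 -> (psi2 P Z <= K%:E)%E -> 1 < m ->
  (P [set w | (Num.sqrt (2 * Ckappa C0 K * 4 * ln m) <= `|Z w|)%R] <=
     (2 / m ^+ 4)%:E)%E.
Proof.
move=> [C00 hC] EZ Z2 ZK m1.
have mZ : measurable_fun setT Z by [].
have ps1 := psi2_ge1 mZ Z2.
have pfin : psi2 P Z \is a fin_num.
  by rewrite ge0_fin_numE ?(le_lt_trans ZK (ltry K)) // (le_trans _ ps1).
set ps := fine (psi2 P Z).
have psE : psi2 P Z = ps%:E by rewrite fineK.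
have psge1 : 1 <= ps by rewrite -lee_fin -psE.
have psK : ps <= K by rewrite -lee_fin -psE.
have K0 : 0 < K by rewrite (lt_le_trans _ psK) // (lt_le_trans _ psge1).
have lnm : 0 < ln m by rewrite ln_gt0.
have t2 : 0 < 2 * Ckappa C0 K * 4 * ln m.
  by rewrite !mulr_gt0 // exprn_gt0.
have t0 : 0 < Num.sqrt (2 * Ckappa C0 K * 4 * ln m) by rewrite sqrtr_gt0.
apply: (le_trans (hC _ _ _ Z EZ (le_lt_trans ZK (ltry K)) _ t0)).
rewrite lee_fin ler_pM2l // -/ps sqr_sqrtr ?(ltW t2) //.
have m0 : 0 < m by rewrite (lt_trans _ m1).
have -> : (m ^+ 4)^-1 = expR (- (4 * ln m)).
  by rewrite expRN expRM_natl lnK ?posrE.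
rewrite ler_expR lerN2 ler_pdivlMr; last first.
  have ps0 : 0 < ps by rewrite (lt_le_trans _ psge1).
  by rewrite !mulr_gt0.
have : ps ^+ 2 <= K ^+ 2.
  by rewrite ler_sqr ?nnegrE ?(ltW K0) // (le_trans _ psge1).
have c0 : 0 <= 8 * C0 * ln m by rewrite !mulr_ge0 // ltW.
by move=> /(ler_wpM2l c0); rewrite /Ckappa; lra.
Qed.

Lemma clip_abs_le (a x : R) : 0 <= a -> `|clip (- a) a x| <= `|x|.
Proof.
move=> a0; have aa : - a <= a by rewrite ge0_cp.
have [xa|ax] := leP x (- a).
  rewrite (clip_low aa xa) normrN (ger0_norm a0) -normrN.
  by apply: (le_trans _ (ler_norm (- x))); rewrite lerNr.
have [ax'|xa] := leP a x.
  by rewrite (clip_high aa ax') (ger0_norm a0); apply: (le_trans ax'); exact: ler_norm.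
have h : - a <= x <= a by rewrite (ltW ax) (ltW xa).
by rewrite (clip_id h).
Qed.

(* On A the error is at most f^2 + g^2, and x^2 <= h x^4 / 2 + 1 / (2 h). *)
Lemma truncation_bias (f g : T -> R) (a b h c mf4 mg4 : R) (A : set T) :
  measurable_fun setT f -> measurable_fun setT g ->
  integrable_rv P (fun w => f w ^+ 4) -> integrable_rv P (fun w => g w ^+ 4) ->
  \int[P]_w (f w ^+ 4) <= mf4 -> \int[P]_w (g w ^+ 4) <= mg4 ->
  0 <= a -> 0 <= b -> 0 < h -> measurable A -> (P A <= (c * h ^+ 2)%:E)%E ->
  (forall w, ~ A w -> `|f w| <= a /\ `|g w| <= b) ->
  `| \int[P]_w (clip (- a) a (f w) * clip (- b) b (g w)) - \int[P]_w (f w * g w) | <=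
  h * (2^-1 * (mf4 + mg4) + c).
Proof.
move=> mf mg if4 ig4 hf hg a0 b0 h0 mA PA offA.
have sq (q : T -> R) : measurable_fun setT q -> integrable_rv P (fun w => q w ^+ 4) ->
    integrable_rv P (fun w => q w ^+ 2).
  move=> mq iq; apply: sqr_integrable; first exact: measurable_funX.
  by rewrite (_ : (fun w => _) = (fun w => q w ^+ 4)) //; apply/funext => w; rewrite -exprM.
have ifg : integrable_rv P (fun w => f w * g w).
  by apply: sqr_integrable_mul => //; apply: sq.
pose fc w := clip (- a) a (f w); pose gc w := clip (- b) b (g w).
have mfc : measurable_fun setT fc by apply: measurableT_comp => //; exact: measurable_clip.
have mgc : measurable_fun setT gc by apply: measurableT_comp => //; exact: measurable_clip.
have ifgc : integrable_rv P (fun w => fc w * gc w).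
  apply: (integrable_rv_le _ (g := fun w => `|f w * g w|)).
  - exact: measurable_funM.
  - exact: (integrable_abse ifg).
  - by move=> w; rewrite !normrM ler_pM // clip_abs_le.
have iA : integrable_rv P (\1_A : T -> R).
  apply: bounded_rv_integrable; split; first exact: measurable_indic.
  by exists 1 => w; rewrite indicE; case: (w \in A); rewrite ?normr1 ?normr0.
have EA : \int[P]_w (\1_A w : R) <= c * h ^+ 2.
  by rewrite -lee_fin integrable_rv_EFin // integral_indic // setIT.
rewrite -RintegralB //.
apply: (le_trans (le_normr_Rintegral measurableT (integrable_rvB ifgc ifg))).
have i5 := integrable_rvZ (h / 2) (integrable_rvD if4 ig4).
have i6 := integrable_rvZ h^-1 iA.
apply: (@le_trans _ _ (\int[P]_w (h / 2 * (f w ^+ 4 + g w ^+ 4) + h^-1 * \1_A w))).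
  apply: le_Rintegral => //.
  - exact: (integrable_abse (integrable_rvB ifgc ifg)).
  - exact: integrable_rvD.
  move=> w _; have [wA|wA] := pselect (A w); last first.
    have [ha hb] := offA w wA.
    rewrite /fc /gc !clip_id -?ler_norml // subrr normr0 addr_ge0 ?mulr_ge0 ?addr_ge0 //.
    - by rewrite ltW.
    - by rewrite exprn_even_ge0.
    - by rewrite exprn_even_ge0.
    - by rewrite invr_ge0 ltW.
  rewrite indicE mem_set //= mulr1.
  have e1 : `|fc w * gc w - f w * g w| <= f w ^+ 2 + g w ^+ 2.
    rewrite (le_trans (ler_normB _ _)) // !normrM.
    have k1 : `|fc w| * `|gc w| <= `|f w| * `|g w| by rewrite ler_pM // clip_abs_le.
    have k2 := sqr_ge0 (`|f w| - `|g w|).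
    have k3 := real_normK (num_real (f w)); have k4 := real_normK (num_real (g w)).
    by lra.
  apply: (le_trans e1).
  have hv (x : R) : x ^+ 2 <= h / 2 * x ^+ 4 + h^-1 / 2.
    have := sqr_ge0 (h * x ^+ 2 - 1).
    have -> : (h * x ^+ 2 - 1) ^+ 2 = 2 * h * (h / 2 * x ^+ 4 + h^-1 / 2 - x ^+ 2).
      by field; rewrite gt_eqF.
    by rewrite pmulr_rge0 ?mulr_gt0 // subr_ge0.
  by have := hv (f w); have := hv (g w); lra.
rewrite RintegralD // RintegralZl //; last exact: integrable_rvD.
rewrite RintegralD // RintegralZl //.
have hn : h != 0 by rewrite gt_eqF.
have k1 : h^-1 * \int[P]_w (\1_A w : R) <= h * c.
  have -> : h * c = h^-1 * (c * h ^+ 2) by field.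
  by rewrite ler_pM2l ?invr_gt0.
have k2 : h / 2 * (\int[P]_w (f w ^+ 4) + \int[P]_w (g w ^+ 4)) <= h / 2 * (mf4 + mg4).
  by rewrite ler_pM2l ?divr_gt0 // lerD.
lra.
Qed.

Lemma same_law_integral dU (U : measurableType dU) (X Y : {RV P >-> U})
    (f : U -> \bar R) : same_law X Y -> measurable_fun setT f ->
  (forall z, 0 <= f z)%E -> (\int[P]_w f (X w) = \int[P]_w f (Y w))%E.
Proof.
move=> XY mf f0.
rewrite -(ge0_integral_distribution X mf f0) -(ge0_integral_distribution Y mf f0).
by apply: eq_measure_integral => A mA _; exact: XY.
Qed.

(** The norms are prescribed for one observation only; this carries them to all the others. *)
Lemma same_law_psi2 dU (U : measurableType dU) (X Y : {RV P >-> U}) (h : U -> R) :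
  same_law X Y -> measurable_fun setT h ->
  psi2 P (fun w => h (X w)) = psi2 P (fun w => h (Y w)).
Proof.
move=> XY mh; rewrite /psi2; congr ereal_inf; congr (_ @` _).
apply/seteqP; split=> t /= [t0]; rewrite unlock => ht; split=> //;
  apply: le_trans ht; rewrite le_eqVlt; apply/orP; left; apply/eqP.
- apply/esym; apply: (same_law_integral (f := fun z => (expR (h z ^+ 2 / t ^+ 2))%:E) XY).
    apply/measurable_EFinP; apply: measurableT_comp => //.
    by apply: measurable_funM; [exact: measurable_funX|exact: measurable_cst].
  by move=> z; rewrite lee_fin expR_ge0.
- apply: (same_law_integral (f := fun z => (expR (h z ^+ 2 / t ^+ 2))%:E) XY).
    apply/measurable_EFinP; apply: measurableT_comp => //.
    by apply: measurable_funM; [exact: measurable_funX|exact: measurable_cst].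
  by move=> z; rewrite lee_fin expR_ge0.
Qed.

End SubGaussian.

Section UnitSubGaussian.
Context (R : realType) (dT : measure_display) (T : measurableType dT).
Variable P : probability T R.

Definition unit_subgaussian (Z : T -> R) (K : R) : Prop :=
  [/\ measurable_fun setT Z, ('E_P[Z] = 0)%E, \int[P]_w (Z w ^+ 2) = 1 &
      (psi2 P Z <= K%:E)%E].

Lemma unit_subgaussian_moment Z K : unit_subgaussian Z K ->
  [/\ integrable_rv P (fun w => Z w ^+ 2), integrable_rv P (fun w => Z w ^+ 4) &
      \int[P]_w (Z w ^+ 4) <= 4 * (K + 1) ^+ 4].
Proof.
move=> [mZ _ _ hK].
have [|i2 _ i4 m4] := @psi2_moments _ _ _ P Z (K + 1) mZ; last by [].
by rewrite (le_lt_trans hK) // lte_fin ltrDl.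
Qed.

Lemma unit_subgaussian_tail C0 Z K m : universal_tail_constant C0 ->
  unit_subgaussian Z K -> 1 < m ->
  measurable [set w | Num.sqrt (2 * Ckappa C0 K * 4 * ln m) <= `|Z w|] /\
  (P [set w | (Num.sqrt (2 * Ckappa C0 K * 4 * ln m) <= `|Z w|)%R] <=
     (2 / m ^+ 4)%:E)%E.
Proof.
move=> hC [mZ EZ Z2 hK] m1; split.
  rewrite (_ : [set _ | _] = (fun w => `|Z w|) @^-1`
      [set` `[Num.sqrt (2 * Ckappa C0 K * 4 * ln m), +oo[]); last first.
    by apply/seteqP; split=> w /=; rewrite in_itv /= andbT.
  rewrite -[X in measurable X]setTI.
  by apply: (measurableT_comp (@normr_measurable R setT) mZ) => //; exact: measurable_itv.
pose Z' : {RV P >-> R} := HB.pack Z (isMeasurableFun.Build _ _ _ _ Z mZ).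
exact: (subgaussian_tail (Z := Z') hC EZ Z2 hK m1).
Qed.

End UnitSubGaussian.

(** * Clipping bias of a sub-Gaussian design *)

Section SubGaussianDesign.
Context (R : realType) (dT dS : measure_display).
Context (T : measurableType dT) (S : measurableType dS).
Context (P : probability T R) (n d : nat).
Variables (X : 'I_n -> {RV P >-> d.-tuple R}) (eps : 'I_n -> {RV P >-> R}).
Variables (xiX xiX2 : 'I_n -> 'I_d -> {RV P >-> S}) (xiY : 'I_n -> {RV P >-> S}).
Variables (Sigma : 'M[R]_d) (beta : 'cV[R]_d) (C0 K Kbar Keps s sigma : R).
Hypothesis tail : universal_tail_constant C0.
Hypothesis n_gt0 : (0 < n)%N.
Let i1 := Ordinal n_gt0.
Hypothesis n_gt1 : (1 < n)%N.
Hypothesis d_gt0 : (0 < d)%N.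
Hypothesis sigma_ge0 : 0 <= sigma.
Hypothesis design : random_design X Sigma.
Hypothesis unit_var : forall i j, 'V_P[fun w => tnth (X i w) j] = 1%E.
Hypothesis Sigma_posdef : posdefmx Sigma.
Hypothesis noise : standardized_noise eps.
Hypothesis indep : independent_model X eps xiX xiX2 xiY.
Hypothesis psi2K : \big[maxe/0%E]_(j < d) psi2 P (fun w => tnth (X i1 w) j) = K%:E.
Hypothesis psi2Kbar :
  psi2_vec P (fun w => invmx (sqrtmx Sigma) *m colvec (X i1 w)) = Kbar%:E.
Hypothesis psi2Keps : psi2 P (eps i1) = Keps%:E.
Hypothesis sE : norm2 (sqrtmx Sigma *m beta) = s.

Lemma coord_facts i j :
  [/\ integrable_rv P (fun w => tnth (X i w) j ^+ 2),
   \int[P]_w (tnth (X i w) j ^+ 2) = 1, integrable_rv P (fun w => tnth (X i w) j) &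
   \int[P]_w tnth (X i w) j = 0].
Proof.
pose Z : {RV P >-> R} := HB.pack (fun w => tnth (X i w) j)
  (isMeasurableFun.Build _ _ _ _ (fun w => tnth (X i w) j) (coordX_meas0 X i j)).
have [_ /(_ i j) EZ _] := design.
exact: (centered_variance (Z := Z) EZ (unit_var i j)).
Qed.

Lemma coord_unit_subgaussian i j : unit_subgaussian P (fun w => tnth (X i w) j) K.
Proof.
have [XX EX _] := design.
have [_ X2 _ _] := coord_facts i j.
split=> //; first exact: coordX_meas0.
rewrite (@same_law_psi2 _ _ _ P _ _ (X i) (X i1) (fun x => tnth x j) (XX i i1)).
  by rewrite -psi2K (bigD1 j) //= le_max lexx.
exact: measurable_tnth.
Qed.

Lemma noise_unit_subgaussian i : unit_subgaussian P (eps i) Keps.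
Proof.
have [ee Ee _] := noise; have [_ e2 _ _] := noise_facts noise i.
split=> //.
by rewrite (@same_law_psi2 _ _ _ P _ _ (eps i) (eps i1) id (ee i i1)) // psi2Keps.
Qed.

Let W i w := dot (colvec (X i w)) beta.

Let XX_int i j k : integrable_rv P (fun w => tnth (X i w) j * tnth (X i w) k).
Proof.
have [h1 _ _ _] := coord_facts i j; have [h2 _ _ _] := coord_facts i k.
by apply: sqr_integrable_mul => //; exact: coordX_meas0.
Qed.

Lemma second_moment i j k : \int[P]_w (tnth (X i w) j * tnth (X i w) k) = Sigma j k.
Proof. by have [_ _ /(_ i j k)] := design; rewrite unlock /Rintegral => ->. Qed.

Lemma Sigma_diag j : Sigma j j = 1.
Proof. by rewrite -(second_moment i1); have [_ <- _ _] := coord_facts i1 j. Qed.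

Let WE i w : W i w = \sum_j beta j 0 * tnth (X i w) j.
Proof. by apply: eq_bigr => j _; rewrite mxE mulrC. Qed.

Let W_sqr i w : W i w ^+ 2 = \sum_j beta j 0 * (W i w * tnth (X i w) j).
Proof.
rewrite expr2 [X in _ * X]WE mulr_sumr.
by apply: eq_bigr => j _; rewrite mulrCA.
Qed.

Lemma projection_meas i : measurable_fun setT (W i).
Proof.
rewrite (_ : W i = fun w => \sum_j beta j 0 * tnth (X i w) j); last exact/funext.
apply: measurable_sum => j.
by apply: measurable_funM; [exact: measurable_cst|exact: coordX_meas0].
Qed.

Lemma projection_mean i : integrable_rv P (W i) /\ \int[P]_w W i w = 0.
Proof.
have ij j : integrable_rv P (fun w => beta j 0 * tnth (X i w) j).
  by have [_ _ h _] := coord_facts i j; exact: integrable_rvZ.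
have -> : W i = fun w => \sum_j beta j 0 * tnth (X i w) j by apply/funext => w.
split; first exact: integrable_rv_sum.
rewrite Rintegral_sum_rv // big1 // => j _.
have [_ _ h h0] := coord_facts i j.
by rewrite (RintegralZl _ measurableT h) h0 mulr0.
Qed.

Lemma projection_coord i j : integrable_rv P (fun w => W i w * tnth (X i w) j) /\
  \int[P]_w (W i w * tnth (X i w) j) = (Sigma *m beta) j 0.
Proof.
have E : (fun w => W i w * tnth (X i w) j) =
    (fun w => \sum_k beta k 0 * (tnth (X i w) j * tnth (X i w) k)).
  by apply/funext => w; rewrite WE mulr_suml; apply: eq_bigr => k _; ring.
have ik k : integrable_rv P (fun w => beta k 0 * (tnth (X i w) j * tnth (X i w) k)).
  exact: integrable_rvZ.
rewrite E; split; first exact: integrable_rv_sum.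
rewrite Rintegral_sum_rv // mxE; apply: eq_bigr => k _.
by rewrite (RintegralZl _ measurableT (XX_int i j k)) second_moment mulrC.
Qed.

Lemma projection_variance i : \int[P]_w (W i w ^+ 2) = s ^+ 2.
Proof.
have [sB BB _] := sqrtmxP Sigma_posdef.
transitivity (\int[P]_w (\sum_j beta j 0 * (W i w * tnth (X i w) j))).
  by apply: eq_Rintegral => w _; exact: W_sqr.
have hj j := projection_coord i j.
rewrite Rintegral_sum_rv; last by move=> j; apply: integrable_rvZ; have [] := hj j.
rewrite -sE norm2_sqr dot_mulmx sB mulmxA BB dotC; apply: eq_bigr => j _.
by have [h e] := hj j; rewrite (RintegralZl _ measurableT h) e.
Qed.

Lemma s_ge0 : 0 <= s. Proof. by rewrite -sE norm2_ge0. Qed.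

(** <X, beta> / s is <Sigma^(-1/2) X, v> for the unit vector v = Sigma^(1/2) beta / s, so its norm
    is at most [Kbar]. *)
Lemma projection_unit_subgaussian i : 0 < s ->
  unit_subgaussian P (fun w => s^-1 * W i w) Kbar.
Proof.
move=> s0; have [sB BB uB] := sqrtmxP Sigma_posdef.
have [XX _ _] := design.
have sn : s != 0 by rewrite gt_eqF.
have [iW W0] := projection_mean i.
split.
- by apply: measurable_funM; [exact: measurable_cst|exact: projection_meas].
- rewrite unlock -integrable_rv_EFin; last exact: integrable_rvZ.
  by rewrite RintegralZl // W0 mulr0.
- under eq_Rintegral do rewrite exprMn.
  rewrite RintegralZl //; last first.
    have -> : (fun w => W i w ^+ 2) = fun w => \sum_j beta j 0 * (W i w * tnth (X i w) j).
      by apply/funext => w; exact: W_sqr.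
    by apply: integrable_rv_sum => j; apply: integrable_rvZ; have [] := projection_coord i j.
  by rewrite projection_variance -exprMn mulVf // expr1n.
- rewrite (@same_law_psi2 _ _ _ P _ _ (X i) (X i1)
    (fun x => s^-1 * dot (colvec x) beta) (XX i i1)); last first.
    apply: measurable_funM; first exact: measurable_cst.
    apply: measurable_sum => j; apply: measurable_funM; last exact: measurable_cst.
    by under eq_fun do rewrite mxE; exact: measurable_tnth.
  rewrite -psi2Kbar; apply: ereal_sup_ubound.
  exists (s^-1 *: (sqrtmx Sigma *m beta)).
    by rewrite /= norm2Z sE ger0_norm ?invr_ge0 ?s_ge0 // mulVf.
  congr (psi2 P _); apply/funext => w.
  by rewrite dotZr dot_mulmx sB mulmxA mulmxV // mul1mx.
Qed.

(** For s = 0 one cannot normalise, but then beta = 0 because the square root is invertible, and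
    everything vanishes. *)
Lemma projection_bounds i :
  [/\ integrable_rv P (fun w => W i w ^+ 4),
      \int[P]_w (W i w ^+ 4) <= s ^+ 4 * (4 * (Kbar + 1) ^+ 4) &
      exists A : set T, [/\ measurable A, (P A <= (2 / n%:R ^+ 4)%:E)%E &
        forall w, ~ A w -> `|W i w| <= s * Num.sqrt (2 * Ckappa C0 Kbar * 4 * ln n%:R)]].
Proof.
have [s0|] := ltP 0 s; last first.
  rewrite le_eqVlt ltNge s_ge0 orbF => /eqP s0.
  have [_ _ uB] := sqrtmxP Sigma_posdef.
  have b0 : beta = 0.
    rewrite -[beta]mul1mx -(mulVmx uB) -mulmxA; apply/eqP.
    by move/eqP: sE; rewrite s0 norm2_eq0 => /eqP ->; rewrite mulmx0.
  have W0 : W i = fun=> 0 by apply/funext => w; rewrite /W b0 dot0r.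
  split.
  - by rewrite W0; exact: integrable_rv_cst.
  - by rewrite W0 Rintegral_cst1 s0 !expr0n /= mul0r.
  - exists set0; split; first exact: measurable0.
      by rewrite measure0 lee_fin divr_ge0 // exprn_ge0.
    by move=> w _; rewrite W0 s0 normr0 mul0r.
have us := projection_unit_subgaussian i s0.
have [_ i4 m4] := unit_subgaussian_moment us.
have sn : s != 0 by rewrite gt_eqF.
have E4 : (fun w => W i w ^+ 4) = (fun w => s ^+ 4 * (s^-1 * W i w) ^+ 4).
  by apply/funext => w; rewrite -exprMn mulrA divff // mul1r.
split.
- by rewrite E4; exact: integrable_rvZ.
- by rewrite E4 RintegralZl // ler_pM2l ?exprn_gt0.
- have n1 : 1 < n%:R :> R by rewrite ltr1n.
  have [mA PA] := unit_subgaussian_tail tail us n1.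
  exists [set w | Num.sqrt (2 * Ckappa C0 Kbar * 4 * ln n%:R) <= `|s^-1 * W i w|].
  split=> // w /= /negP; rewrite -ltNge => /ltW.
  rewrite normrM ger0_norm ?invr_ge0 ?s_ge0 // => h.
  by rewrite -ler_pdivrMl.
Qed.

Let r := range_X n d C0 K 3.
Let L := range_Y n C0 Kbar Keps s sigma 3.
(** The parameter of [truncation_bias]: exceptional sets have probability of order n^-4 = h^2, so
    the bias is of order n^-2. *)
Let h : R := (n%:R ^+ 2)^-1.

Let h_gt0 : 0 < h. Proof. by rewrite invr_gt0 exprn_gt0 // ltr0n. Qed.
Let h_sqr : h ^+ 2 = (n%:R ^+ 4)^-1. Proof. by rewrite /h exprVn -exprM. Qed.

Lemma range_X_ge0 : 0 <= r. Proof. exact: sqrtr_ge0. Qed.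

Lemma range_YE : L = s * Num.sqrt (2 * Ckappa C0 Kbar * 4 * ln n%:R) +
  sigma * Num.sqrt (2 * Ckappa C0 Keps * 4 * ln n%:R).
Proof.
have [C00 _] := tail; have e (c : R) : Num.sqrt (2 * 4 * Ckappa C0 c) * Num.sqrt (ln n%:R) =
    Num.sqrt (2 * Ckappa C0 c * 4 * ln n%:R).
  rewrite -sqrtrM; first by congr Num.sqrt; ring.
  by rewrite mulr_ge0 // mulr_ge0 ?sqr_ge0 // ltW.
by rewrite /L /range_Y -!e; ring.
Qed.

Lemma range_Y_ge0 : 0 <= L.
Proof. by rewrite range_YE addr_ge0 // mulr_ge0 ?sqrtr_ge0 // s_ge0. Qed.

(** The range even gives 2 (n d)^-4. The weaker n^-4 suffices because the bias is estimated entry by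
    entry, without a union over coordinates. *)
Lemma coord_tail i j : exists A : set T, [/\ measurable A,
   (P A <= (2 / n%:R ^+ 4)%:E)%E & forall w, ~ A w -> `|tnth (X i w) j| <= r].
Proof.
have nd1 : 1 < (n * d)%:R :> R.
  by rewrite ltr1n (leq_trans n_gt1) // -[X in (X <= _)%N]muln1 leq_mul2l d_gt0 orbT.
have [mA PA] := unit_subgaussian_tail tail (coord_unit_subgaussian i j) nd1.
eexists; split; [exact: mA| |].
  apply: (le_trans PA); rewrite lee_fin ler_pM2l // lef_pV2 ?posrE ?exprn_gt0 ?ltr0n //.
    by rewrite lerXn2r ?nnegrE ?ler0n // ler_nat -[X in (X <= _)%N]muln1 leq_mul2l d_gt0 orbT.
  by rewrite muln_gt0 n_gt0.
by move=> w /= /negP; rewrite -ltNge => /ltW.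
Qed.

Lemma noise_tail i : exists A : set T, [/\ measurable A,
   (P A <= (2 / n%:R ^+ 4)%:E)%E &
   forall w, ~ A w -> `|eps i w| <= Num.sqrt (2 * Ckappa C0 Keps * 4 * ln n%:R)].
Proof.
have n1 : 1 < n%:R :> R by rewrite ltr1n.
have [mA PA] := unit_subgaussian_tail tail (noise_unit_subgaussian i) n1.
by eexists; split; [exact: mA|exact: PA|move=> w /= /negP; rewrite -ltNge => /ltW].
Qed.

Lemma moment_bias i j k :
  `|clip_moment X r i j k - Sigma j k| <= h * (4 * (K + 1) ^+ 4 + 6).
Proof.
have [_ i4j m4j] := unit_subgaussian_moment (coord_unit_subgaussian i j).
have [_ i4k m4k] := unit_subgaussian_moment (coord_unit_subgaussian i k).
have [A [mA PA hA]] := coord_tail i j; have [B [mB PB hB]] := coord_tail i k.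
have PAB : (P (A `|` B) <= (4 * h ^+ 2)%:E)%E.
  apply: (le_trans (measureU2 _ mA mB)); apply: (le_trans (leeD PA PB)).
  by rewrite -EFinD lee_fin h_sqr; lra.
rewrite mxE -(second_moment i).
have := truncation_bias (coordX_meas0 X i j) (coordX_meas0 X i k) i4j i4k m4j m4k
  range_X_ge0 range_X_ge0 h_gt0 (measurableU _ _ mA mB) PAB.
under [in X in _ -> X]eq_Rintegral do rewrite !mxE.
move=> /(_ _)/le_trans; apply.
  by move=> w /not_orP [wA wB]; split; [exact: hA|exact: hB].
by rewrite ler_pM2l //; lra.
Qed.

Definition response_moment : R :=
  8 * (s ^+ 4 * (4 * (Kbar + 1) ^+ 4) + sigma ^+ 4 * (4 * (Keps + 1) ^+ 4)).

(** Three exceptional sets, for <X, beta>, the noise and the coordinate, explain the 6. The two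
    summands of [range_Y] are the thresholds of the first two. *)
Lemma cross_bias i j :
  `|clip_cross X eps beta sigma r L i j 0 - (Sigma *m beta) j 0| <=
  h * (2^-1 * (response_moment + 4 * (K + 1) ^+ 4) + 6).
Proof.
have [iX2 i4j m4j] := unit_subgaussian_moment (coord_unit_subgaussian i j).
have [ie2 i4e m4e] := unit_subgaussian_moment (noise_unit_subgaussian i).
have [iW4 mW4 [A [mA PA hA]]] := projection_bounds i.
have [B [mB PB hB]] := noise_tail i; have [D [mD PD hD]] := coord_tail i j.
pose Y := response X eps beta sigma i.
have mY : measurable_fun setT Y by exact: response_meas0.
have PABD : (P (A `|` B `|` D) <= (6 * h ^+ 2)%:E)%E.
  apply: (le_trans (measureU2 _ (measurableU _ _ mA mB) mD)).
  apply: (le_trans (leeD (le_trans (measureU2 _ mA mB) (leeD PA PB)) PD)).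
  by rewrite -!EFinD lee_fin h_sqr; lra.
have y4 w : Y w ^+ 4 <= 8 * (W i w ^+ 4 + sigma ^+ 4 * eps i w ^+ 4).
  rewrite /Y /response -/(W i w) -exprMn; move: (W i w) (sigma * eps i w) => x y.
  (* The last factor is 5 (x + y)^2 + 2 (x^2 + y^2), hence nonnegative. *)
  have -> : 8 * (x ^+ 4 + y ^+ 4) =
    (x + y) ^+ 4 + (x - y) ^+ 2 * (7 * (x ^+ 2 + y ^+ 2) + 10 * (x * y)) by ring.
  rewrite lerDl mulr_ge0 ?sqr_ge0 //.
  have := sqr_ge0 (x + y); have := sqr_ge0 x; have := sqr_ge0 y; lra.
have iG := integrable_rvZ 8 (integrable_rvD iW4 (integrable_rvZ (sigma ^+ 4) i4e)).
have i4Y : integrable_rv P (fun w => Y w ^+ 4).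
  apply: (integrable_rv_le _ iG); first exact: measurable_funX.
  by move=> w; rewrite ger0_norm // exprn_even_ge0.
have m4Y : \int[P]_w (Y w ^+ 4) <= response_moment.
  apply: (le_trans (le_Rintegral measurableT i4Y iG (fun w _ => y4 w))).
  have ie4 := integrable_rvZ (sigma ^+ 4) i4e.
  rewrite RintegralZl //; last exact: integrable_rvD.
  rewrite RintegralD // RintegralZl // ler_pM2l // lerD // ler_wpM2l // exprn_ge0 //.
have EYX : \int[P]_w (Y w * tnth (X i w) j) = (Sigma *m beta) j 0.
  have [iWX <-] := projection_coord i j.
  have [_ _ iXj _] := coord_facts i j.
  have [iXe Xe0] := noise_design_uncorrelated noise indep
    (measurable_tnth j : measurable_fun setT (fun x : d.-tuple R => tnth x j)) iXj.
  transitivity (\int[P]_w (W i w * tnth (X i w) j + sigma * (tnth (X i w) j * eps i w))).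
    by apply: eq_Rintegral => w _; rewrite /Y /response -/(W i w); ring.
  rewrite RintegralD //; last exact: integrable_rvZ.
  by rewrite RintegralZl // Xe0 mulr0 addr0.
rewrite mxE -EYX.
have := truncation_bias mY (coordX_meas0 X i j) i4Y i4j m4Y m4j
  range_Y_ge0 range_X_ge0 h_gt0 (measurableU _ _ (measurableU _ _ mA mB) mD) PABD.
under [in X in _ -> X]eq_Rintegral do rewrite mxE.
apply => w /not_orP [/not_orP [wA wB] wD]; split; last exact: hD.
rewrite range_YE /Y /response (le_trans (ler_normD _ _)) // lerD //; first exact: hA.
by rewrite normrM (ger0_norm sigma_ge0) ler_wpM2l //; exact: hB.
Qed.

End SubGaussianDesign.

Lemma norm2_le_coords (R : realType) (d : nat) (x : 'cV[R]_d) (c : R) : 0 <= c ->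
  (forall j, `|x j 0| <= c) -> norm2 x <= Num.sqrt d%:R * c.
Proof.
move=> c0 hx; rewrite -ler_sqr ?nnegrE ?norm2_ge0 ?mulr_ge0 ?sqrtr_ge0 //.
rewrite norm2_sqr exprMn sqr_sqrtr // /dot.
have -> : d%:R * c ^+ 2 = \sum_(j < d) c ^+ 2 by rewrite sumr_const card_ord mulr_natl.
apply: ler_sum => j _; rewrite -expr2 -(real_normK (num_real _)).
by rewrite ler_sqr ?nnegrE.
Qed.

Lemma norm2_mulmx_le_entries (R : realType) (d : nat) (A : 'M[R]_d) (c : R) v :
  0 <= c -> (forall j k, `|A j k| <= c) -> norm2 (A *m v) <= d%:R * c * norm2 v.
Proof.
move=> c0 hA.
have h j : `|(A *m v) j 0| <= Num.sqrt d%:R * c * norm2 v.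
  have -> : (A *m v) j 0 = dot (\col_k A j k) v.
    by rewrite mxE; apply: eq_bigr => k _; rewrite mxE.
  apply: (le_trans (cauchy_schwarz_abs _ _)); rewrite ler_wpM2r ?norm2_ge0 //.
  by apply: norm2_le_coords => // k; rewrite mxE.
apply: (le_trans (norm2_le_coords _ h)).
  by rewrite !mulr_ge0 ?sqrtr_ge0 ?norm2_ge0.
by rewrite mulrA mulrA -expr2 sqr_sqrtr.
Qed.

Section Rate.
Variable R : realType.

(** Squaring gives N^2 >= C^2 x^(4/3) >= C x. The bias is of order d n^-2, so a lower bound on n^2
    is what makes it small. *)
Lemma powR_two_thirds_sample (C x N : R) : 1 <= C -> 1 <= x ->
  C * x `^ (2 / 3) <= N -> C <= N /\ C * x <= N ^+ 2.
Proof.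
move=> C1 x1 hN; have x0 : 0 <= x by rewrite (le_trans _ x1).
have C0 : 0 <= C by rewrite (le_trans _ C1).
have y1 : 1 <= x `^ (2 / 3).
  by rewrite -[X in X <= _](powRr0 x) ler_powR // divr_ge0.
have y2 : x <= (x `^ (2 / 3)) ^+ 2.
  rewrite -powR_mulrn ?powR_ge0 // -powRrM -{1}(powRr1 x0) ler_powR //; lra.
split; first by apply: le_trans hN; rewrite ler_peMr.
have Cy0 : 0 <= C * x `^ (2 / 3) by rewrite mulr_ge0 ?powR_ge0.
apply: (@le_trans _ _ ((C * x `^ (2 / 3)) ^+ 2)); last first.
  by rewrite ler_sqr ?nnegrE // (le_trans Cy0).
rewrite exprMn ler_pM // expr2 ler_peMl //.
Qed.

Lemma powR_three_halves_le (n : nat) : (0 < n)%N ->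
  0 < n%:R `^ (3 / 2) :> R /\ n%:R `^ (3 / 2) <= n%:R ^+ 2 :> R.
Proof.
move=> n0; split; first by rewrite powR_gt0 // ltr0n.
by rewrite -powR_mulrn // ler_powR ?ler1n //; lra.
Qed.

End Rate.

(** * Error bound for sub-Gaussian data *)

Section SubGaussian.
Context (R : realType) (dT dS : measure_display).
Context (T : measurableType dT) (S : measurableType dS).
Context (P : probability T R) (n d : nat).
Variables (X : 'I_n -> {RV P >-> d.-tuple R}) (eps : 'I_n -> {RV P >-> R}).
Variables (xiX xiX2 : 'I_n -> 'I_d -> {RV P >-> S}) (xiY : 'I_n -> {RV P >-> S}).
Variables (QX QX2 QY : R -> S -> R).
Variables (Sigma : 'M[R]_d) (beta : 'cV[R]_d) (C0 K Kbar Keps s sigma : R).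
Variable bh : T -> 'cV[R]_d.

Definition moment_bias_constant : R := 4 * (K + 1) ^+ 4 + 6.

Definition cross_bias_constant : R :=
  2^-1 * (response_moment Kbar Keps s sigma + 4 * (K + 1) ^+ 4) + 6.

(** The 2 gives n > 1, the middle term keeps the matrix bias below [lambda_min] / 8, and the
    exponential makes ln n large enough for r^2 >= 1. *)
Definition sample_constant : R :=
  2 + 8 * moment_bias_constant + expR (8 * C0 * K ^+ 2)^-1.

Lemma moment_bias_constant_gt0 : 0 < moment_bias_constant.
Proof.
have : 0 <= (K + 1) ^+ 4 by rewrite exprn_even_ge0.
by rewrite /moment_bias_constant; lra.
Qed.

Lemma cross_bias_constant_ge0 : 0 <= cross_bias_constant.
Proof.
have e4 (x : R) : 0 <= x ^+ 4 by rewrite exprn_even_ge0.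
rewrite /cross_bias_constant /response_moment.
have h1 := mulr_ge0 (e4 s) (e4 (Kbar + 1)).
have h2 := mulr_ge0 (e4 sigma) (e4 (Keps + 1)).
by have h3 := e4 (K + 1); lra.
Qed.

Lemma sample_constant_ge : [/\ 2 <= sample_constant,
  8 * moment_bias_constant <= sample_constant &
  expR (8 * C0 * K ^+ 2)^-1 <= sample_constant].
Proof.
have h1 := moment_bias_constant_gt0; have h2 := expR_ge0 (8 * C0 * K ^+ 2)^-1.
by rewrite /sample_constant; split; lra.
Qed.

Lemma subgaussian_error (n_gt0 : (0 < n)%N) :
  let i1 := Ordinal n_gt0 in
  let r := range_X n d C0 K 3 in
  let L := range_Y n C0 Kbar Keps s sigma 3 in
  universal_tail_constant C0 -> (0 < d)%N -> 0 <= sigma ->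
  random_design X Sigma ->
  (forall i j, 'V_P[fun w => tnth (X i w) j] = 1%E) ->
  posdefmx Sigma -> standardized_noise eps ->
  independent_model X eps xiX xiX2 xiY ->
  \big[maxe/0%E]_(j < d) psi2 P (fun w => tnth (X i1 w) j) = K%:E ->
  psi2_vec P (fun w => invmx (sqrtmx Sigma) *m colvec (X i1 w)) = Kbar%:E ->
  psi2 P (eps i1) = Keps%:E -> norm2 (sqrtmx Sigma *m beta) = s ->
  dithered_quantizers xiX xiX2 xiY QX QX2 QY r L ->
  is_estimator X eps xiX xiX2 xiY QX QX2 QY beta sigma r bh ->
  sample_size_condition n Sigma r ->
  sample_constant * ((lambda_min Sigma)^-1 * d%:R * Num.max (s + sigma) 1) `^ (2 / 3)
    <= n%:R ->
  with_prob_at_least P (1 - 2 / n%:R)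
    [set w | norm2 (bh w - beta) <= 2 * err n Sigma beta r L +
      `|8 / lambda_min Sigma * (moment_bias_constant * norm2 beta + cross_bias_constant)| *
      (d%:R / n%:R `^ (3 / 2))].
Proof.
move=> i1 r L hC d0 sigma0 design unit_var pS noise indep hK hKbar hKeps hs quant est ss.
have [lam0 lamP] := lambda_minP d0 pS; move: lam0 lamP.
set lam := lambda_min Sigma => lam0 lamP hn.
have diag := Sigma_diag n_gt0 design unit_var.
have lam1 : lam <= 1 by rewrite -(diag (Ordinal d0)) lambda_min_le_diag.
have C00 : 0 < C0 by case: hC.
have D1 : 1 <= d%:R :> R by rewrite ler1n.
set c1 := moment_bias_constant; set c2 := cross_bias_constant.
have c10 : 0 < c1 by exact: moment_bias_constant_gt0.
have c20 : 0 <= c2 by exact: cross_bias_constant_ge0.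
have [C2 C8 Cexp] := sample_constant_ge.
set x := lam^-1 * d%:R * Num.max (s + sigma) 1 in hn.
have lamV : 1 <= lam^-1 by rewrite invf_ge1.
have xd : lam^-1 * d%:R <= x.
  have h0 : 0 <= lam^-1 * d%:R by rewrite mulr_ge0 ?invr_ge0 // ltW.
  by rewrite /x ler_peMr // le_max lexx orbT.
have x1 : 1 <= x by rewrite (le_trans _ xd) // mulr_ege1.
have C1 : 1 <= sample_constant by rewrite (le_trans _ C2) // ler1n.
have [Cn Cn2] := powR_two_thirds_sample C1 x1 hn.
have n1 : (1 < n)%N by rewrite -(ltr_nat R) (lt_le_trans _ (le_trans C2 Cn)) // ltr1n.
have N0 : 0 < n%:R :> R by rewrite ltr0n.
have N2 : 0 < n%:R ^+ 2 :> R by rewrite exprn_gt0.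
set h : R := (n%:R ^+ 2)^-1.
have h0 : 0 < h by rewrite invr_gt0.
have bias_small : d%:R * (h * c1) <= lam / 8.
  have e : 8 * c1 * (lam^-1 * d%:R) <= n%:R ^+ 2.
    apply: le_trans Cn2; rewrite ler_pM // ?mulr_ge0 ?invr_ge0 ?(ltW lam0) ?(ltW c10) //.
  have -> : d%:R * (h * c1) = (8 * c1 * (lam^-1 * d%:R)) * (lam / 8) * h.
    by field; rewrite gt_eqF.
  by rewrite /h ler_pdivrMr // mulrC ler_pM2l // divr_gt0.
have mb i j k := moment_bias hC n1 d0 design unit_var hK i j k.
have cb i j := cross_bias hC n1 d0 sigma0 design unit_var pS noise indep hK hKbar hKeps hs i j.
have L0 : 0 <= L by exact: (range_Y_ge0 n Kbar Keps hC sigma0 hs).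
have K1 : 1 <= K.
  have [mZ _ Z2 ZK] := coord_unit_subgaussian design unit_var hK i1 (Ordinal d0).
  by rewrite -lee_fin (le_trans (psi2_ge1 mZ Z2)).
have K0 : 0 < K by rewrite (lt_le_trans _ K1).
have q0 : 0 < 8 * C0 * K ^+ 2 by rewrite !mulr_gt0.
(* r^2 = 8 C0 K^2 ln (n d) reaches 1, and the unit diagonal of Sigma keeps [lam] at most 1, so [lam]
   <= r^2. *)
have r1 : 1 <= r ^+ 2.
  have lnn : (8 * C0 * K ^+ 2)^-1 <= ln n%:R.
    by rewrite -[leLHS]expRK ler_ln ?posrE ?expR_gt0 // (le_trans Cexp).
  have lnd : ln n%:R <= ln (n * d)%:R :> R.
    rewrite ler_ln ?posrE ?ltr0n ?muln_gt0 ?n_gt0 // ler_nat.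
    by rewrite -[X in (X <= _)%N]muln1 leq_mul2l d0 orbT.
  have e : 1 <= (8 * C0 * K ^+ 2) * ln (n * d)%:R.
    by rewrite mulrC -ler_pdivrMr // mul1r (le_trans lnn).
  rewrite /r /range_X sqr_sqrtr; last first.
    rewrite (_ : _ * ln _ = (8 * C0 * K ^+ 2) * ln (n * d)%:R); first by rewrite (le_trans _ e).
    by rewrite /Ckappa; ring.
  by apply: (le_trans e); rewrite le_eqVlt; apply/orP; left; apply/eqP; rewrite /Ckappa; ring.
have r0 : 0 < r.
  have := range_X_ge0 n d C0 K; rewrite -/r le_eqVlt => /orP [/eqP e|//].
  by move: r1; rewrite -e expr0n /= ler10.
have lamr : lam <= r ^+ 2 by rewrite (le_trans lam1).
have dq i v : `|qform (clip_moment X r i) v - qform Sigma v| <= lam / 8 * norm2 v ^+ 2.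
  have -> : qform (clip_moment X r i) v - qform Sigma v =
      dot v ((clip_moment X r i - Sigma) *m v) by rewrite mulmxBl dotBr.
  apply: (le_trans (cauchy_schwarz_abs _ _)).
  rewrite expr2 mulrA mulrC ler_wpM2r ?norm2_ge0 //.
  apply: (@le_trans _ _ (d%:R * (h * c1) * norm2 v)).
    apply: norm2_mulmx_le_entries; first by rewrite mulr_ge0 // ltW.
    by move=> j k; rewrite [X in `|X|]mxE [X in _ + X]mxE; exact: mb.
  by rewrite ler_wpM2r ?norm2_ge0.
pose b := d%:R * h * (c1 * norm2 beta + c2).
have b0 : 0 <= b.
  by rewrite !mulr_ge0 ?(ltW h0) // addr_ge0 // mulr_ge0 ?norm2_ge0 // ltW.
(* An eighth of [lam] is lost to bias. Then l - lam / 2 = 3/8 lam exceeds lam / 4, which doubles the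
   factor 2 / lam of [err] and turns 2 b into 8 b / lam. *)
pose l := lam * (7 / 8).
have ll : lam / 2 < l by rewrite /l; lra.
have n_sum (c : R) : n%:R * c = \sum_(i < n) c by rewrite sumr_const card_ord mulr_natl.
have res := estimator_error (l := l) (b := b) n_gt0 d0 r0 L0 indep quant est lam0 lamr ss ll b0.
apply: (with_prob_at_leastW (res _ _ _)) => //.
- move=> v; rewrite -mulrA n_sum; apply: ler_sum => i _.
  have /ler_normlP [_ h1] := dq i v; have h2 := qform_le_opnorm Sigma v.
  have h3 : lam / 8 * norm2 v ^+ 2 <= r ^+ 2 * norm2 v ^+ 2.
    by rewrite ler_wpM2r ?sqr_ge0 // (le_trans _ lamr) // ger_pMr // invf_le1 // ler1n.
  by rewrite mulrDl; lra.
- move=> v; rewrite -mulrA n_sum; apply: ler_sum => i _.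
  by have /ler_normlP [h1 _] := dq i v; have h2 := lamP v; rewrite /l; lra.
- move=> i; rewrite (_ : _ - _ = (clip_moment X r i - Sigma) *m beta -
    (clip_cross X eps beta sigma r L i - Sigma *m beta)); last first.
    by rewrite mulmxBl opprB addrA subrK.
  apply: (le_trans (norm2B _ _)).
  have e1 : norm2 ((clip_moment X r i - Sigma) *m beta) <= d%:R * (h * c1) * norm2 beta.
    apply: norm2_mulmx_le_entries; first by rewrite mulr_ge0 // ltW.
    by move=> j k; rewrite [X in `|X|]mxE [X in _ + X]mxE; exact: mb.
  have e2 : norm2 (clip_cross X eps beta sigma r L i - Sigma *m beta) <= d%:R * (h * c2).
    have hc : 0 <= h * c2 by rewrite mulr_ge0 // ltW.
    apply: (le_trans (norm2_le_coords hc _)).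
      by move=> j; rewrite [X in `|X|]mxE [X in _ + X]mxE; exact: cb.
    rewrite ler_wpM2r // -[leRHS]ger0_norm // -sqrtr_sqr ler_sqrt ?sqr_ge0 //.
    by rewrite expr2 ler_peMr.
  by rewrite /b; lra.
move=> w /= /le_trans; apply.
set E := err_scale _ _ _ _ _.
have E0 : 0 <= E.
  have M0 : 0 <= log_max R n d by rewrite (le_trans _ (log_max_ge0 R n d0)).
  rewrite /E /err_scale addr_ge0 ?sqrtr_ge0 // addr_ge0 // mulr_ge0 ?norm2_ge0 ?sqrtr_ge0 //.
  by rewrite divr_ge0 // mulr_ge0 // mulr_ge0 ?sqr_ge0.
have errE : err n Sigma beta r L = 2 / lam * E by [].
rewrite errE.
have lb : (E + 2 * b) / (l - lam / 2) <= (E + 2 * b) / (lam / 4).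
  apply: ler_wpM2l; first by rewrite addr_ge0 // mulr_ge0.
  by rewrite lef_pV2 ?posrE ?divr_gt0 ?subr_gt0 // -/lam /l; lra.
apply: (le_trans lb).
have [pn0 pn] := @powR_three_halves_le R n n_gt0.
have cc : 0 <= 8 / lam * (c1 * norm2 beta + c2).
  by rewrite mulr_ge0 ?divr_ge0 ?(ltW lam0) // addr_ge0 // mulr_ge0 ?norm2_ge0 // ltW.
have -> : (E + 2 * b) / (lam / 4) =
    2 * (2 / lam * E) + 8 / lam * (c1 * norm2 beta + c2) * (d%:R * h).
  by rewrite /b; field; rewrite gt_eqF.
by rewrite lerD2l (ger0_norm cc) ler_wpM2l // ler_wpM2l // /h lef_pV2 ?posrE //.
Qed.

End SubGaussian.

Theorem theorem2 (R : realType) :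
  (* (I) fixed range, random or fixed design *)
  (forall (n d : nat) (dT dS : measure_display)
      (T : measurableType dT) (S : measurableType dS) (P : probability T R)
      (X : 'I_n -> {RV P >-> d.-tuple R}) (eps : 'I_n -> {RV P >-> R})
      (xiX xiX2 : 'I_n -> 'I_d -> {RV P >-> S}) (xiY : 'I_n -> {RV P >-> S})
      (QX QX2 QY : R -> S -> R)
      (Sigma : 'M[R]_d) (beta : 'cV[R]_d) (sigma r L : R)
      (beta_hat : T -> 'cV[R]_d),
    (0 < n)%N -> (0 < d)%N -> 0 <= sigma -> 0 < r -> 0 < L ->
    random_design X Sigma \/ fixed_design X Sigma ->
    posdefmx Sigma ->
    standardized_noise eps ->
    independent_model X eps xiX xiX2 xiY ->
    dithered_quantizers xiX xiX2 xiY QX QX2 QY r L ->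
    is_estimator X eps xiX xiX2 xiY QX QX2 QY beta sigma r beta_hat ->
    bounded_data X eps beta sigma r L ->
    sample_size_condition n Sigma r ->
    with_prob_at_least P (1 - 2 / n%:R)
      [set w | norm2 (beta_hat w - beta) <= err n Sigma beta r L])
  /\
  (* (II) unbounded sub-Gaussian case, random design *)
  (forall C0 : R, universal_tail_constant C0 ->
   forall K Kbar Keps : R,
   exists C : R, 0 < C /\
   forall lmin norm_beta norm_Sbeta sigma : R,
   exists M : R, 0 <= M /\
   forall (n d : nat) (dT dS : measure_display)
      (T : measurableType dT) (S : measurableType dS) (P : probability T R)
      (X : 'I_n -> {RV P >-> d.-tuple R}) (eps : 'I_n -> {RV P >-> R})
      (xiX xiX2 : 'I_n -> 'I_d -> {RV P >-> S}) (xiY : 'I_n -> {RV P >-> S})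
      (QX QX2 QY : R -> S -> R)
      (Sigma : 'M[R]_d) (beta : 'cV[R]_d) (beta_hat : T -> 'cV[R]_d)
      (n_gt0 : (0 < n)%N),
    let i1 := Ordinal n_gt0 in
    let Rn := range_X n d C0 K 3 in
    let Ln := range_Y n C0 Kbar Keps norm_Sbeta sigma 3 in
    (0 < d)%N -> 0 <= sigma ->
    random_design X Sigma ->
    (forall i j, 'V_P[fun w => tnth (X i w) j] = 1%E) ->
    posdefmx Sigma ->
    standardized_noise eps ->
    independent_model X eps xiX xiX2 xiY ->
    (psi2_vec P (fun w => colvec (X i1 w)) < +oo)%E ->
    \big[maxe/0%E]_(j < d) psi2 P (fun w => tnth (X i1 w) j) = K%:E ->
    psi2_vec P (fun w => invmx (sqrtmx Sigma) *m colvec (X i1 w)) = Kbar%:E ->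
    psi2 P (eps i1) = Keps%:E ->
    lambda_min Sigma = lmin ->
    norm2 beta = norm_beta ->
    norm2 (sqrtmx Sigma *m beta) = norm_Sbeta ->
    dithered_quantizers xiX xiX2 xiY QX QX2 QY Rn Ln ->
    is_estimator X eps xiX xiX2 xiY QX QX2 QY beta sigma Rn beta_hat ->
    sample_size_condition n Sigma Rn ->
    C * (lmin^-1 * d%:R * Num.max (norm_Sbeta + sigma) 1) `^ (2 / 3) <= n%:R ->
    with_prob_at_least P (1 - 6 / n%:R - 2 / (n * d)%:R)
      [set w | norm2 (beta_hat w - beta) <=
        2 * err n Sigma beta Rn Ln + M * (d%:R / n%:R `^ (3 / 2))]).
Proof.
split.
  move=> n d dT dS T S P X eps xiX xiX2 xiY QX QX2 QY Sigma beta sigma r L bh.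
  move=> n0 d0 _ r0 L0; exact: part_fixed_range.
move=> C0 hC K Kbar Keps; exists (sample_constant C0 K).
have [C2 _ _] := sample_constant_ge C0 K.
split; first exact: lt_le_trans C2.
move=> lmin norm_beta norm_Sbeta sigma.
(* The absolute value makes the witness nonnegative for every real [lmin], which is fixed before it
   is known to be an eigenvalue. *)
exists `|8 / lmin * (moment_bias_constant K * norm_beta +
  cross_bias_constant K Kbar Keps norm_Sbeta sigma)|; split=> //.
move=> n d dT dS T S P X eps xiX xiX2 xiY QX QX2 QY Sigma beta bh n0 i1 r L d0 sigma0.
move=> design unit_var pS noise indep _ hK hKbar hKeps <- <- hs quant est ss hn.
have E := subgaussian_error hC d0 sigma0 design unit_var pS noise indep
  hK hKbar hKeps hs quant est ss hn.
(* The bound already holds with probability at least 1 - 2/n, since no probability is spent on the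
   data staying in range. *)
apply: (with_prob_at_leastW E) => //.
have h1 : 0 <= 1 / n%:R :> R by rewrite divr_ge0.
have h2 : 0 <= 1 / (n * d)%:R :> R by rewrite divr_ge0.
lra.
Qed.
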